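(* The rotational symmetry group $H\subset O(3)$ of the regular icosahedron centered at the origin, in its standard action on $\mathbb{R}^3$, has property $(\mathcal{B}_{15})$.
   Context: For an orthogonal representation $G\to O(V)$ of a finite group, let $\sigma_1,\ldots,\sigma_m$ be homogeneous generators of positive degree of the algebra $\mathbb{R}[V]^G$ of invariant polynomials and $\sigma=(\sigma_1,\ldots,\sigma_m):V\to\mathbb{R}^m$ the orbit map; $V/G$ is identified with $\sigma(V)\subseteq\mathbb{R}^m$ via the homeomorphism induced by $\sigma$. A curve in $V/G$ is of class $C^k$ if it is $C^k$ as a curve in $\mathbb{R}^m$ (independent of the choice of generators). A lift of a curve $c$ in $\sigma(V)$ is a curve $\bar c$ in $V$ with $\sigma\circ\bar c=c$; a local lift near $t_0$ is a lift of the restriction of $c$ to an open neighborhood of $t_0$. A differentiable lift has locally bounded derivative if $\|\bar c'\|$ is bounded on compact subsets of its domain. The representation has property $(\mathcal{B}_k)$ if there exists a neighborhood $U$ of $0$ in $V/G=\sigma(V)$ such that each $C^k$-curve in $U$ admits (near each parameter value) a local differentiable lift to $V$ with locally bounded derivative. *)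

(* Defs.v *)
From HB Require Import structures.
From mathcomp Require Import all_boot all_order all_algebra.
From mathcomp Require Import all_classical all_reals all_analysis.
(* The notations of mpoly clash with those of mathcomp-analysis. *)
From mathcomp Require mpoly.
Import -(notations) mpoly.
Set Implicit Arguments.
Unset Strict Implicit.
Unset Printing Implicit Defensive.
Import Order.TTheory GRing.Theory Num.Theory.
Import numFieldNormedType.Exports.
Local Open Scope ring_scope.
Local Open Scope classical_set_scope.

Section Invariants.
Context {R : realType} {n : nat}.

Definition peval (p : mpoly n R) (x : 'cV[R]_n) : R :=
  meval (fun i => x i 0) p.

(* A representation enters the definitions below only through its image, the
   set [G] of matrices, which acts on column vectors by [A *m x]. *)
Definition invariant_poly (G : set 'M[R]_n) (p : mpoly n R) : Prop :=
  forall A, G A -> forall x, peval p (A *m x) = peval p x.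

Definition homogeneous_generators (G : set 'M[R]_n) (m : nat)
    (sigma : m.-tuple (mpoly n R)) : Prop :=
  [/\ forall i, invariant_poly G (tnth sigma i),
      forall i, exists2 d : nat, (0 < d)%N & tnth sigma i \is ishomog1 d mdeg
    & forall p, invariant_poly G p ->
        exists q : mpoly m R, p = comp_mpoly sigma q].

Definition orbit_map (m : nat) (sigma : m.-tuple (mpoly n R))
    (x : 'cV[R]_n) : 'cV[R]_m :=
  \col_i peval (tnth sigma i) x.

End Invariants.

Section Curves.
Context {R : realType}.

(* Curves are total functions of which only the values on the open domain [I]
   are used. *)
Definition Ck_curve (m : nat) (k : nat) (I : set R) (c : R -> 'cV[R]_m) : Prop :=
  (forall j, (j < k)%N -> forall t, I t -> derivable (c^`(j)) t 1) /\
  (forall t, I t -> {for t, continuous (c^`(k))}).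

(* The norm is the sup norm of matrices, equivalent to the Euclidean one. *)
Definition differentiable_locally_bounded (n : nat) (J : set R)
    (c : R -> 'cV[R]_n) : Prop :=
  (forall t, J t -> derivable c t 1) /\
  (forall K, compact K -> K `<=` J -> [bounded c^`() t | t in K]).

Definition property_B (n : nat) (G : set 'M[R]_n) (k : nat) : Prop :=
  forall (m : nat) (sigma : m.-tuple (mpoly n R)),
    homogeneous_generators G sigma ->
    exists U : set 'cV[R]_m,
      [/\ U `<=` range (orbit_map sigma),
          within (range (orbit_map sigma)) (nbhs (0 : 'cV[R]_m)) U
        & forall (I : set R) (c : R -> 'cV[R]_m),
            open I -> is_interval I -> Ck_curve k I c ->
            (forall t, I t -> U (c t)) ->
            forall t0, I t0 ->
            exists (J : set R) (cbar : R -> 'cV[R]_n),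
              [/\ open J, J t0 & J `<=` I] /\
              [/\ forall t, J t -> orbit_map sigma (cbar t) = c t
                & differentiable_locally_bounded J cbar]].

End Curves.

Section Icosahedron.
Context {R : realType}.

Definition vec3 (x y z : R) : 'cV[R]_3 := \col_(i < 3) [:: x; y; z]`_i.

Definition golden : R := (1 + Num.sqrt 5) / 2.

Definition icosahedron_vertices : set 'cV[R]_3 :=
  [set v | exists e f : bool,
     let a := (-1) ^+ e in
     let b := (-1) ^+ f * golden in
     [\/ v = vec3 0 a b, v = vec3 a b 0 | v = vec3 b 0 a]].

Definition convex_hull_of (n : nat) (X : set 'cV[R]_n) : set 'cV[R]_n :=
  [set v | exists (N : nat) (w : 'I_N -> R) (x : 'I_N -> 'cV[R]_n),
     [/\ forall i, 0 <= w i, \sum_i w i = 1, forall i, X (x i)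
       & v = \sum_i w i *: x i]].

Definition orthogonal_mx (n : nat) (A : 'M[R]_n) : Prop := A *m A^T = 1%:M.

(* The origin-centred regular icosahedra are the images of the standard one
   under the linear similarities. *)
Definition regular_icosahedron (P : set 'cV[R]_3) : Prop :=
  exists (s : R) (Q : 'M[R]_3),
    [/\ 0 < s, orthogonal_mx Q
      & P = [set s *: (Q *m x) | x in convex_hull_of icosahedron_vertices]].

Definition rotational_symmetries (P : set 'cV[R]_3) : set 'M[R]_3 :=
  [set A | [/\ orthogonal_mx A, \det A = 1 & [set A *m x | x in P] = P]].

End Icosahedron.

(* Main.v *)
Require Import Defs.
From HB Require Import structures.
From mathcomp Require Import all_boot all_order all_algebra.
From mathcomp Require Import all_classical all_reals all_analysis.
From mathcomp Require Import ring lra zify.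
From mathcomp Require mpoly.
Import -(notations) mpoly.
Set Implicit Arguments.
Unset Strict Implicit.
Unset Printing Implicit Defensive.
Import Order.TTheory GRing.Theory Num.Theory.
Import numFieldNormedType.Exports.
Local Open Scope ring_scope.
Local Open Scope classical_set_scope.

(** The symmetries permute the twelve vertices and form a finite group of
    rotations, which is used only through two bounds: its invariants are
    generated by forms of degree at most [15], and the stabiliser of a nonzero
    point has at most [15] elements. The second holds because a stabiliser acts
    freely on the vertices off its axis ([symmetry_stab]). For the first,
    the squared norm and the sums of the sixth and tenth powers of the linear forms given by the vertices
    generate an ideal that contains all forms of degree above [15]
    ([ideal_all]), and averaging over the group turns this into a statement on
    generators ([gen_of_ideal], [symmetry_gen]).

    Let [x] be an arbitrary choice of points over the given curve. Invariant
    polynomials of [x] have bounded derivatives up to order [15]. This implies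
    that the curve of orbits has a velocity at each parameter, up to the group
    ([orbit_jet]). At a zero, invariant forms of degree [k] at most [15] have
    quotients by the power [k] of the parameter that converge, which determines
    the limit orbit of the difference quotient ([jet_zero]). At a nonzero value
    [e], the same argument applies to the polynomials whose roots are the values
    of a linear form on the orbit: with a suitable moving argument they vanish to
    the order of the stabiliser of [e] ([jet_nonzero]). Velocities at each
    parameter are enough for a differentiable lift, by induction on the order of
    the group and by gluing local lifts ([lift_of_jets], [glue_lifts]).

    It remains to bound the velocity of such a lift ([speed_bound]). Rescaling
    space and time by the norm of the starting point keeps the velocity, moves
    the starting point to the unit sphere and keeps the invariants bounded,
    since generators of degree at most [15] have as many derivatives as their
    degree ([rescaled_bounds]). Near a point of the sphere the root polynomials
    and Landau's inequality between the bounds of derivatives control the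
    velocity ([local_speed_bound]), and the sphere is compact. *)

(** * Differentiation of curves *)

Section Dif.
Context {R : realType} {V : normedModType R}.
Implicit Types (f g : R -> V) (t : R) (v w : V).

(** The derivative in epsilon-delta form, in which it is compared below with
    expansions that hold only up to the action of a group. *)
Definition dif f t v := forall e : R, 0 < e -> exists2 d : R, 0 < d &
  forall h, `|h| < d -> `|f (t + h) - f t - h *: v| <= e * `|h|.

Lemma diff_quotientE (h : R) (u v : V) : h != 0 ->
  v - h^-1 *: u = - (h^-1 *: (u - h *: v)).
Proof. by move=> h0; rewrite (scalerBr _ u) scalerA mulVf// scale1r opprB. Qed.

Lemma difP f t v : dif f t v <-> is_derive t 1 f v.
Proof.
split=> [D | D e e0].
- have L : (fun h => h^-1 *: ((f \o shift t) (h *: 1) - f t)) @ 0^' --> v.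
    apply/cvgrPdist_le => /= e e0; have [d d0 Dd] := D _ e0.
    exists d => //= h /=; rewrite sub0r normrN => hd h0.
    rewrite [h *: 1]mulr1 [h + t]addrC diff_quotientE// normrN normrZ normfV ler_pdivrMl ?normr_gt0// mulrC.
    exact: Dd.
  by apply: DeriveDef; [apply/cvg_ex; exists v | exact: cvg_lim].
- have /cvg_ex[/= l Dl] : cvg ((fun h => h^-1 *: ((f \o shift t) (h *: 1) - f t)) @ 0^').
    by case: D.
  have vl : v = l.
    by have := @derive_val _ _ _ _ _ _ _ D; rewrite /derive (cvg_lim _ Dl).
  move/cvgrPdist_le : Dl => /(_ e e0)[/= d d0 dle].
  exists d => // h hd; have [->|h0] := eqVneq h 0.
    by rewrite addr0 scale0r subrr subr0 !normr0 mulr0.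
  have := dle h; rewrite /= sub0r normrN => /(_ hd h0).
  by rewrite -?vl [h *: 1]mulr1 [h + t]addrC diff_quotientE// normrN normrZ normfV ler_pdivrMl ?normr_gt0// mulrC.
Qed.

Lemma dif_unique f t v w : dif f t v -> dif f t w -> v = w.
Proof.
move=> /difP Dv /difP Dw.
by rewrite -(@derive_val _ _ _ _ _ _ _ Dv) (@derive_val _ _ _ _ _ _ _ Dw).
Qed.

Lemma dif_near f g t v : (exists2 d : R, 0 < d & forall s, `|s - t| < d -> f s = g s) ->
  dif f t v -> dif g t v.
Proof.
move=> [d d0 fg] D e e0; have [d' d'0 Dd] := D e e0.
exists (Num.min d d') => [|h]; first by rewrite lt_min d0.
rewrite lt_min => /andP[hd hd']; rewrite -!fg ?subrr ?normr0//; first exact: Dd.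
by rewrite addrAC subrr add0r.
Qed.

Lemma dif_cst v t : dif (fun=> v) t 0.
Proof. by apply/difP; exact: is_derive_cst. Qed.

Lemma difD f g t v w : dif f t v -> dif g t w -> dif (fun s => f s + g s) t (v + w).
Proof. by move=> /difP ? /difP ?; apply/difP; exact: is_deriveD. Qed.

Lemma difB f g t v w : dif f t v -> dif g t w -> dif (fun s => f s - g s) t (v - w).
Proof. by move=> /difP ? /difP ?; apply/difP; exact: is_deriveB. Qed.

Lemma dif_lip f t v : dif f t v -> exists2 d : R, 0 < d &
  forall h, `|h| < d -> `|f (t + h) - f t| <= (1 + `|v|) * `|h|.
Proof.
move=> /(_ 1 ltr01)[d d0 D]; exists d => // h /D hd.
have := ler_normD (f (t + h) - f t - h *: v) (h *: v).
rewrite subrK normrZ => /le_trans; apply; rewrite mulrDl mul1r.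
by rewrite (mulrC `|v|) lerD2r; rewrite mul1r in hd.
Qed.

Lemma dif_affine f (a b t : R) v : dif f (a + b * t) v ->
  dif (fun s => f (a + b * s)) t (b *: v).
Proof.
move=> D e e0; have b1 : 0 < `|b| + 1 by rewrite ltr_wpDl.
have [d d0 Dd] := D _ (divr_gt0 e0 b1).
exists (d / (`|b| + 1)) => [|h]; first exact: divr_gt0.
rewrite ltr_pdivlMr// => hd.
have := Dd (b * h); rewrite normrM.
have -> : a + b * t + b * h = a + b * (t + h) by rewrite mulrDr addrA.
have bh : `|b| * `|h| <= `|h| * (`|b| + 1).
  by rewrite mulrC mulrDr mulr1 lerDl.
move=> /(_ (le_lt_trans bh hd)); rewrite scalerA (mulrC h) => /le_trans; apply.
by rewrite mulrAC ler_pdivrMr// -mulrA ler_wpM2l// ltW.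
Qed.

End Dif.

Section DifScalar.
Context {R : realType}.

Lemma difM (f g : R -> R) t v w : dif f t v -> dif g t w ->
  dif (fun s => f s * g s) t (v * g t + f t * w).
Proof.
move=> /difP ? /difP ?; apply/difP; apply: is_derive_eq.
by rewrite addrC; congr (_ + _); rewrite mulrC.
Qed.

Lemma dif_id (t : R) : dif (fun s : R => s) t 1.
Proof. by apply/difP; exact: is_derive_id. Qed.

Lemma dif_exp n (t : R) : dif (fun s : R => s ^+ n.+1) t (n.+1%:R * t ^+ n).
Proof.
elim: n => [|n IH].
  by rewrite expr0 mulr1; exact: dif_id.
have := difM (dif_id t) IH.
have -> : (fun s : R => s * s ^+ n.+1) = (fun s : R => s ^+ n.+2).
  by apply/funext => s; rewrite -exprS.
by have -> : 1 * t ^+ n.+1 + t * (n.+1%:R * t ^+ n) = n.+2%:R * t ^+ n.+1;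
  [rewrite exprS -(natr1 n.+1); ring|].
Qed.

Lemma dif_mvt (f df : R -> R) a b : a < b ->
  (forall s, a <= s <= b -> dif f s (df s)) ->
  exists2 c, a < c < b & f b - f a = df c * (b - a).
Proof.
move=> ab D.
have [||c cab E] := @MVT R f df a b ab.
- move=> x; rewrite in_itv/= => /andP[ax xb]; apply/difP/D.
  by rewrite !ltW.
- apply: derivable_within_continuous => x; rewrite in_itv/= => xab.
  by have /difP[] := D _ xab.
by exists c => //; rewrite in_itv/= in cab.
Qed.

(** The indicator function of the property has derivative zero. *)
Lemma locally_constant (P : R -> Prop) (a b : R) :
  (forall t, a < t < b -> exists2 d : R, 0 < d &
     forall s, a < s < b -> `|s - t| < d -> P s <-> P t) ->
  forall s t, a < s < b -> a < t < b -> P s -> P t.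
Proof.
move=> loc; pose f (t : R) : R := if `[< P t >] then 1 else 0.
have D t : a < t < b -> dif f t 0.
  move=> /[dup] tab /andP[ta tb]; have [d d0 dP] := loc t tab.
  pose d' := Num.min d (Num.min (t - a) (b - t)).
  apply: (@dif_near _ _ (fun=> f t)); last exact: dif_cst.
  exists d' => [|s]; first by rewrite !lt_min d0 !subr_gt0 ta.
  rewrite !lt_min => /and3P[sd sa sb].
  have sab : a < s < b.
    by move: sa sb; rewrite !ltr_norml => /andP[? ?] /andP[? ?]; apply/andP; split; lra.
  have := dP s sab sd; rewrite /f => st.
  by case: asboolP; case: asboolP => //; tauto.
suff E s t : a < s < b -> a < t < b -> s < t -> f s = f t.
  move=> s t sab tab; case: (ltgtP s t) => [st|ts|<-//].
    have := E _ _ sab tab st; rewrite /f; case: asboolP => //; case: asboolP => //.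
    by move=> _ _ /eqP; rewrite oner_eq0.
  have := E _ _ tab sab ts; rewrite /f; case: asboolP => //; case: asboolP => //.
  by move=> _ _ /eqP; rewrite eq_sym oner_eq0.
move=> /andP[sa sb] /andP[ta tb] st.
have [|c _ ] := @dif_mvt f (fun=> 0) s t st.
  by move=> u /andP[su ut]; apply: D; apply/andP; split; lra.
by rewrite mul0r => /eqP; rewrite subr_eq0 => /eqP.
Qed.

End DifScalar.

Section MatrixNorm.
Context {R : realType}.

Lemma normr_coord m n (A : 'M[R]_(m, n)) i j : `|A i j| <= `|A|.
Proof.
rewrite [leRHS]/Num.Def.normr/= mx_normrE.
exact: (le_bigmax _ (fun k : 'I_m * 'I_n => `|A k.1 k.2|) (i, j)).
Qed.

Lemma normr_le_coord m n (A : 'M[R]_(m, n)) (c : R) : 0 <= c ->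
  (forall i j, `|A i j| <= c) -> `|A| <= c.
Proof.
move=> c0 Ac; rewrite [leLHS]/Num.Def.normr/= mx_normrE.
by apply: bigmax_le => // i _; exact: Ac.
Qed.

Lemma mulmx_norm_le m n (A : 'M[R]_(m, n)) (x : 'cV[R]_n) :
  `|A *m x| <= n%:R * `|A| * `|x|.
Proof.
apply: normr_le_coord => [|i j]; first by rewrite !mulr_ge0.
rewrite mxE (le_trans (ler_norm_sum _ _ _))//.
rewrite -mulrA mulr_natl -[X in _ *+ X]card_ord -sumr_const ler_sum// => k _.
by rewrite normrM ler_pM ?normr_coord.
Qed.

Lemma seq_norm_bound n (G : seq 'M[R]_n) :
  exists2 C : R, 1 <= C & forall g, g \in G -> forall x : 'cV[R]_n, `|g *m x| <= C * `|x|.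
Proof.
elim: G => [|g G [C C1 GC]]; first by exists 1.
exists (C + n%:R * `|g|) => [|h].
  by rewrite (le_trans C1)// lerDl mulr_ge0.
rewrite inE => /orP[/eqP-> x|/GC hC x].
  by rewrite (le_trans (mulmx_norm_le _ _))// mulrDl lerDr mulr_ge0// (le_trans _ C1).
by rewrite (le_trans (hC x))// mulrDl lerDl !mulr_ge0.
Qed.

End MatrixNorm.

(** * Finite matrix groups *)

Section MxGroup.
Context {R : realType} {n : nat}.
Implicit Types (G : seq 'M[R]_n) (g h : 'M[R]_n) (x : R -> 'cV[R]_n).

(** The group is listed without repetition, so that [size] is its order and that
    sums and products over it can be reindexed. *)
Definition mxgroup G := [/\ uniq G, 1%:M \in G,
  forall g h, g \in G -> h \in G -> g *m h \in G &
  forall g, g \in G -> exists2 h, h \in G & h *m g = 1%:M].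

Definition same_orbit G (y z : 'cV[R]_n) := exists2 g, g \in G & y = g *m z.

Lemma same_orbit_refl G y : mxgroup G -> same_orbit G y y.
Proof. by case=> _ G1 _ _; exists 1%:M; rewrite ?mul1mx. Qed.

Lemma same_orbit_sym G y z : mxgroup G -> same_orbit G y z -> same_orbit G z y.
Proof.
move=> [_ _ _ GV] [g /GV[h hG hg] ->]; exists h => //.
by rewrite mulmxA hg mul1mx.
Qed.

Lemma same_orbit_trans G y z w : mxgroup G ->
  same_orbit G y z -> same_orbit G z w -> same_orbit G y w.
Proof.
move=> [_ _ GM _] [g gG ->] [h hG ->]; exists (g *m h); first exact: GM.
by rewrite mulmxA.
Qed.

Lemma same_orbit_mul G g y z : mxgroup G -> g \in G ->
  same_orbit G y z -> same_orbit G (g *m y) z.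
Proof. by move=> GG gG; apply: same_orbit_trans => //; exists g. Qed.

Lemma mxgroup_perm G g : mxgroup G -> g \in G -> perm_eq [seq h *m g | h <- G] G.
Proof.
move=> [Gu G1 GM GV] gG; have [k kG kg] := GV g gG.
have inj : injective (fun h => h *m g).
  move=> h1 h2 /(congr1 (mulmx^~ k)).
  by rewrite -!mulmxA (mulmx1C kg) !mulmx1.
apply: uniq_perm => //; first by rewrite map_inj_uniq.
move=> h; apply/mapP/idP => [[h' h'G ->]|hG]; first exact: GM.
by exists (h *m k); [exact: GM | rewrite -mulmxA kg mulmx1].
Qed.

Lemma mxgroup_perml G g : mxgroup G -> g \in G -> perm_eq [seq g *m h | h <- G] G.
Proof.
move=> [Gu G1 GM GV] gG; have [k kG kg] := GV g gG.
have inj : injective (fun h => g *m h).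
  move=> h1 h2 /(congr1 (mulmx k)).
  by rewrite !mulmxA kg !mul1mx.
apply: uniq_perm => //; first by rewrite map_inj_uniq.
move=> h; apply/mapP/idP => [[h' h'G ->]|hG]; first exact: GM.
by exists (k *m h); [exact: GM | rewrite mulmxA (mulmx1C kg) mul1mx].
Qed.

Definition stab G (y : 'cV[R]_n) := [seq g <- G | g *m y == y].

Lemma mem_stab G y g : (g \in stab G y) = (g \in G) && (g *m y == y).
Proof. by rewrite mem_filter andbC. Qed.

Lemma mxgroup_stab G y : mxgroup G -> mxgroup (stab G y).
Proof.
move=> [Gu G1 GM GV]; split.
- exact: filter_uniq.
- by rewrite mem_stab G1 mul1mx eqxx.
- move=> g h; rewrite !mem_stab => /andP[gG /eqP gy] /andP[hG /eqP hy].
  by rewrite GM// -mulmxA hy gy eqxx.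
- move=> g; rewrite mem_stab => /andP[gG /eqP gy].
  have [h hG hg] := GV g gG; exists h => //; rewrite mem_stab hG.
  by rewrite -{1}gy mulmxA hg mul1mx eqxx.
Qed.

End MxGroup.

Section CommonDelta.
Context {R : realType}.

Lemma common_delta (T : eqType) (s : seq T) (P : T -> R -> Prop) :
  (forall y d d', d' <= d -> P y d -> P y d') ->
  (forall y, y \in s -> exists2 d, 0 < d & P y d) ->
  exists2 d, 0 < d & forall y, y \in s -> P y d.
Proof.
move=> mono; elim: s => [|y s IH] H; first by exists 1.
have [d d0 Pd] := H y (mem_head _ _).
have [|d' d'0 Pd'] := IH; first by move=> z zs; apply: H; rewrite inE zs orbT.
exists (Num.min d d') => [|z]; first by rewrite lt_min d0.
rewrite inE => /orP[/eqP->|zs].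
  by apply: mono Pd; rewrite ge_min lexx.
by apply: mono (Pd' z zs); rewrite ge_min lexx orbT.
Qed.

Lemma dif_accum_zeros (V : normedModType R) (f : R -> V) e v : dif f e v ->
  (forall d, 0 < d -> exists2 h, 0 < `|h| < d & f (e + h) = 0) -> f e = 0 /\ v = 0.
Proof.
move=> D Z; have fe : f e = 0.
  apply/eqP; rewrite -normr_eq0 eq_le normr_ge0 andbT leNgt; apply/negP => fe0.
  have [d d0 L] := dif_lip D; have v1 : 0 < 1 + `|v| by rewrite ltr_pwDl.
  have [|h /andP[h0 hd] fh] := Z (Num.min d (`|f e| / (1 + `|v|))).
    by rewrite lt_min d0 divr_gt0.
  move: hd; rewrite lt_min => /andP[/L]; rewrite fh sub0r normrN => le.
  by rewrite ltr_pdivlMr// mulrC ltNge le.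
split=> //; apply/eqP; rewrite -normr_eq0 eq_le normr_ge0 andbT.
apply/ler_addgt0Pl => e' e'0; rewrite addr0.
have [d d0 L] := D _ e'0; have [h /andP[h0 /L]] := Z _ d0.
move=> /[swap] ->; rewrite fe subrr sub0r normrN normrZ mulrC.
by rewrite ler_pM2r.
Qed.

Lemma dif_mulmx n (g : 'M[R]_n) (f : R -> 'cV[R]_n) t v :
  dif f t v -> dif (fun s => g *m f s) t (g *m v).
Proof.
move=> D e e0; have [C C1 gC] := seq_norm_bound [:: g].
have C0 : 0 < C by rewrite (lt_le_trans _ C1).
have [d d0 L] := D _ (divr_gt0 e0 C0); exists d => // h /L hd.
rewrite scalemxAr -!mulmxBr (le_trans (gC _ (mem_head _ _) _))//.
by rewrite mulrC -ler_pdivlMr// mulrAC.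
Qed.

End CommonDelta.

(** * Gluing lifts *)

Section Glue.
Context {R : realType} {n : nat} (G : seq 'M[R]_n) (GG : mxgroup G) (x : R -> 'cV[R]_n).

(** [x] is any choice of points over the curve, without regularity: only its
    orbits matter. *)
Definition is_lift (J : set R) (xb : R -> 'cV[R]_n) :=
  forall t, J t -> same_orbit G (xb t) (x t) /\ exists v, dif xb t v.

(** Open sets, described by balls. *)
Definition nbhd (J : set R) := forall t, J t -> exists2 d : R, 0 < d &
  forall s, `|s - t| < d -> J s.

Lemma lift_near (J : set R) (xb xb' : R -> 'cV[R]_n) t : is_lift J xb -> J t ->
  (exists2 d : R, 0 < d & forall s, `|s - t| < d -> xb s = xb' s) ->
  same_orbit G (xb' t) (x t) /\ exists v, dif xb' t v.
Proof.
move=> L Jt [d d0 E]; have [Ox [v D]] := L t Jt; split.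
  by rewrite -E// subrr normr0.
by exists v; apply: dif_near D; exists d.
Qed.

Lemma is_lift_mul (J : set R) xb g : g \in G -> is_lift J xb ->
  is_lift J (fun t => g *m xb t).
Proof.
move=> gG L t /L[Ox [v D]]; split; first exact: same_orbit_mul.
by exists (g *m v); exact: dif_mulmx.
Qed.

(** Near [e] the two lifts differ by an element of [G] depending on the
    parameter; since [G] is finite, one element serves for parameters that
    accumulate at [e], and it therefore matches values and derivatives. *)
Lemma lifts_agree (J : set R) f1 f2 e v1 v2 : nbhd J -> J e ->
  is_lift J f1 -> is_lift J f2 -> dif f1 e v1 -> dif f2 e v2 ->
  exists2 g, g \in G & f1 e = g *m f2 e /\ v1 = g *m v2.
Proof.
move=> oJ Je L1 L2 D1 D2; apply: contrapT => N.
have [d d0 Jd] := oJ e Je.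
have [|g gG|d' d'0 Pd'] := @common_delta R _ G
    (fun g d => forall h, 0 < `|h| < d -> f1 (e + h) <> g *m f2 (e + h)).
- by move=> g d1 d2 d21 H h /andP[h0 hd]; apply: H; rewrite h0 (lt_le_trans hd).
- apply: contrapT => N'; apply: N; exists g => //.
  have [|/subr0_eq-> /subr0_eq->//] := dif_accum_zeros (difB D1 (dif_mulmx g D2)).
  move=> d1 d10; apply: contrapT => N2; apply: N'; exists d1 => // h hd E.
  by apply: N2; exists h => //; rewrite E subrr.
- pose h := Num.min d d' / 2.
  have m0 : 0 < Num.min d d' by rewrite lt_min d0.
  have h0 : 0 < h by rewrite divr_gt0.
  have hm : h < Num.min d d' by rewrite ltr_pdivrMr// ltr_pMr// ltr1n.
  move: (hm); rewrite lt_min => /andP[hd hd'].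
  have Jh : J (e + h) by apply: Jd; rewrite addrC addKr gtr0_norm.
  have [Ox1 _] := L1 _ Jh; have [Ox2 _] := L2 _ Jh.
  have [g gG E] := same_orbit_trans GG Ox1 (same_orbit_sym GG Ox2).
  by apply: (Pd' g gG h) E; rewrite gtr0_norm ?h0.
Qed.

(** Both branches have the same expansion at [e]. *)
Lemma dif_piecewise (f1 f2 : R -> 'cV[R]_n) e v (side : R -> bool) :
  dif f1 e v -> dif f2 e v -> f1 e = f2 e ->
  dif (fun t => if side t then f1 t else f2 t) e v.
Proof.
move=> D1 D2 E eps eps0.
have [d1 d10 L1] := D1 _ eps0; have [d2 d20 L2] := D2 _ eps0.
exists (Num.min d1 d2) => [|h]; first by rewrite lt_min d10.
rewrite lt_min => /andP[/L1 hd1 /L2 hd2].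
by case: ifP; case: ifP => _ _ //; rewrite ?E // -E.
Qed.

Definition local_lifts (O : set R) := forall t, O t -> exists2 d : R, 0 < d &
  exists f, is_lift [set s | `|s - t| < d] f.

Lemma nbhd_ball (t d : R) : nbhd [set s | `|s - t| < d].
Proof.
move=> s /= sd; exists (d - `|s - t|) => [|u us]; first by rewrite subr_gt0.
by rewrite (le_lt_trans (ler_distD s _ _))// -ltrBrDr.
Qed.

Definition convex_set (W : set R) := forall s t u, W s -> W t -> s <= u <= t -> W u.

Lemma convex_ball (t d : R) : convex_set [set s | `|s - t| < d].
Proof.
move=> s s' u /= sd td /andP[su ut]; move: sd td.
by rewrite !ltr_distl => /andP[? ?] /andP[? ?]; apply/andP; split; lra.
Qed.

(** Continuation across [e]: beyond [e], the lift [f] is continued by the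
    translate of [g] that has the same value and velocity at [e]. *)
Lemma glue_at (right : bool) (W1 W2 : set R) f g e :
  let side t := if right then t <= e else e <= t in
  let W' := [set t | if side t then W1 t else W2 t] in
  nbhd W1 -> nbhd W2 -> W1 e -> W2 e -> is_lift W1 f -> is_lift W2 g ->
  exists f', [/\ nbhd W', is_lift W' f' & forall t, side t -> f' t = f t].
Proof.
move=> side W' oW1 oW2 We1 We2 L1 L2.
have side_e : side e by rewrite /side; case Er: right.
have [[_ [v D1]] [_ [w D2]]] := (L1 e We1, L2 e We2).
have [d1 d10 dW1] := oW1 e We1; have [d2 d20 dW2] := oW2 e We2.
pose d := Num.min d1 d2; have d0 : 0 < d by rewrite lt_min d10.
have [k kG [fe vw]] : exists2 k, k \in G & f e = k *m g e /\ v = k *m w.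
  apply: (@lifts_agree [set t | `|t - e| < d]) => //.
  - exact: nbhd_ball.
  - by rewrite /= subrr normr0.
  - by move=> t /=; rewrite lt_min => /andP[/dW1/L1].
  - by move=> t /=; rewrite lt_min => /andP[_ /dW2/L2].
pose f' t := if side t then f t else k *m g t.
(* away from [e] one stays on one side *)
have side_near t : t != e -> forall s, `|s - t| < `|t - e| -> side s = side t.
  move=> te s; have [lt_te|lt_et|te'] := ltrgtP t e; last by rewrite te' eqxx in te.
    rewrite ltr_distl => /andP[? ?].
    rewrite /side; case Er: right; apply/idP/idP => ?; lra.
  rewrite ltr_distl => /andP[? ?].
  rewrite /side; case Er: right; apply/idP/idP => ?; lra.
have L2k := is_lift_mul kG L2.
exists f'; split; last by move=> t; rewrite /f' => ->.
- move=> t; rewrite /W'/=; have [->|te] := eqVneq t e.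
    move=> _; exists d => // s; rewrite lt_min => /andP[/dW1 ? /dW2 ?].
    by case: ifP.
  have te0 : 0 < `|t - e| by rewrite normr_gt0 subr_eq0.
  have near := side_near t te.
  case: ifP => st Wt.
    have [d' d'0 dW'] := oW1 t Wt; exists (Num.min d' `|t - e|).
      by rewrite lt_min d'0.
    by move=> s; rewrite lt_min => /andP[/dW' ? /near ->]; rewrite st.
  have [d' d'0 dW'] := oW2 t Wt; exists (Num.min d' `|t - e|).
    by rewrite lt_min d'0.
  by move=> s; rewrite lt_min => /andP[/dW' ? /near ->]; rewrite st.
- move=> t; rewrite /W'/=; have [->|te] := eqVneq t e.
    move=> _; split; first by rewrite /f' side_e; have [] := L1 e We1.
    by exists v; apply: dif_piecewise => //; rewrite vw; exact: dif_mulmx.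
  have te0 : 0 < `|t - e| by rewrite normr_gt0 subr_eq0.
  have near := side_near t te.
  case: ifP => st Wt; [apply: (lift_near L1) => //|apply: (lift_near L2k) => //];
    by exists `|t - e| => // s /near; rewrite /f' => ->; rewrite st.
Qed.

(** The points lie in the same component of [O]. *)
Definition linked (O : set R) (s t : R) := exists a b, [/\ a < s < b, a < t < b &
  forall u, a < u < b -> O u].

(** The points that a lift starting at [q] can reach form a set that is open and
    closed in the interval. *)
Lemma compact_lift (O : set R) q t : local_lifts O -> O q -> linked O q t ->
  exists W f, [/\ nbhd W, convex_set W, W q, W t & is_lift W f].
Proof.
move=> loc Oq [a [b [qab tab abO]]].
pose P t := exists W f, [/\ nbhd W, convex_set W, W q, W t & is_lift W f].
apply: (@locally_constant R P a b _ q t) => //; last first.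
  have [d d0 [f L]] := loc q Oq; exists [set s | `|s - q| < d], f.
  split=> //; rewrite /= ?subrr ?normr0//; [exact: nbhd_ball|exact: convex_ball].
move=> {tab} {}t tab; have [d d0 [g Lg]] := loc t (abO _ tab).
have cB := @convex_ball t d; have oB := @nbhd_ball t d.
have tt : `|t - t| < d by rewrite subrr normr0.
exists d => // s _ st.
(* any two points of the ball around [t] can be traded for one another *)
suff E u w : `|u - t| < d -> `|w - t| < d -> P u -> P w by split; exact: E.
move=> ut wt [W [f [oW cW Wq Wu Lf]]].
case: (lerP q u) => qu; case: (lerP w u) => wu.
- case: (lerP q w) => qw.
    by exists W, f; split=> //; apply: (cW q u) => //; rewrite qw.
  exists [set s | `|s - t| < d], g; split => //.
  by apply: (cB w u) => //; rewrite qu ltW.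
- have [f' [oW' L' _]] := @glue_at true _ _ f g u oW oB Wu ut Lf Lg.
  eexists; exists f'; split; [exact: oW'| |..|exact: L']; rewrite /= ?qu ?leNgt ?wu//.
  move=> v1 v2 v3 /=; case: (lerP v3 u) => v3u; case: (lerP v2 u) => v2u;
    case: (lerP v1 u) => v1u W1 W2 /andP[v13 v32]; try lra.
  + by apply: (cW v1 v2) => //; rewrite v13.
  + by apply: (cW v1 u) => //; rewrite v13.
  + by apply: (cB u v2) => //; rewrite v32 andbT ltW.
  + by apply: (cB v1 v2) => //; rewrite v13.
- have [f' [oW' L' _]] := @glue_at false _ _ f g u oW oB Wu ut Lf Lg.
  case: (ltrP w u) => wu'; last by have -> : w = u; [lra|exists W, f].
  eexists; exists f'; split; [exact: oW'| |..|exact: L']; rewrite /= ?(ltW qu) ?leNgt ?wu'//.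
  move=> v1 v2 v3 /=; case: (lerP u v3) => v3u; case: (lerP u v2) => v2u;
    case: (lerP u v1) => v1u W1 W2 /andP[v13 v32]; try lra.
  + by apply: (cW v1 v2) => //; rewrite v13.
  + by apply: (cW u v2) => //; rewrite v32 andbT.
  + by apply: (cB v1 u) => //; rewrite v13 ltW.
  + by apply: (cB v1 v2) => //; rewrite v13.
- case: (lerP w q) => wq.
    by exists W, f; split=> //; apply: (cW u q) => //; rewrite wq ltW.
  exists [set s | `|s - t| < d], g; split => //.
  by apply: (cB u w) => //; rewrite !ltW.
Qed.

Lemma linked_refl (O : set R) t : nbhd O -> O t -> linked O t t.
Proof.
move=> oO Ot; have [d d0 dO] := oO t Ot; exists (t - d), (t + d).
have tt : t - d < t < t + d by apply/andP; split; lra.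
by split=> // u uab; apply: dO; rewrite ltr_distl.
Qed.

Lemma linked_sym (O : set R) s t : linked O t s -> linked O s t.
Proof. by move=> [a [b [sab tab abO]]]; exists a, b. Qed.

Lemma linked_trans (O : set R) s t u : linked O s t -> linked O t u -> linked O s u.
Proof.
move=> [a [b [sab tab abO]]] [a' [b' [tab' uab' abO']]].
exists (Num.min a a'), (Num.max b b').
rewrite !gt_min !lt_max.
move: sab tab tab' uab' => /andP[-> ->] /andP[at_ tb] /andP[at' tb'] /andP[-> ->].
rewrite !orbT; split=> // v /andP[]; rewrite gt_min lt_max => va vb.
case: (ltrP v t) => vt.
  by case/orP: va => va; [apply: abO|apply: abO']; apply/andP; split=> //; lra.
by case/orP: vb => vb; [apply: abO|apply: abO']; apply/andP; split=> //; lra.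
Qed.

Lemma linked_in (O : set R) s t : linked O s t -> O t.
Proof. by move=> [a [b [_ tab abO]]]; exact: abO. Qed.

Lemma linked_nbhd (O : set R) q t : linked O q t -> exists2 d, 0 < d &
  forall s, `|s - t| <= d -> linked O q s.
Proof.
move=> [a [b [qab /andP[at_ tb] abO]]].
exists (Num.min (t - a) (b - t) / 2) => [|s].
  by rewrite divr_gt0// lt_min !subr_gt0 at_.
rewrite ler_pdivlMr// => st; have : `|s - t| * 2 <= t - a.
  by rewrite (le_trans st)// ge_min lexx.
have : `|s - t| * 2 <= b - t by rewrite (le_trans st)// ge_min lexx orbT.
rewrite -!ler_pdivlMr// !ler_distl => /andP[? ?] /andP[? ?].
by exists a, b; split=> //; apply/andP; split; lra.
Qed.

Lemma extend_two_sided (O W : set R) f a b a' b' : local_lifts O ->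
  nbhd W -> is_lift W f -> (forall t, a <= t <= b -> W t) ->
  O a' -> linked O a' b' -> a' <= a -> a <= b -> b <= b' ->
  exists W' f', [/\ nbhd W', is_lift W' f', forall t, a' <= t <= b' -> W' t &
    forall t, a <= t <= b -> f' t = f t].
Proof.
move=> loc oW L abW Oa' link a'a ab bb'.
have [V [g [oV cV Va' Vb' Lg]]] := compact_lift loc Oa' link.
have Vt t : a' <= t <= b' -> V t by apply: cV.
have Wb : W b by apply: abW; rewrite ab lexx.
have Vb : V b by apply: Vt; rewrite bb' (le_trans a'a).
have [f1 [oW1 L1 f1E]] := @glue_at true _ _ f g b oW oV Wb Vb L Lg.
have Va : V a by apply: Vt; rewrite a'a (le_trans ab).
have [|f2 [oW2 L2 f2E]] := @glue_at false _ _ f1 g a oW1 oV _ Va L1 Lg.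
  by rewrite /= ab; apply: abW; rewrite lexx.
eexists; exists f2; split; [exact: oW2|exact: L2| |].
- move=> t /= ta'b'; case: ifP => ta; last exact: Vt.
  by case: ifP => tb; [apply: abW; rewrite ta | apply: Vt].
- by move=> t /andP[at_ tb]; rewrite f2E// f1E.
Qed.

Lemma exhaustion (O : set R) q : nbhd O -> O q -> exists a b : nat -> R,
  [/\ forall k, linked O q (a k) /\ linked O q (b k), forall k, a k <= q <= b k,
      forall k l, (k <= l)%N -> a l <= a k /\ b k <= b l &
      forall t, linked O q t -> exists k, a k <= t <= b k].
Proof.
move=> oO Oq.
(* the rationals of the component, enumerated, bound ever larger intervals *)
pose r (k : nat) : R := if unpickle k is Some y then ratr y else q.
pose b := fix b k := if k is k'.+1 then
  (if `[< linked O q (r k') >] then Num.max (b k') (r k') else b k') else q.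
pose a := fix a k := if k is k'.+1 then
  (if `[< linked O q (r k') >] then Num.min (a k') (r k') else a k') else q.
have link k : linked O q (a k) /\ linked O q (b k).
  elim: k => [|k [IHa IHb]]; first by split; exact: linked_refl.
  by split=> /=; case: asboolP => // lr; rewrite /Num.min /Num.max; case: ifP.
have step k : a k.+1 <= a k /\ b k <= b k.+1.
  by split=> /=; case: asboolP => // _; rewrite ?ge_min ?le_max lexx.
have mono k l : (k <= l)%N -> a l <= a k /\ b k <= b l.
  elim: l => [|l IH]; first by rewrite leqn0 => /eqP->.
  rewrite leq_eqVlt => /orP[/eqP->//|]; rewrite ltnS => /IH[al bl].
  have [al' bl'] := step l; split; first exact: le_trans al' al.
  exact: le_trans bl bl'.
exists a, b; split=> // [k|t qt].
  by have [] := mono 0 k (leq0n k) => /= -> ->.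
have [d d0 dl] := linked_nbhd qt.
have [|y1] := @rat_in_itvoo R t (t + d); first by rewrite ltrDl.
rewrite in_itv/= => /andP[ty1 y1d].
have [|y2] := @rat_in_itvoo R (t - d) t; first by rewrite ltrBlDr ltrDl.
rewrite in_itv/= => /andP[dy2 y2t].
have l1 : linked O q (r (pickle y1)).
  by rewrite /r pickleK; apply: dl; rewrite ler_distl; apply/andP; split; lra.
have l2 : linked O q (r (pickle y2)).
  by rewrite /r pickleK; apply: dl; rewrite ler_distl; apply/andP; split; lra.
have b1 : t <= b (pickle y1).+1.
  move: l1 => /=; rewrite /r pickleK => l1; case: asboolP => // _.
  by rewrite le_max (ltW ty1) orbT.
have a2 : a (pickle y2).+1 <= t.
  move: l2 => /=; rewrite /r pickleK => l2; case: asboolP => // _.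
  by rewrite ge_min (ltW y2t) orbT.
exists (maxn (pickle y1).+1 (pickle y2).+1).
have [_ b1'] := mono _ _ (leq_maxl (pickle y1).+1 (pickle y2).+1).
have [a2' _] := mono _ _ (leq_maxr (pickle y1).+1 (pickle y2).+1).
by rewrite (le_trans a2' a2) (le_trans b1 b1').
Qed.

(** Lifts over an increasing sequence of compact intervals are chosen one after
    the other, each of them extending the previous one. *)
Lemma glue_component (O : set R) q : nbhd O -> O q -> local_lifts O ->
  exists f, is_lift (linked O q) f.
Proof.
move=> oO Oq loc; have [a [b [link aqb mono exh]]] := exhaustion oO Oq.
pose good k f := exists W, [/\ nbhd W, is_lift W f & forall t, a k <= t <= b k -> W t].
have /choice[S SP] : forall kf : nat * (R -> 'cV[R]_n), exists f', good kf.1 kf.2 ->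
    good kf.1.+1 f' /\ forall t, a kf.1 <= t <= b kf.1 -> f' t = kf.2 t.
  move=> [k f] /=; have [[W [oW L abW]]|?] := pselect (good k f); last by exists f.
  have [] := @extend_two_sided O W f (a k) (b k) (a k.+1) (b k.+1) => //.
  - exact: linked_in (link _).1.
  - by apply: linked_trans (link _).2; exact: linked_sym (link _).1.
  - by have [] := mono k k.+1 (leqnSn k).
  - by have /andP[? ?] := aqb k; lra.
  - by have [] := mono k k.+1 (leqnSn k).
  - by move=> W' [f' [oW' L' abW' E]]; exists f' => _; split=> //; exists W'.
have [d d0 [f0 L0]] := loc q Oq.
have [f00 f00P] : exists f, good 0 f.
  have /andP[a0 b0] := aqb 0.
  have [] := @extend_two_sided O [set s | `|s - q| < d] f0 q q (a 0) (b 0) => //.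
  - exact: nbhd_ball.
  - by move=> t /andP[? ?] /=; have -> : t = q by [lra]; rewrite subrr normr0.
  - exact: linked_in (link _).1.
  - by apply: linked_trans (link _).2; exact: linked_sym (link _).1.
  - by move=> W' [f' [oW' L' abW' E]]; exists f', W'.
pose F := fix F k := if k is k'.+1 then S (k', F k') else f00.
have FP k : good k (F k) by elim: k => //= k /(SP (k, _))[].
have Fmono k l : (k <= l)%N -> forall t, a k <= t <= b k -> F l t = F k t.
  move=> + t tk; elim: l => [|l IH]; first by rewrite leqn0 => /eqP->.
  rewrite leq_eqVlt => /orP[/eqP<-//|]; rewrite ltnS => kl; rewrite -IH//.
  apply: (SP (l, F l) (FP l)).2 => /=; have [al bl] := mono _ _ kl.
  by move: tk => /andP[? ?]; apply/andP; split; lra.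
have /choice[N NP] : forall t, exists k, linked O q t -> a k <= t <= b k.
  by move=> t; have [/exh[k]|?] := pselect (linked O q t); [exists k | exists 0].
have FE t l : linked O q t -> a l <= t <= b l -> F (N t) t = F l t.
  move=> /NP tN tl; case/orP: (leq_total (N t) l) => le.
    by rewrite (Fmono _ _ le).
  by rewrite -(Fmono _ _ le).
exists (fun t => F (N t) t) => t qt.
have [d' d'0 dl] := linked_nbhd qt.
have [k1 k1P] : exists k, a k <= t - d' <= b k.
  by apply/exh/dl; rewrite addrAC subrr add0r normrN gtr0_norm.
have [k2 k2P] : exists k, a k <= t + d' <= b k.
  by apply/exh/dl; rewrite addrAC subrr add0r gtr0_norm.
have [a1 b1] := mono _ _ (leq_maxl k1 k2).
have [a2 b2] := mono _ _ (leq_maxr k1 k2).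
have rng s : `|s - t| < d' -> a (maxn k1 k2) <= s <= b (maxn k1 k2).
  by rewrite ltr_distl => /andP[? ?]; move: k1P k2P => /andP[? ?] /andP[? ?];
    apply/andP; split; lra.
have [W [oW L abW]] := FP (maxn k1 k2).
apply: (@lift_near W (F (maxn k1 k2)) (fun s => F (N s) s) t L).
  by apply: abW; apply: rng; rewrite subrr normr0.
exists d' => // s sd; rewrite (FE s (maxn k1 k2)) ?rng//.
by apply: dl; exact: ltW.
Qed.

(** The lift is chosen once for each component of [O]. *)
Lemma glue_lifts (O : set R) : nbhd O -> local_lifts O -> exists f, is_lift O f.
Proof.
move=> oO loc; pose base t := xget 0 (linked O t).
have baseP t : O t -> linked O t (base t).
  move=> Ot; rewrite /base; case: xgetP => // /(_ t).
  by have := linked_refl oO Ot.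
have /choice[L LP] : forall q, exists f, O q -> is_lift (linked O q) f.
  move=> q; have [Oq|Oq] := pselect (O q); last by exists (fun=> 0).
  by have [f Lf] := glue_component oO Oq loc; exists f.
exists (fun t => L (base t) t) => t Ot; have bt := baseP t Ot.
apply: (@lift_near _ (L (base t)) (fun s => L (base s) s) t (LP _ (linked_in bt))).
  exact: linked_sym.
have [d d0 dl] := linked_nbhd (linked_refl oO Ot); exists d => // s sd.
suff -> : base s = base t by [].
rewrite /base (_ : linked O s = linked O t)//; apply/seteqP.
have ts := dl s (ltW sd).
by split=> u; apply: linked_trans => //; exact: linked_sym.
Qed.

End Glue.

(** * First-order expansions up to a finite group *)

Section Jets.
Context {R : realType} {n : nat}.
Implicit Types (G : seq 'M[R]_n) (x : R -> 'cV[R]_n).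

(** [v] is a velocity of the curve of orbits: the group element may depend on
    the increment. *)
Definition orbit_jet G x t (v : 'cV[R]_n) := forall e : R, 0 < e ->
  exists2 d : R, 0 < d & forall h, `|h| < d ->
    exists2 g, g \in G & `|g *m x (t + h) - x t - h *: v| <= e * `|h|.

Lemma orbit_jet_lip G x t v : orbit_jet G x t v -> exists2 d : R, 0 < d &
  forall h, `|h| < d -> exists2 g, g \in G &
    `|g *m x (t + h) - x t| <= (1 + `|v|) * `|h|.
Proof.
move=> /(_ 1 ltr01)[d d0 D]; exists d => // h /D[g gG hg]; exists g => //.
have := ler_normD (g *m x (t + h) - x t - h *: v) (h *: v).
rewrite subrK normrZ => /le_trans; apply; rewrite mulrDl mul1r.
by rewrite (mulrC `|v|) lerD2r; rewrite mul1r in hg.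
Qed.

Lemma orbit_jet_close G x t v e : orbit_jet G x t v -> 0 < e ->
  exists2 d : R, 0 < d & forall h, `|h| < d ->
    exists2 g, g \in G & `|g *m x (t + h) - x t| < e.
Proof.
move=> /orbit_jet_lip[d d0 D] e0; have v1 : 0 < 1 + `|v| by rewrite ltr_pwDl.
exists (Num.min d (e / (1 + `|v|))) => [|h]; first by rewrite lt_min d0 divr_gt0.
rewrite lt_min => /andP[/D[g gG hg]]; rewrite ltr_pdivlMr// mulrC => he.
by exists g => //; exact: le_lt_trans hg he.
Qed.

Definition avg G (y : 'cV[R]_n) := (size G)%:R^-1 *: \sum_(g <- G) g *m y.

Lemma avgB G y z : avg G (y - z) = avg G y - avg G z.
Proof.
rewrite /avg -scalerBr -sumrB; congr (_ *: _).
by apply: eq_bigr => g _; rewrite mulmxBr.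
Qed.

Lemma avgZ G a y : avg G (a *: y) = a *: avg G y.
Proof.
rewrite /avg scalerA mulrC -scalerA; congr (_ *: _); rewrite scaler_sumr.
by apply: eq_bigr => g _; rewrite -scalemxAr.
Qed.

Lemma avg_mul G g y : mxgroup G -> g \in G -> avg G (g *m y) = avg G y.
Proof.
move=> GG gG; rewrite /avg; congr (_ *: _).
rewrite -[RHS](perm_big _ (mxgroup_perm GG gG)) big_map.
by apply: eq_bigr => h _; rewrite mulmxA.
Qed.

Lemma mul_avg G g y : mxgroup G -> g \in G -> g *m avg G y = avg G y.
Proof.
move=> GG gG; rewrite /avg -scalemxAr mulmx_sumr; congr (_ *: _).
rewrite -[RHS](perm_big _ (mxgroup_perml GG gG)) big_map.
by apply: eq_bigr => h _; rewrite mulmxA.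
Qed.

Lemma mxgroup_size_gt0 G : mxgroup G -> (0 < size G)%N.
Proof. by move=> [_ + _ _]; case: (G). Qed.

Lemma avg_fixed G y : mxgroup G -> (forall g, g \in G -> g *m y = y) -> avg G y = y.
Proof.
move=> GG fix_y; rewrite /avg big_seq (eq_bigr (fun=> y)); last first.
  by move=> g /fix_y.
rewrite -big_seq big_const_seq count_predT iter_addr_0 -[y *+ _]scaler_nat.
rewrite scalerA mulVf ?scale1r//.
by rewrite pnatr_eq0 -lt0n mxgroup_size_gt0.
Qed.

Lemma avg_norm_le G : exists2 C : R, 0 < C & forall y, `|avg G y| <= C * `|y|.
Proof.
have [C C1 GC] := seq_norm_bound G.
have k0 : 0 <= (size G)%:R^-1 :> R by rewrite invr_ge0.
exists (1 + (size G)%:R^-1 * (size G)%:R * C).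
  by rewrite ltr_pwDl// !mulr_ge0// (le_trans _ C1).
move=> y; rewrite /avg normrZ ger0_norm// mulrDl mul1r ler_wpDl// -!mulrA.
rewrite ler_wpM2l// (le_trans (ler_norm_sum _ _ _))//.
rewrite big_seq (le_trans (ler_sum _ (fun g gG => GC g gG y)))//.
by rewrite -big_seq big_const_seq count_predT iter_addr_0 mulr_natl.
Qed.

(** The average does not see the group element of the expansion. *)
Lemma avg_dif G x t v : mxgroup G -> orbit_jet G x t v ->
  dif (fun s => avg G (x s)) t (avg G v).
Proof.
move=> GG D e e0; have [C C0 GC] := avg_norm_le G.
have [d d0 L] := D _ (divr_gt0 e0 C0); exists d => // h /L[g gG hg].
rewrite -(avg_mul (x (t + h)) GG gG) -avgZ -!avgB (le_trans (GC _))//.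
by rewrite mulrC -ler_pdivlMr// mulrAC.
Qed.

(** Subtracting the average, which is differentiable and fixed by the group,
    reduces to a curve that vanishes wherever it is fixed by the group. *)
Lemma jet_sub_avg G x t v : mxgroup G -> orbit_jet G x t v ->
  orbit_jet G (fun s => x s - avg G (x s)) t (v - avg G v).
Proof.
move=> GG D e e0; have e2 : 0 < e / 2 by rewrite divr_gt0.
have [d d0 L] := D _ e2; have [d' d'0 L'] := avg_dif GG D e2.
exists (Num.min d d') => [|h]; first by rewrite lt_min d0.
rewrite lt_min => /andP[/L[g gG hg] /L' hg']; exists g => //.
rewrite mulmxBr mul_avg//.
have -> : g *m x (t + h) - avg G (x (t + h)) - (x t - avg G (x t)) - h *: (v - avg G v) =
    (g *m x (t + h) - x t - h *: v) -
    (avg G (x (t + h)) - avg G (x t) - h *: avg G v).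
  move: (g *m _) (avg _ _) (avg _ _) (avg _ _) => a b c p.
  by apply/matrixP => i j; rewrite !mxE; ring.
by rewrite (le_trans (ler_normB _ _))// [e in leRHS]splitr mulrDl lerD.
Qed.

End Jets.

(** * Lifts of curves that have expansions *)

Section LiftOfJets.
Context {R : realType} {n : nat}.
Implicit Types (G : seq 'M[R]_n) (x : R -> 'cV[R]_n).

Lemma orbit_separation G (y : 'cV[R]_n) : exists2 r : R, 0 < r &
  forall g, g \in G -> `|g *m y - y| < r -> g *m y = y.
Proof.
have [|g gG|r r0 P] := @common_delta R _ G
    (fun g d => `|g *m y - y| < d -> g *m y = y).
- by move=> g d d' dd' H h; apply: H; exact: lt_le_trans h dd'.
- have [E|N] := eqVneq (g *m y) y; first by exists 1.
  by exists `|g *m y - y|; rewrite ?normr_gt0 ?subr_eq0// ltxx.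
- by exists r.
Qed.

(** Near a point with smaller stabiliser the elements of the orbit close to it
    form one orbit of the stabiliser, so that the group may be reduced. *)
Lemma local_lift_nonfixed G (J : set R) x t : mxgroup G -> nbhd J -> J t ->
  (forall G', mxgroup G' -> (size G' < size G)%N -> forall J x, nbhd J ->
     (forall s, J s -> exists v, orbit_jet G' x s v) -> exists f, is_lift G' x J f) ->
  (forall s, J s -> exists v, orbit_jet G x s v) ->
  (exists2 g, g \in G & g *m x t <> x t) ->
  exists2 d : R, 0 < d & exists f, is_lift G x [set s | `|s - t| < d] f.
Proof.
move=> GG oJ Jt IH jets [g0 g0G g0x].
set y0 := x t; have [_ G1 GM GV] := GG.
have NG := mxgroup_stab y0 GG.
have sN : (size (stab G y0) < size G)%N.
  rewrite size_filter ltn_neqAle count_size andbT -all_count.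
  by apply/allPn; exists g0 => //; apply/eqP.
have [r r0 sep] := orbit_separation G y0.
have [C C1 GC] := seq_norm_bound G.
have C0 : 0 < C by rewrite (lt_le_trans _ C1).
pose r' := r / (1 + C); have r'0 : 0 < r' by rewrite divr_gt0// addr_gt0.
have close k y : k \in G -> `|y - y0| < r' -> `|k *m y - y0| < r' -> k \in stab G y0.
  move=> kG yr kyr; rewrite mem_stab kG; apply/eqP/sep => //.
  have -> : k *m y0 - y0 = (k *m y - y0) - k *m (y - y0).
    rewrite mulmxBr; move: (k *m y0) (k *m y) => a b.
    by apply/matrixP => i j; rewrite !mxE; ring.
  rewrite (le_lt_trans (ler_normB _ _))//.
  have -> : r = r' + C * r'.
    by rewrite /r' -[X in X + _]mul1r -mulrDl mulrC divfK// gt_eqF// addr_gt0.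
  rewrite ltr_leD// (le_trans (GC _ kG _))// ler_wpM2l// ltW//.
have [d1 d10 dJ] := oJ t Jt; have [v jv] := jets t Jt.
have [d2 d20 near] := orbit_jet_close jv r'0.
pose d := Num.min d1 d2; have d0 : 0 < d by rewrite lt_min d10.
have /choice[sel selP] : forall s, exists g, g \in G /\
    (`|s - t| < d -> `|g *m x s - y0| < r').
  move=> s; have [st|?] := pselect (`|s - t| < d); last by exists 1%:M.
  have [|g gG hg] := near (s - t); first by move: st; rewrite lt_min => /andP[].
  by exists g; split=> // _; move: hg; rewrite (addrC t) subrK.
pose x' s := sel s *m x s.
have [f Lf] : exists f, is_lift (stab G y0) x' [set s | `|s - t| < d] f.
  apply: IH => //; first exact: nbhd_ball.
  move=> s st; have std1 : `|s - t| < d1.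
    by apply: lt_le_trans st _; rewrite ge_min lexx.
  have [w jw] := jets s (dJ s std1).
  have [sG ssr] := selP s; exists (sel s *m w) => e e0.
  pose rs := r' - `|x' s - y0|; have rs0 : 0 < rs by rewrite subr_gt0 ssr.
  have [d3 d30 close3] := orbit_jet_close jw (divr_gt0 rs0 C0).
  have [d4 d40 jet4] := jw _ (divr_gt0 e0 C0).
  pose w1 := 1 + `|w|; have w10 : 0 < w1 by rewrite ltr_pwDl.
  pose e' := Num.min (e / C) 1.
  have e'0 : 0 < e' by rewrite lt_min divr_gt0//=.
  have [d5 d50 jet5] := jw _ e'0.
  exists (Num.min (d - `|s - t|) (Num.min d5 (rs / C / w1))) => [|h].
    by rewrite !lt_min subr_gt0 st d50 !divr_gt0.
  rewrite !lt_min => /and3P[hd /jet5[g gG hg] hw].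
  have sh : `|s + h - t| < d.
    by rewrite addrAC (le_lt_trans (ler_normD _ _))// -ltrBrDl.
  have [shG /(_ sh) shr] := selP (s + h).
  have [k kG ksel] := GV _ shG.
  pose m := sel s *m g *m k.
  have mG : m \in G by rewrite !GM.
  have mE : m *m x' (s + h) = sel s *m (g *m x (s + h)).
    by rewrite /m /x' -!mulmxA (mulmxA k) ksel mul1mx.
  have hC : `|m *m x' (s + h) - x' s| < rs.
    rewrite mE -mulmxBr (le_lt_trans (GC _ sG _))// mulrC -ltr_pdivlMr//.
    have := ler_normD (g *m x (s + h) - x s - h *: w) (h *: w).
    rewrite subrK normrZ => /le_lt_trans; apply; rewrite ltr_pdivlMr// in hw.
    apply: le_lt_trans hw; rewrite /w1 mulrDr mulr1 lerD2r (le_trans hg)//.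
    by rewrite ler_piMl// ge_min lexx orbT.
  exists m.
    apply: (close _ (x' (s + h))) => //.
    have := ler_normD (m *m x' (s + h) - x' s) (x' s - y0).
    by rewrite subrKA => /le_lt_trans; apply; rewrite -ltrBrDr.
  rewrite mE scalemxAr -!mulmxBr (le_trans (GC _ sG _))//.
  rewrite mulrC -ler_pdivlMr// mulrAC (le_trans hg)// ler_wpM2r//.
  by rewrite ge_min lexx.
exists d => //; exists f => s sd; have [Ox D] := Lf s sd; split=> //.
have [sG _] := selP s.
apply: (@same_orbit_trans _ _ _ _ (x' s)) => //; last by exists (sel s).
by case: Ox => g; rewrite mem_stab => /andP[gG _] ->; exists g.
Qed.

(** As [h] tends to [0] from one side, [f (t + h) / h] comes close to the orbit
    of [w], which is finite; being continuous, it stays near one point of it. *)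
Lemma one_sided_limit G x (t w_ s : R) (w : 'cV[R]_n) f :
  mxgroup G -> x t = 0 -> orbit_jet G x t w -> (s = 1 \/ s = -1) -> 0 < w_ ->
  (forall h, 0 < h < w_ -> same_orbit G (f (t + s * h)) (x (t + s * h)) /\
     exists v, dif f (t + s * h) v) ->
  exists2 g, g \in G & forall e : R, 0 < e -> exists2 d : R, 0 < d &
    forall h, 0 < h < d -> `|g *m f (t + s * h) - (s * h) *: w| <= e * h.
Proof.
move=> GG xt jw s1 w_0 Lf; have [_ G1 GM GV] := GG.
have [C C1 GC] := seq_norm_bound G.
have C0 : 0 < C by rewrite (lt_le_trans _ C1).
have ns : `|s| = 1 by case: s1 => ->; rewrite ?normrN normr1.
have [m0 m00 sep] : exists2 m : R, 0 < m & forall g k, g \in G -> k \in G ->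
    `|g *m w - k *m w| < m -> g *m w = k *m w.
  have [|g gG|m m0 P] := @common_delta R _ G
     (fun g d => forall k, k \in G -> `|g *m w - k *m w| < d -> g *m w = k *m w).
  - by move=> g d d' dd' H k kG h; apply: H => //; exact: lt_le_trans h dd'.
  - have [|k kG|m m0 P] := @common_delta R _ G
      (fun k d => `|g *m w - k *m w| < d -> g *m w = k *m w); last by exists m.
    + by move=> k d d' dd' H h; apply: H => //; exact: lt_le_trans h dd'.
    + have [E|N] := eqVneq (g *m w) (k *m w); first by exists 1.
      by exists `|g *m w - k *m w|; rewrite ?normr_gt0 ?subr_eq0// ltxx.
  - by exists m => // g k gG kG; exact: P.
pose F h := f (t + s * h).
have approx e : 0 < e -> exists2 d : R, 0 < d & forall h, 0 < h < d ->
    exists2 g, g \in G & `|F h - (s * h) *: (g *m w)| <= e * h.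
  move=> e0; have [d d0 jd] := jw _ (divr_gt0 e0 C0).
  exists (Num.min d w_) => [|h]; first by rewrite lt_min d0.
  rewrite lt_min => /and3P[h0 hd hw].
  have nsh : `|s * h| = h by rewrite normrM ns mul1r gtr0_norm.
  have [|g gG] := jd (s * h); first by rewrite nsh.
  rewrite nsh xt subr0 => hg; have [|[k kG fk] _] := Lf h; first by rewrite h0.
  have [l lG lg] := GV g gG; exists (k *m l); first exact: GM.
  have -> : F h - (s * h) *: (k *m l *m w) = (k *m l) *m (g *m x (t + s * h) - (s * h) *: w).
    rewrite mulmxBr mulmxA -(mulmxA k l g) lg mulmx1 -scalemxAr; congr (_ - _).
    exact: fk.
  rewrite (le_trans (GC _ (GM _ _ kG lG) _))// mulrC -ler_pdivlMr//.
  by rewrite mulrAC.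
have m4 : 0 < m0 / 4 by rewrite divr_gt0.
have [d0 d00 near0] := approx _ m4.
pose b := Num.min d0 w_; have b0 : 0 < b by rewrite lt_min d00.
have [|g0 g0G hg0] := near0 (b / 2).
  by rewrite divr_gt0//= ltr_pdivrMr// (@le_lt_trans _ _ d0) ?ltr_pMr ?ltr1n//
     ge_min lexx.
pose P h := `|F h - (s * h) *: (g0 *m w)| < m0 / 2 * h.
(* the closest orbit point is determined *)
have rigid h g e : 0 < h -> g \in G -> P h -> e <= m0 / 4 ->
    `|F h - (s * h) *: (g *m w)| <= e * h -> g *m w = g0 *m w.
  move=> h0 gG Ph e4 hg; apply: sep => //.
  have nsh : `|s * h| = h by rewrite normrM ns mul1r gtr0_norm.
  rewrite -(ltr_pM2l h0) -{1}nsh -normrZ scalerBr.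
  have -> : (s * h) *: (g *m w) - (s * h) *: (g0 *m w) =
      (F h - (s * h) *: (g0 *m w)) - (F h - (s * h) *: (g *m w)).
    by move: (F h) (_ *: _) (_ *: _) => p q q'; apply/matrixP => i j; rewrite !mxE; ring.
  rewrite (le_lt_trans (ler_normB _ _))//.
  have e4h : e * h <= m0 / 4 * h by rewrite ler_wpM2r// ltW.
  have := ltr_leD Ph (le_trans hg e4h) => /lt_le_trans; apply.
  by rewrite -mulrDl mulrC ler_wpM2l ?(ltW h0)//; lra.
have Pb h : 0 < h < b -> P h.
  have hb2 : 0 < b / 2 < b by rewrite divr_gt0//= ltr_pdivrMr// ltr_pMr// ltr1n.
  have Pb2 : P (b / 2).
    apply: le_lt_trans hg0 _; rewrite ltr_pM2r ?divr_gt0//; lra.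
  move=> hb; apply: (@locally_constant R P 0 b _ (b / 2)) => // {hb}h' hb.
  move: (hb); rewrite lt_min => /and3P[h0 hd hw].
  have [|_ [v D]] := Lf h'; first by rewrite h0.
  have DF := dif_affine D; have DL : dif (fun h => (s * h) *: (g0 *m w)) h' (s *: (g0 *m w)).
    have := @dif_affine R _ (fun u => u *: (g0 *m w)) 0 s h' (g0 *m w).
    have -> : (fun s0 => (0 + s * s0) *: (g0 *m w)) = (fun h => (s * h) *: (g0 *m w)).
      by apply/funext => u; rewrite add0r.
    apply=> e e0; exists 1 => // k _.
    rewrite -!scalerBl (_ : _ - _ - _ = 0); last by ring.
    by rewrite scale0r normr0 mulr_ge0// ltW.
  have [d1 d10 L1] := dif_lip (difB DF DL).
  set L := 1 + _ in L1; have L0 : 0 < L by rewrite ltr_pwDl.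
  pose q := m0 / 8 * h'; have q0 : 0 < q by rewrite !mulr_gt0.
  exists (Num.min d1 (Num.min (q / L) (h' / 4))) => [|u /andP[u0 ub]].
    by rewrite !lt_min d10 !divr_gt0.
  rewrite !lt_min => /and3P[/L1]; rewrite /= (addrC h') subrK => uL.
  rewrite ltr_pdivlMr// mulrC => uq; rewrite ltr_distl => /andP[uh1 uh2].
  have {}uL := le_lt_trans uL uq.
  have tri k k' : `|F k - (s * k) *: (g0 *m w)| <= m0 / 4 * k ->
     `|(F k' - (s * k') *: (g0 *m w)) - (F k - (s * k) *: (g0 *m w))| < q ->
     m0 / 4 * k + q <= m0 / 2 * k' -> P k'.
    move=> h1 h2 h3; rewrite /P -[X in `|X|](subrK (F k - (s * k) *: (g0 *m w))).
    by rewrite (le_lt_trans (ler_normD _ _))// (lt_le_trans _ h3)// addrC ler_ltD.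
  have small k : 0 < k < b -> P k -> `|F k - (s * k) *: (g0 *m w)| <= m0 / 4 * k.
    move=> /andP[k0 kb] Pk; have [|g gG hg] := near0 k.
      by move: kb; rewrite k0 lt_min => /andP[].
    by rewrite -(rigid k g _ k0 gG Pk (lexx _) hg).
  split=> [Pu|Ph].
    apply: (tri u); [by apply: small; rewrite ?u0|by rewrite distrC|rewrite /q].
    by rewrite -!mulrA -mulrDr ler_wpM2l ?(ltW m00)//; lra.
  apply: (tri h'); [exact: small|by []|rewrite /q].
  by rewrite -!mulrA -mulrDr ler_wpM2l ?(ltW m00)//; lra.
have [k kG kg0] := GV g0 g0G; exists k => // e e0.
pose e' := Num.min (e / C) (m0 / 4); have e'0 : 0 < e' by rewrite lt_min divr_gt0.
have [d1 d10 near1] := approx _ e'0.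
exists (Num.min b d1) => [|h]; first by rewrite lt_min b0.
rewrite lt_min => /and3P[h0 hb hd]; have [|g gG hg] := near1 h; first by rewrite h0.
have Ph : P h by apply: Pb; rewrite h0.
have gw : g *m w = g0 *m w by apply: (rigid h g e' h0 gG Ph _ hg); rewrite ge_min lexx orbT.
have -> : k *m f (t + s * h) - (s * h) *: w = k *m (F h - (s * h) *: (g *m w)).
  by rewrite gw mulmxBr -scalemxAr mulmxA kg0 mul1mx.
rewrite (le_trans (GC _ kG _))// mulrC -ler_pdivlMr// mulrAC (le_trans hg)//.
by rewrite ler_wpM2r ?(ltW h0)// ge_min lexx.
Qed.

(** The zero is isolated because the velocity is not zero; the lifts on both
    sides are turned by group elements so that they arrive with velocity [w]. *)
Lemma is_lift_zero_point G (J : set R) x t w : mxgroup G -> nbhd J -> J t ->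
  (forall s, J s -> x s <> 0 -> exists2 d : R, 0 < d &
     exists f, is_lift G x [set u | `|u - s| < d] f) ->
  x t = 0 -> orbit_jet G x t w -> w != 0 ->
  exists2 d : R, 0 < d & (forall s, `|s - t| < d -> J s /\ (s != t -> x s <> 0)) /\
    exists f, is_lift G x [set s | `|s - t| < d] f.
Proof.
move=> GG oJ Jt loc xt jw w0.
have nw : 0 < `|w| by rewrite normr_gt0.
have w2 : 0 < `|w| / 2 by rewrite divr_gt0.
have [d1 d10 dJ] := oJ t Jt; have [d2 d20 near] := jw _ w2.
pose d := Num.min d1 d2; have d0 : 0 < d by rewrite lt_min d10.
have nz s : `|s - t| < d -> J s /\ (s != t -> x s <> 0).
  rewrite lt_min => /andP[sd1 sd2]; split; first exact: dJ.
  move=> st xs; have [g gG] := near _ sd2.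
  rewrite (addrC t) subrK xs mulmx0 xt subr0 sub0r normrN normrZ mulrC.
  by rewrite ler_pM2r ?normr_gt0 ?subr_eq0//; lra.
exists d => //; split=> //.
have glue (O : set R) : nbhd O -> (forall s, O s -> `|s - t| < d /\ s != t) ->
    exists f, is_lift G x O f.
  move=> oO sub; apply: glue_lifts => // s /sub[sd st].
  by have [Js /(_ st) xs] := nz s sd; exact: loc.
have [r Lr] : exists f, is_lift G x [set s | t < s < t + d] f.
  apply: glue => s /= /andP[ts sd].
    exists (Num.min (s - t) (t + d - s)) => [|u]; first by rewrite lt_min !subr_gt0 ts.
    rewrite lt_min !ltr_distl => /andP[/andP[? ?] /andP[? ?]].
    by apply/andP; split; lra.
  by rewrite ltr_distl gt_eqF//; split=> //; apply/andP; split; lra.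
have [l Ll] : exists f, is_lift G x [set s | t - d < s < t] f.
  apply: glue => s /= /andP[ts sd].
    exists (Num.min (s - (t - d)) (t - s)) => [|u]; first by rewrite lt_min !subr_gt0 ts.
    rewrite lt_min !ltr_distl => /andP[/andP[? ?] /andP[? ?]].
    by apply/andP; split; lra.
  by rewrite ltr_distl lt_eqF//; split=> //; apply/andP; split; lra.
have [|g gG gr] := @one_sided_limit G x t d 1 w r GG xt jw (or_introl erefl) d0.
  by move=> h /andP[h0 hd]; apply: Lr => /=; rewrite mul1r; apply/andP; split; lra.
have [|k kG kl] := @one_sided_limit G x t d (-1) w l GG xt jw (or_intror erefl) d0.
  by move=> h /andP[h0 hd]; apply: Ll => /=; rewrite mulN1r; apply/andP; split; lra.
pose f s := if s < t then k *m l s else if s == t then 0 else g *m r s.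
have [Lrg Llk] := (is_lift_mul GG gG Lr, is_lift_mul GG kG Ll).
exists f => s /= sd; case: (ltrgtP s t) => st.
- apply: (lift_near Llk) => /=.
    by move: sd; rewrite ltr_distl => /andP[? ?]; apply/andP; split.
  exists (t - s) => [|u]; first by rewrite subr_gt0.
  by rewrite ltr_distl => /andP[? ?]; rewrite /f ifT//; lra.
- apply: (lift_near Lrg) => /=.
    by move: sd; rewrite ltr_distl => /andP[? ?]; apply/andP; split.
  exists (s - t) => [|u]; first by rewrite subr_gt0.
  rewrite ltr_distl => /andP[? ?]; rewrite /f ifF ?ifF//; last by apply/negbTE; rewrite -leNgt; lra.
  by apply/negbTE; rewrite gt_eqF//; lra.
- have ft : f t = 0 by rewrite /f ltxx eqxx.
  rewrite st ft xt; split; first exact: same_orbit_refl.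
  exists w => e e0; have [d3 d30 D3] := gr e e0; have [d4 d40 D4] := kl e e0.
  exists (Num.min d3 d4) => [|h]; first by rewrite lt_min d30.
  rewrite lt_min ft subr0 => /andP[h3 h4]; case: (ltrgtP h 0) => h0.
  + have := D4 (- h); rewrite oppr_gt0 h0 mulN1r opprK /f ifT; last by lra.
    by rewrite ltr0_norm// in h4; rewrite h4 ltr0_norm//; apply.
  + have := D3 h; rewrite h0 mul1r /f ifF ?ifF; last by apply/negbTE; rewrite -leNgt; lra.
      by rewrite gtr0_norm// in h3; rewrite h3 gtr0_norm//; apply.
    by apply/negbTE; rewrite gt_eqF//; lra.
  + by rewrite h0 addr0 ft scale0r subrr !normr0 mulr0.
Qed.

(** By induction on the order of the group: once the fixed part has been split
    off, the curve lifts near its nonzero values by a smaller group, and near its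
    isolated zeros with nonzero velocity by joining the lifts of both sides;
    elsewhere it vanishes to first order and the value [0] will do. *)
Theorem lift_of_jets G (J : set R) x : mxgroup G -> nbhd J ->
  (forall t, J t -> exists v, orbit_jet G x t v) -> exists f, is_lift G x J f.
Proof.
have [N] := ubnP (size G); elim: N => // N IH in G J x *.
rewrite ltnS => sG GG oJ jets.
have {}IH G' : mxgroup G' -> (size G' < size G)%N -> forall J x, nbhd J ->
    (forall s, J s -> exists v, orbit_jet G' x s v) -> exists f, is_lift G' x J f.
  by move=> GG' s' J' x' oJ' jets'; apply: IH => //; exact: leq_trans s' sG.
pose b s := x s - avg G (x s).
have jetb t : J t -> exists v, orbit_jet G b t v.
  by move=> /jets[v jv]; exists (v - avg G v); exact: jet_sub_avg.
suff [f Lf] : exists f, is_lift G b J f.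
  exists (fun s => f s + avg G (x s)) => t Jt.
  have [[g gG fE] [v D]] := Lf t Jt; have [w jw] := jets t Jt; split.
    exists g => //; rewrite fE /b mulmxBr mul_avg//; exact: subrK.
  by exists (v + avg G w); apply: difD => //; exact: avg_dif.
have b_fixed t : (forall g, g \in G -> g *m b t = b t) -> b t = 0.
  move=> /(avg_fixed GG) <-; rewrite /b avgB; apply/subr0_eq; rewrite subr0.
  apply/eqP; rewrite subr_eq0; apply/eqP/esym/avg_fixed => // g gG.
  exact: mul_avg.
clearbody b.
have loc s : J s -> b s <> 0 -> exists2 d : R, 0 < d &
    exists f, is_lift G b [set u | `|u - s| < d] f.
  move=> Js bs; apply: (local_lift_nonfixed GG oJ Js IH jetb).
  apply: contrapT => Nfix; apply: bs; apply: b_fixed => g gG.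
  by apply: contrapT => gb; apply: Nfix; exists g.
pose O := [set t | J t /\ (b t <> 0 \/ exists2 w, w != 0 & orbit_jet G b t w)].
have zero t w : J t -> b t = 0 -> orbit_jet G b t w -> w != 0 ->
   exists2 d : R, 0 < d & (forall s, `|s - t| < d -> J s /\ (s != t -> b s <> 0)) /\
    exists f, is_lift G b [set s | `|s - t| < d] f.
  by move=> Jt; exact: is_lift_zero_point.
have oO : nbhd O.
  move=> t [Jt bt]; have [bt0|bt0] := pselect (b t = 0).
    case: bt => // -[w w0 jw]; have [d d0 [dJ _]] := zero t w Jt bt0 jw w0.
    exists d => // s sd; have [Js bs] := dJ s sd; split=> //.
    have [->|/bs] := eqVneq s t; [by right; exists w|by left].
  have [v jv] := jetb t Jt; have [d d0 dJ] := oJ t Jt.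
  have [|d' d'0 close] := orbit_jet_close jv (_ : 0 < `|b t|).
    by rewrite normr_gt0; apply/eqP.
  exists (Num.min d d') => [|s]; first by rewrite lt_min d0.
  rewrite lt_min => /andP[/dJ Js /close[g gG p]]; split=> //; left => bs.
  have tst : t + (s - t) = s by lra.
  by move: p; rewrite tst bs mulmx0 sub0r normrN ltxx.
have [f Lf] : exists f, is_lift G b O f.
  apply: glue_lifts => // t [Jt bt]; have [bt0|bt0] := pselect (b t = 0).
    by case: bt => // -[w w0 jw]; have [d d0 [_ ?]] := zero t w Jt bt0 jw w0; exists d.
  exact: loc.
exists (fun t => if `[< O t >] then f t else 0) => t Jt.
have [Ot|NOt] := pselect (O t).
  apply: (@lift_near _ _ G b O f (fun t => if `[< O t >] then f t else 0) t Lf Ot).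
  by have [d d0 dO] := oO t Ot; exists d => // s /dO Os; case: asboolP.
have bt : b t = 0 by apply: contrapT => bt; apply: NOt; split=> //; left.
case: asboolP => // _; split; first by rewrite bt; exact: same_orbit_refl.
have [v jv] := jetb t Jt.
have v0 : v = 0.
  by apply/eqP; apply: contrapT => /negP v0; apply: NOt; split=> //; right; exists v.
exists 0 => e e0; have [C C1 GC] := seq_norm_bound G.
have C0 : 0 < C by rewrite (lt_le_trans _ C1).
have [d d0 jd] := jv _ (divr_gt0 e0 C0); exists d => // h /jd[g gG].
rewrite v0 bt scaler0 !subr0 => hg; case: (asboolP (O t)) => // _; rewrite subr0.
case: asboolP => [Oth|_]; last by rewrite normr0 mulr_ge0// ltW.
have [Ox _] := Lf _ Oth; have [_ _ _ GV] := GG.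
have [|k kG ->] := @same_orbit_trans _ _ _ _ _ (g *m b (t + h)) GG Ox.
  by apply: same_orbit_sym => //; exists g.
by rewrite (le_trans (GC _ kG _))// mulrC -ler_pdivlMr// mulrAC.
Qed.

End LiftOfJets.

(** * Inequalities between derivatives *)

Section Landau.
Context {R : realType}.
Implicit Types (D : nat -> R -> R) (a b c d s u v w A B C M : R).

(** [D j] is the derivative of order [j] of [D 0], for [j] up to [k]. *)
Definition chain D a b k := forall j, (j < k)%N -> forall s, a < s < b ->
  dif (D j) s (D j.+1 s).

Lemma chain_sub D a b a' b' k k' : a <= a' -> b' <= b -> (k' <= k)%N ->
  chain D a b k -> chain D a' b' k'.
Proof.
move=> aa bb kk ch j jk s /andP[? ?]; apply: ch; first exact: leq_trans jk kk.
by apply/andP; split; lra.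
Qed.

(** The mean value theorem between a point of the first third and a point of the
    last third, where the derivative of order [k] is small, gives the next order. *)
Lemma landau_point k : exists2 C : R, 0 <= C & forall D a b A, a < b ->
  chain D a b k -> (forall s, a < s < b -> `|D 0%N s| <= A) ->
  exists2 c, a < c < b & `|D k c| <= C * A / (b - a) ^+ k.
Proof.
elim: k => [|k [C C0 IH]].
  exists 1 => // D a b A ab _ DA; exists ((a + b) / 2); first by apply/andP; split; lra.
  by rewrite mul1r expr0 divr1; apply: DA; apply/andP; split; lra.
exists (6 * 3 ^+ k * C) => [|D a b A ab ch DA]; first by rewrite !mulr_ge0// exprn_ge0.
have [l l3 l0] : exists2 l, b - a = 3 * l & 0 < l by exists ((b - a) / 3); lra.
have [|||c1 /andP[ac1 c1l] h1] := IH D a (a + l) A; first by lra.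
- by apply: chain_sub ch => //; lra.
- by move=> s /andP[? ?]; apply: DA; apply/andP; split; lra.
have [|||c2 /andP[lc2 c2b] h2] := IH D (b - l) b A; first by lra.
- by apply: chain_sub ch => //; lra.
- by move=> s /andP[? ?]; apply: DA; apply/andP; split; lra.
have c12 : c1 + l <= c2 by lra.
have [||c /andP[? ?] cE] := @dif_mvt _ (D k) (D k.+1) c1 c2; first by lra.
  by move=> s /andP[? ?]; apply: ch => //; apply/andP; split; lra.
exists c; first by apply/andP; split; lra.
have e1 : a + l - a = l by lra.
have e2 : b - (b - l) = l by lra.
rewrite e1 in h1; rewrite e2 in h2.
have : `|D k.+1 c| * l <= 2 * (C * A / l ^+ k).
  apply: (@le_trans _ _ (`|D k.+1 c| * (c2 - c1))); first by rewrite ler_wpM2l//; lra.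
  rewrite -[X in _ * X]ger0_norm -?normrM -?cE; last by lra.
  by rewrite (le_trans (ler_normB _ _))//; lra.
rewrite -ler_pdivlMr// => /le_trans; apply.
rewrite l3 exprMn (exprS l) (exprS 3).
have lk : l ^+ k != 0 by rewrite expf_neq0// gt_eqF.
have k3 : 3 ^+ k != 0 :> R by rewrite expf_neq0.
rewrite le_eqVlt; apply/orP; left; apply/eqP; field.
by rewrite lk k3 gt_eqF.
Qed.

(** The mean value theorem turns a bound on the function into a bound on each
    derivative at some point, and the bound on the top derivative spreads it
    over the interval. *)
Lemma landau k : exists2 C : R, 0 <= C & forall D a b A B, a < b ->
  chain D a b k.+1 -> (forall s, a < s < b -> `|D 0%N s| <= A) ->
  (forall s, a < s < b -> `|D k.+1 s| <= B) ->
  forall s, a < s < b -> `|D 1%N s| <= C * (A / (b - a) + B * (b - a) ^+ k).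
Proof.
elim: k => [|k [C C0 IH]].
  exists 1 => // D a b A B ab _ DA DB s sab; rewrite mul1r expr0 mulr1.
  rewrite (le_trans (DB s sab))// lerDr divr_ge0 ?subr_ge0 ?(ltW ab)//.
  exact: le_trans (DA s sab).
have [C1 C10 P] := landau_point k.+1.
exists (C * (1 + C1)) => [|D a b A B ab ch DA DB s sab].
  by rewrite mulr_ge0// addr_ge0.
have l0 : 0 < b - a by rewrite subr_gt0.
have A0 : 0 <= A by exact: le_trans (DA s sab).
have B0 : 0 <= B by exact: le_trans (DB s sab).
have [|c cab hc] := P D a b A ab _ DA; first exact: chain_sub ch.
have top u : a < u < b -> `|D k.+1 u| <= C1 * A / (b - a) ^+ k.+1 + B * (b - a).
  move=> uab; rewrite -(subrK (D k.+1 c) (D k.+1 u)).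
  rewrite (le_trans (ler_normD _ _))// addrC lerD//.
  have main v w : a < v < b -> a < w < b -> v < w ->
      `|D k.+1 w - D k.+1 v| <= B * (b - a).
    move=> /andP[? ?] /andP[? ?] vw.
    have [|z /andP[? ?] ->] := @dif_mvt _ (D k.+1) (D k.+2) v w vw.
      by move=> z /andP[? ?]; apply: ch => //; apply/andP; split; lra.
    rewrite normrM ler_pM//; last by rewrite gtr0_norm; lra.
    by apply: DB; apply/andP; split; lra.
  case: (ltrgtP u c) => uc; [by rewrite distrC main|by rewrite main|].
  by rewrite uc subrr normr0 mulr_ge0// ltW.
have ch' : chain D a b k.+1 by exact: chain_sub ch.
rewrite (le_trans (IH D a b A _ ab ch' DA top s sab))// -[leRHS]mulrA ler_wpM2l//.
have -> : (C1 * A / (b - a) ^+ k.+1 + B * (b - a)) * (b - a) ^+ k =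
    C1 * (A / (b - a)) + B * (b - a) ^+ k.+1.
  rewrite !exprS; have lk : (b - a) ^+ k != 0 by rewrite expf_neq0// gt_eqF.
  by field; rewrite lk gt_eqF.
have : 0 <= C1 * (B * (b - a) ^+ k.+1).
  by rewrite !mulr_ge0// exprn_ge0// ltW.
lra.
Qed.

(** A nonnegative function cannot grow faster than quadratically away from a
    small value: the value at the opposite point would be negative. *)
Lemma nonneg_growth D d M : 0 < d -> chain D (- d) d 2 ->
  (forall s, `|s| < d -> 0 <= D 0%N s) -> (forall s, `|s| < d -> `|D 2%N s| <= M) ->
  forall h, `|h| < d -> D 0%N h <= 2 * D 0%N 0 + 2 * M * h ^+ 2.
Proof.
move=> d0 ch D0 DM.
suff main h : 0 < h < d -> D 0%N h + D 0%N (- h) <= 2 * D 0%N 0 + 2 * M * h ^+ 2.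
  move=> h hd; have Dm : 0 <= D 0%N (- h) by rewrite D0// normrN.
  move: hd; rewrite ltr_norml => /andP[? ?]; case: (ltrgtP h 0) => h0.
  - have := main (- h); rewrite opprK sqrrN => /(_ ltac:(apply/andP; split; lra)).
    by lra.
  - by have := main h ltac:(apply/andP; split; lra); lra.
  - have D00 : 0 <= D 0%N 0 by rewrite D0// normr0.
    by rewrite h0 expr0n/= mulr0 addr0; lra.
move=> /andP[h0 hd].
pose phi u := D 0%N u + D 0%N (- u).
have dphi u : `|u| < d -> dif phi u (D 1%N u - D 1%N (- u)).
  rewrite ltr_norml => /andP[? ?]; apply: difD.
    by apply: ch => //; apply/andP; split; lra.
  have := @dif_affine R _ (D 0%N) 0 (-1) u (D 1%N (- u)).
  rewrite mulN1r add0r -[(-1) *: _]/(-1 * _) mulN1r.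
  have -> : (fun s => D 0%N (0 + -1 * s)) = (fun s => D 0%N (- s)).
    by apply/funext => s; rewrite mulN1r add0r.
  by apply; apply: ch => //; apply/andP; split; lra.
have [|c /andP[c0 ch_] phiE] := @dif_mvt _ phi (fun u => D 1%N u - D 1%N (- u)) 0 h h0.
  by move=> u /andP[? ?]; apply: dphi; rewrite ger0_norm//; lra.
have [||c' /andP[? ?] DE] := @dif_mvt _ (D 1%N) (D 2%N) (- c) c.
- by lra.
- by move=> s /andP[? ?]; apply: ch => //; apply/andP; split; lra.
move: phiE; rewrite DE subr0 /phi oppr0 opprK => E.
have M0 : `|D 2%N c'| <= M by apply: DM; rewrite ltr_norml; apply/andP; split; lra.
have : D 2%N c' * (c + c) * h <= 2 * M * h ^+ 2.
  rewrite (le_trans (ler_norm _))// !normrM (gtr0_norm h0) expr2 mulrA.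
  rewrite ler_wpM2r ?(ltW h0)//; apply: (@le_trans _ _ (M * (2 * h))); last by lra.
  by rewrite ler_pM// gtr0_norm; lra.
lra.
Qed.

End Landau.

Section Peano.
Context {R : realType}.
Implicit Types (D : nat -> R -> R) (a b c d e s u v w A B C M : R).

(** Landau's inequality on the interval of radius [|s| / 2] around [s] shows
    that the derivative vanishes at [0] to the next lower order; the expansion of
    the derivative is then integrated. *)
Lemma peano k D d A B : 0 < d -> chain D (- d) d k.+1 ->
  (forall s, `|s| < d -> `|D k.+1 s| <= B) ->
  (forall s, `|s| < d -> `|D 0%N s| <= A * `|s| ^+ k.+1) ->
  exists L : R, forall e, 0 < e -> exists2 r : R, 0 < r & forall s, `|s| < r ->
    `|D 0%N s - L * s ^+ k.+1| <= e * `|s| ^+ k.+1.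
Proof.
elim: k => [|k IH] in D d A * => d0 ch DB DA.
  have D00 : D 0%N 0 = 0.
    by apply/eqP; rewrite -normr_le0; have := DA 0; rewrite normr0 expr1 mulr0; exact.
  exists (D 1%N 0) => e e0; have [//||r r0 P] := ch 0%N _ 0 _ e e0.
    by apply/andP; split; lra.
  exists r => // s /P; rewrite add0r D00 subr0 !expr1.
  by rewrite [s *: _]mulrC.
have [C C0 LC] := @landau R k.+1.
pose A' := C * (A * (3 / 2) ^+ k.+2 + B).
have B0 : 0 <= B.
  by have := DB 0; rewrite normr0 => /(_ d0); exact: le_trans.
have D00 : D 0%N 0 = 0.
  by apply/eqP; rewrite -normr_le0; have := DA 0; rewrite normr0 exprS mul0r mulr0; exact.
have D10 : D 1%N 0 = 0.
  have D1 : dif (D 0%N) 0 (D 1%N 0) by apply: ch => //; apply/andP; split; lra.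
  apply: (dif_unique D1) => e e0; have A1 : 0 < `|A| + 1 by rewrite ltr_pwDr.
  exists (Num.min (Num.min d 1) (e / (`|A| + 1))) => [|h].
    by rewrite !lt_min d0 ltr01 divr_gt0.
  rewrite !lt_min => /andP[/andP[hd h1]]; rewrite ltr_pdivlMr// => he.
  rewrite add0r D00 scaler0 !subr0 (le_trans (DA h hd))//.
  have h0 := normr_ge0 h; rewrite !exprS mulrA -mulrA mulrCA mulrA.
  have hk : `|h| * `|h| ^+ k <= `|h|.
    by rewrite ler_piMr// exprn_ile1// ltW.
  apply: (@le_trans _ _ ((`|A| + 1) * `|h| * `|h|)); last first.
    by rewrite ler_wpM2r// mulrC ltW.
  rewrite (mulrC `|h| A) -!mulrA.
  apply: (@le_trans _ _ (`|A| * (`|h| * (`|h| * `|h| ^+ k)))).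
    by rewrite ler_wpM2r ?ler_norm// !mulr_ge0// exprn_ge0.
  by rewrite ler_pM ?mulr_ge0 ?exprn_ge0// ?lerDl// ler_wpM2l.
have DA1 s : `|s| < d / 2 -> `|D 1%N s| <= A' * `|s| ^+ k.+1.
  move=> sd; have [->|s0] := eqVneq s 0.
    by rewrite D10 normr0 exprS mul0r mulr0.
  have n0 : 0 < `|s| by rewrite normr_gt0.
  have [h hE h0] : exists2 h, h = `|s| / 2 & 0 < h by exists (`|s| / 2); rewrite ?divr_gt0.
  have sb : - `|s| <= s <= `|s| by rewrite -ler_norml.
  have bnd u : s - h < u < s + h -> `|u| <= 3 / 2 * `|s| /\ `|u| < d.
    move: sb => /andP[? ?] /andP[? ?].
    have u1 : `|u| <= 3 / 2 * `|s| by rewrite ler_norml; apply/andP; split; lra.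
    by split=> //; lra.
  have -> : A' * `|s| ^+ k.+1 =
      C * ((A * (3 / 2 * `|s|) ^+ k.+2) / (s + h - (s - h)) + B * (s + h - (s - h)) ^+ k.+1).
    have -> : s + h - (s - h) = `|s| by lra.
    by rewrite /A' [(3 / 2 * `|s|) ^+ _]exprMn (exprS `|s| k.+1); field; rewrite gt_eqF.
  apply: (LC D (s - h) (s + h)); first by lra.
  - move=> j jk u /bnd[_]; rewrite ltr_norml => ud; exact: ch.
  - move=> u /[dup] /bnd[u1 ud] _; rewrite (le_trans (DA u ud))//.
    have A0 : 0 <= A.
      have := le_trans (normr_ge0 _) (DA s _); rewrite pmulr_lge0 ?exprn_gt0//.
      by apply; lra.
    by rewrite ler_wpM2l// lerXn2r// nnegrE// mulr_ge0.
  - by move=> u /bnd[_ /DB].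
  - by apply/andP; split; lra.
have d2 : 0 < d / 2 by rewrite divr_gt0.
have [||L' P] := IH (fun j => D j.+1) (d / 2) A' d2 _ _ DA1.
- move=> j jk s /andP[? ?]; apply: ch => //; apply/andP; split; lra.
- by move=> s sd; apply: DB; lra.
exists (L' / k.+2%:R) => e e0; have [r r0 {}P] := P e e0.
exists (Num.min r d) => [|s]; first by rewrite lt_min r0.
rewrite lt_min => /andP[sr sd].
pose g u := D 0%N u - L' / k.+2%:R * u ^+ k.+2.
have dg u : `|u| < d -> dif g u (D 1%N u - L' * u ^+ k.+1).
  rewrite ltr_norml => ud; apply: difB; first exact: ch.
  have := difM (dif_cst (L' / k.+2%:R) u) (dif_exp k.+1 u).
  by rewrite mul0r add0r mulrA divfK// pnatr_eq0.
have g0 : g 0 = 0 by rewrite /g D00 exprS mul0r mulr0 subr0.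
have fin c : `|c| <= `|s| -> g s = (D 1%N c - L' * c ^+ k.+1) * s ->
    `|D 0%N s - L' / k.+2%:R * s ^+ k.+2| <= e * `|s| ^+ k.+2.
  move=> cs; rewrite -/(g s) => ->; rewrite normrM (exprSr `|s|) mulrA ler_wpM2r//.
  rewrite (le_trans (P c (le_lt_trans cs sr)))// ler_wpM2l ?(ltW e0)//.
  by rewrite lerXn2r// nnegrE.
have [s0|s0|s0] := ltrgtP s 0.
- have [u|c /andP[? ?]] := @dif_mvt _ g (fun u => D 1%N u - L' * u ^+ k.+1) s 0 s0.
    by move=> /andP[? ?]; apply: dg; apply: le_lt_trans sd; rewrite !ler0_norm//; lra.
  rewrite g0 !sub0r mulrN => /oppr_inj; apply: fin.
  by rewrite !ltr0_norm//; lra.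
- have [u|c /andP[? ?]] := @dif_mvt _ g (fun u => D 1%N u - L' * u ^+ k.+1) 0 s s0.
    by move=> /andP[? ?]; apply: dg; apply: le_lt_trans sd; rewrite !ger0_norm//; lra.
  by rewrite g0 !subr0; apply: fin; rewrite !gtr0_norm//; lra.
- by apply: (fin 0); rewrite ?normr0// s0 mulr0.
Qed.

End Peano.

(** * Families with bounded derivatives *)

Section Families.
Context {R : realType}.
Implicit Types (d e s M : R).

(** A family of functions, indexed by [A], whose derivatives up to order [k]
    exist and are bounded on the ball of radius [d], uniformly in the index. *)
Definition UB (T : Type) (A : set T) d k (F : T -> R -> R) :=
  exists D : nat -> T -> R -> R, [/\ D 0%N = F,
    forall j, (j < k)%N -> forall i, A i -> forall s, `|s| < d ->
      dif (D j i) s (D j.+1 i s) &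
    forall j, (j <= k)%N -> exists M, forall i, A i -> forall s, `|s| < d ->
      `|D j i s| <= M].

Section Index.
Context (T : Type) (A : set T) (d : R).
Implicit Types F : T -> R -> R.

Lemma UB0 F M : (forall i, A i -> forall s, `|s| < d -> `|F i s| <= M) -> UB A d 0 F.
Proof.
by move=> FM; exists (fun=> F); split => // j _; exists M.
Qed.

Lemma UB_S k F F' M : (forall i, A i -> forall s, `|s| < d -> `|F i s| <= M) ->
  (forall i, A i -> forall s, `|s| < d -> dif (F i) s (F' i s)) ->
  UB A d k F' -> UB A d k.+1 F.
Proof.
move=> FM FF' [D [D0 ch DM]].
exists (fun j => if j is j'.+1 then D j' else F); split=> //.
- move=> [|j] jk i Ai s sd; first by rewrite D0; exact: FF'.
  exact: ch.
- by case=> [_|j jk]; [exists M | exact: DM].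
Qed.

Lemma UB_bound k F : UB A d k F -> exists2 M, 0 < M &
  forall i, A i -> forall s, `|s| < d -> `|F i s| <= M.
Proof.
move=> [D [<- _ /(_ 0%N (leq0n k))[M DM]]]; exists (1 + `|M|).
  by rewrite ltr_pwDl.
move=> i Ai s sd; rewrite (le_trans (DM i Ai s sd))//.
by rewrite (le_trans (ler_norm _))// lerDr.
Qed.

Lemma UB_derivative k F : UB A d k.+1 F -> exists2 F',
  (forall i, A i -> forall s, `|s| < d -> dif (F i) s (F' i s)) & UB A d k F'.
Proof.
move=> [D [<- ch DM]]; exists (D 1%N); first by move=> i; apply: ch.
exists (fun j => D j.+1); split=> // j jk; first exact: ch.
exact: DM.
Qed.

Lemma UB_le k k' F : (k' <= k)%N -> UB A d k F -> UB A d k' F.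
Proof.
move=> kk [D [D0 ch DM]]; exists D; split=> // j jk; [apply: ch|apply: DM];
  exact: leq_trans jk kk.
Qed.

Lemma UB_ext k F F' : (forall i, A i -> forall s, `|s| < d -> F i s = F' i s) ->
  UB A d k F -> UB A d k F'.
Proof.
move=> FF' [D [D0 ch DM]].
exists (fun j => if j is j'.+1 then D j else F'); split=> //.
- case=> [|j] jk i Ai s sd; last exact: ch.
  apply: dif_near (ch 0%N jk i Ai s sd); exists (d - `|s|) => [|u us].
    by rewrite subr_gt0.
  rewrite D0; apply: FF' => //.
  by rewrite -(subrK s u) (le_lt_trans (ler_normD _ _))// -ltrBrDr.
- case=> [_|j jk]; last exact: DM.
  have [M DM0] := DM 0%N (leq0n _); exists M => i Ai s sd.
  by rewrite -FF'// -D0; exact: DM0.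
Qed.

Lemma UB_cst k (c : T -> R) M : (forall i, A i -> `|c i| <= M) ->
  UB A d k (fun i _ => c i).
Proof.
elim: k c M => [|k IH] c M cM; first by apply: (@UB0 _ M) => i /cM.
apply: (@UB_S _ _ (fun _ _ => 0) M) => [i /cM//|i _ s _|].
  exact: dif_cst.
by apply: (IH (fun=> 0) 0) => i _; rewrite normr0.
Qed.

Lemma UB_add k F G : UB A d k F -> UB A d k G -> UB A d k (fun i s => F i s + G i s).
Proof.
elim: k F G => [|k IH] F G UF UG.
  have [M _ FM] := UB_bound UF; have [M' _ GM] := UB_bound UG.
  apply: (@UB0 _ (M + M')) => i Ai s sd.
  by rewrite (le_trans (ler_normD _ _))// lerD// ?FM ?GM.
have [M _ FM] := UB_bound UF; have [M' _ GM] := UB_bound UG.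
have [F' FF' UF'] := UB_derivative UF; have [G' GG' UG'] := UB_derivative UG.
apply: (@UB_S _ _ (fun i s => F' i s + G' i s) (M + M')); last exact: IH.
- move=> i Ai s sd.
  by rewrite (le_trans (ler_normD _ _))// lerD// ?FM ?GM.
- by move=> i Ai s sd; apply: difD; [exact: FF' | exact: GG'].
Qed.

Lemma UB_mul k F G : UB A d k F -> UB A d k G -> UB A d k (fun i s => F i s * G i s).
Proof.
elim: k F G => [|k IH] F G UF UG.
  have [M _ FM] := UB_bound UF; have [M' _ GM] := UB_bound UG.
  apply: (@UB0 _ (M * M')) => i Ai s sd.
  by rewrite normrM ler_pM ?FM ?GM.
have [M _ FM] := UB_bound UF; have [M' _ GM] := UB_bound UG.
have [F' FF' UF'] := UB_derivative UF; have [G' GG' UG'] := UB_derivative UG.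
apply: (@UB_S _ _ (fun i s => F' i s * G i s + F i s * G' i s) (M * M')).
- by move=> i Ai s sd; rewrite normrM ler_pM ?FM ?GM.
- by move=> i Ai s sd; apply: difM; [exact: FF' | exact: GG'].
- by apply: UB_add; apply: IH => //; [apply: UB_le UG | apply: UB_le UF].
Qed.

Lemma UB_sum k (I : Type) (r : seq I) (F : I -> T -> R -> R) :
  (forall l, UB A d k (F l)) -> UB A d k (fun i s => \sum_(l <- r) F l i s).
Proof.
move=> UF; elim: r => [|l r IH].
  apply: (@UB_ext _ (fun _ _ => 0)) => [i _ s _|]; first by rewrite big_nil.
  by apply: (@UB_cst _ _ 0) => i _; rewrite normr0.
apply: (@UB_ext _ (fun i s => F l i s + \sum_(l <- r) F l i s)).
  by move=> i _ s _; rewrite big_cons.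
exact: UB_add.
Qed.

Lemma UB_exp k F n : UB A d k F -> UB A d k (fun i s => F i s ^+ n).
Proof.
move=> UF; elim: n => [|n IH].
  by apply: (@UB_cst _ (fun=> 1) 1) => i _; rewrite normr1.
by apply: (@UB_ext _ (fun i s => F i s * F i s ^+ n)) => [i _ s _|];
  [rewrite exprS | exact: UB_mul].
Qed.

(** Landau's inequality, one order at a time. *)
Lemma UB_interpolate k (D : nat -> T -> R -> R) M B : 0 < d ->
  (forall j, (j < k)%N -> forall i, A i -> forall s, `|s| < d ->
      dif (D j i) s (D j.+1 i s)) ->
  (forall i, A i -> forall s, `|s| < d -> `|D 0%N i s| <= M) ->
  (forall i, A i -> forall s, `|s| < d -> `|D k i s| <= B) ->
  forall j, (j <= k)%N -> exists M', forall i, A i -> forall s, `|s| < d ->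
      `|D j i s| <= M'.
Proof.
move=> d0; elim: k => [|k IH] in D M * => ch DM DB.
  by move=> j; rewrite leqn0 => /eqP->; exists M.
move=> [_|j jk]; first by exists M.
have [C _ LC] := @landau R k.
apply: (IH (fun j => D j.+1) (C * (M / (d - (- d)) + B * (d - (- d)) ^+ k))) => //.
- by move=> l lk; apply: ch.
- move=> i Ai s; rewrite ltr_norml => sd.
  apply: (LC (fun j => D j i) (- d) d) => //; first by lra.
  + by move=> l lk u; rewrite -ltr_norml => ud; exact: ch.
  + by move=> u; rewrite -ltr_norml => ud; exact: DM.
  + by move=> u; rewrite -ltr_norml => ud; exact: DB.
Qed.

Lemma UB_lipschitz k F : UB A d k.+1 F -> exists2 M, 0 < M &
  forall i, A i -> forall s, `|s| < d -> `|F i s - F i 0| <= M * `|s|.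
Proof.
move=> /UB_derivative[F' FF' /UB_bound[M M0 FM]]; exists M => // i Ai s sd.
have [s0|s0|->] := ltrgtP s 0; last by rewrite subrr !normr0 mulr0.
- rewrite ltr0_norm// in sd *; have [u|c /andP[? ?]] := @dif_mvt _ (F i) (F' i) s 0 s0.
    by move=> /andP[? ?]; apply: FF' => //; rewrite ler0_norm//; lra.
  rewrite distrC => ->; rewrite normrM sub0r.
  rewrite (gtr0_norm (x := - s)) ?oppr_gt0// ler_wpM2r ?oppr_ge0 ?(ltW s0)//.
  by apply: FM => //; rewrite ltr0_norm//; lra.
- rewrite gtr0_norm// in sd *; have [u|c /andP[? ?]] := @dif_mvt _ (F i) (F' i) 0 s s0.
    by move=> /andP[? ?]; apply: FF' => //; rewrite ger0_norm//; lra.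
  move=> ->; rewrite normrM subr0 (gtr0_norm s0) ler_wpM2r ?(ltW s0)//.
  by apply: FM => //; rewrite gtr0_norm//; lra.
Qed.

Lemma UB_growth F : 0 < d -> UB A d 2 F ->
  (forall i, A i -> forall s, `|s| < d -> 0 <= F i s) ->
  exists2 M, 0 < M & forall i, A i -> forall s, `|s| < d ->
    F i s <= 2 * F i 0 + M * s ^+ 2.
Proof.
move=> d0 [D [<- ch /(_ 2%N (leqnn _))[M DM]]] F0.
exists (2 * `|M| + 1) => [|i Ai s sd]; first by rewrite ltr_wpDl// mulr_ge0.
have := @nonneg_growth R (fun j => D j i) d M d0.
have M0 := ler_norm M; have s0 := sqr_ge0 s.
move=> /(_ _ (F0 i Ai) (DM i Ai) s sd)/le_trans; apply.
  by move=> j jk u; rewrite -ltr_norml => ud; exact: ch.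
by rewrite lerD2l ler_wpM2r//; lra.
Qed.

(** Landau's inequality on an interval of length [2 c]: the bound on the
    derivative of order [k + 1] contributes a multiple of [c ^ k]. *)
Lemma UB_first_derivative k F : UB A d k.+1 F -> exists2 C, 0 < C &
  forall i, A i -> forall c N v : R, 0 < c < d -> 0 <= N -> dif (F i) 0 v ->
    (forall s, `|s| < c -> `|F i s| <= N * c ^+ k.+1) -> `|v| <= C * (N + 1) * c ^+ k.
Proof.
move=> [D [<- ch /(_ k.+1 (leqnn _))[M DM]]]; have [C C0 LC] := @landau R k.
exists (C * (1 + `|M| * 2 ^+ k) + 1).
  by rewrite ltr_wpDl// mulr_ge0// addr_ge0// mulr_ge0// exprn_ge0.
move=> i Ai c N v /andP[c0 cd] N0 Dv FN.
have z0 : `|0 : R| < d by rewrite normr0; lra.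
have -> : v = D 1%N i 0 by apply: dif_unique Dv _; exact: ch.
have cc : c - - c = 2 * c by lra.
have chc : chain (fun j => D j i) (- c) c k.+1.
  by move=> j jk u /andP[? ?]; apply: ch => //; rewrite ltr_norml; apply/andP; split; lra.
have DMc u : - c < u < c -> `|D k.+1 i u| <= `|M|.
  move=> /andP[? ?]; rewrite (le_trans (DM i Ai u _)) ?ler_norm//.
  by rewrite ltr_norml; apply/andP; split; lra.
have FNc u : - c < u < c -> `|D 0%N i u| <= N * c ^+ k.+1.
  by rewrite -ltr_norml => /FN.
have h := LC _ _ _ _ _ (_ : - c < c) chc FNc DMc 0.
rewrite (le_trans (h _ _))//; [by lra|by apply/andP; split; lra|].
rewrite cc exprMn exprS.
have ck : 0 <= c ^+ k by rewrite exprn_ge0// ltW.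
have -> : N * (c * c ^+ k) / (2 * c) = N / 2 * c ^+ k by field; rewrite gt_eqF.
rewrite mulrA -mulrDl mulrA ler_wpM2r//.
set P := `|M| * 2 ^+ k; have P0 : 0 <= P by rewrite mulr_ge0// exprn_ge0.
have : 0 <= C * N by rewrite mulr_ge0.
have : 0 <= C * P by rewrite mulr_ge0.
have : 0 <= C * P * N by rewrite !mulr_ge0.
nra.
Qed.

Lemma UB_peano k F i m M : 0 < d -> UB A d k F -> A i -> (0 < m <= k)%N ->
  (forall s, `|s| < d -> `|F i s| <= M * `|s| ^+ m) ->
  exists L : R, forall e, 0 < e -> exists2 r : R, 0 < r & forall s, `|s| < r ->
    `|F i s - L * s ^+ m| <= e * `|s| ^+ m.
Proof.
move=> d0 + Ai /andP[m0 mk] => /(UB_le mk)[D [<- ch /(_ m (leqnn _))[B DB]]] FM.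
case: m m0 {mk} => // m _ in ch B DB FM *.
apply: (@peano R m (fun j => D j i) d M B) => //; last by move=> s; exact: DB.
by move=> j jk s; rewrite -ltr_norml => sd; exact: ch.
Qed.

End Index.

Lemma UB_restrict (T : Type) (A A' : set T) d d' k F : A' `<=` A -> d' <= d ->
  UB A d k F -> UB A' d' k F.
Proof.
move=> AA dd [D [D0 ch DM]]; exists D; split=> // [j jk i Ai s sd|j jk].
  by apply: ch => //; [exact: AA | exact: lt_le_trans sd dd].
have [M DM'] := DM j jk; exists M => i Ai s sd.
by apply: DM'; [exact: AA | exact: lt_le_trans sd dd].
Qed.

End Families.

(** * Scalar product *)

Section Dot.
Context {R : realType} {n : nat}.
Implicit Types (x y z : 'cV[R]_n) (a : R).

Definition dot x y : R := \sum_i x i 0 * y i 0.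
Definition nsq x : R := dot x x.

Lemma dotC x y : dot x y = dot y x.
Proof. by apply: eq_bigr => i _; rewrite mulrC. Qed.

Lemma dotDr x y z : dot x (y + z) = dot x y + dot x z.
Proof. by rewrite -big_split; apply: eq_bigr => i _; rewrite mxE mulrDr. Qed.

Lemma dotZr a x y : dot x (a *: y) = a * dot x y.
Proof. by rewrite mulr_sumr; apply: eq_bigr => i _; rewrite mxE mulrCA. Qed.

Lemma dotNr x y : dot x (- y) = - dot x y.
Proof. by rewrite -scaleN1r dotZr mulN1r. Qed.

Lemma dotBr x y z : dot x (y - z) = dot x y - dot x z.
Proof. by rewrite dotDr dotNr. Qed.

Lemma dotDl x y z : dot (y + z) x = dot y x + dot z x.
Proof. by rewrite !(dotC _ x) dotDr. Qed.

Lemma dotZl a x y : dot (a *: y) x = a * dot y x.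
Proof. by rewrite !(dotC _ x) dotZr. Qed.

Lemma dotBl x y z : dot (y - z) x = dot y x - dot z x.
Proof. by rewrite !(dotC _ x) dotBr. Qed.

Lemma dot0r x : dot x 0 = 0.
Proof. by rewrite -(scale0r 0) dotZr mul0r. Qed.

Lemma dot_mulmx (A : 'M[R]_n) x y : dot x (A *m y) = dot (A^T *m x) y.
Proof.
have dotE u v : dot u v = (u^T *m v) 0 0 by rewrite mxE; apply: eq_bigr => i _; rewrite mxE.
by rewrite !dotE trmx_mul trmxK mulmxA.
Qed.

Lemma nsq_ge0 x : 0 <= nsq x.
Proof. by apply: sumr_ge0 => i _; rewrite -expr2 sqr_ge0. Qed.

Lemma sqr_normr_le_nsq x : `|x| ^+ 2 <= nsq x.
Proof.
have h i : `|x i 0| ^+ 2 <= nsq x.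
  rewrite real_normK ?num_real// /nsq /dot (bigD1 i)//= -expr2 lerDl.
  by apply: sumr_ge0 => j _; rewrite -expr2 sqr_ge0.
rewrite -[leRHS]sqr_sqrtr ?nsq_ge0// lerXn2r ?nnegrE ?sqrtr_ge0//.
apply: normr_le_coord => [|i j]; first exact: sqrtr_ge0.
by rewrite ord1 -(@ler_pXn2r _ 2) ?nnegrE ?sqrtr_ge0// sqr_sqrtr ?nsq_ge0.
Qed.

Lemma dot_le x y : `|dot x y| <= n%:R * `|x| * `|y|.
Proof.
rewrite (le_trans (ler_norm_sum _ _ _))// -mulrA mulr_natl -[X in _ *+ X]card_ord.
rewrite -sumr_const ler_sum// => i _.
by rewrite normrM ler_pM ?normr_coord.
Qed.

Lemma nsq_eq0 x : (nsq x == 0) = (x == 0).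
Proof.
apply/idP/eqP => [/eqP x0|->]; last by rewrite /nsq dot0r.
apply/eqP; rewrite -normr_eq0 -sqrf_eq0 eq_le sqr_ge0 andbT -x0.
exact: sqr_normr_le_nsq.
Qed.

Lemma nsq_gt0 x : (0 < nsq x) = (x != 0).
Proof. by rewrite lt_def nsq_ge0 andbT nsq_eq0. Qed.

Lemma nsqZ a x : nsq (a *: x) = a ^+ 2 * nsq x.
Proof. by rewrite /nsq dotZr dotZl expr2 mulrA. Qed.

Lemma nsqB x y : nsq (x - y) = nsq x - 2 * dot x y + nsq y.
Proof. by rewrite /nsq dotBr !dotBl (dotC y x); ring. Qed.

Lemma orthogonal_dot (A : 'M[R]_n) x y : orthogonal_mx A -> dot (A *m x) (A *m y) = dot x y.
Proof. by move=> /mulmx1C AA; rewrite dot_mulmx mulmxA AA mul1mx. Qed.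

Lemma orthogonal_nsq (A : 'M[R]_n) x : orthogonal_mx A -> nsq (A *m x) = nsq x.
Proof. by move=> AA; rewrite /nsq orthogonal_dot. Qed.

Lemma dif_dot y (f : R -> 'cV[R]_n) t v : dif f t v -> dif (fun s => dot y (f s)) t (dot y v).
Proof.
move=> D e e0; have C0 : 0 < n%:R * `|y| + 1 by rewrite ltr_wpDl// mulr_ge0.
have [d d0 L] := D _ (divr_gt0 e0 C0); exists d => // h /L hd.
rewrite -[h *: dot y v]/(h * _) -dotZr -!dotBr (le_trans (dot_le _ _))//.
apply: (@le_trans _ _ ((n%:R * `|y| + 1) * `|f (t + h) - f t - h *: v|)).
  by rewrite ler_wpM2r// lerDl.
by rewrite mulrC -ler_pdivlMr// mulrAC.
Qed.

End Dot.

(** * Polynomial functions and invariants *)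

Section PolyFun.
Context {R : realType}.
Implicit Types (f g : 'cV[R]_3 -> R) (x y : 'cV[R]_3).

(** Homogeneous polynomials as functions, given by the inductive process that
    all arguments about them follow. *)
Inductive hpoly : nat -> ('cV[R]_3 -> R) -> Prop :=
| hp_mono (k : R) a b c :
    hpoly (a + b + c) (fun x => k * x 0 0 ^+ a * x 1 0 ^+ b * x 2 0 ^+ c)
| hp_add d f g : hpoly d f -> hpoly d g -> hpoly d (fun x => f x + g x).

Lemma hp_ext d f g : f =1 g -> hpoly d f -> hpoly d g.
Proof. by move=> /funext ->. Qed.

Lemma hp_scale d f (k : R) : hpoly d f -> hpoly d (fun x => k * f x).
Proof.
elim=> [k' a b c|d' f' g _ IHf _ IHg].
  by apply: hp_ext (hp_mono (k * k') a b c) => x; rewrite !mulrA.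
by apply: hp_ext (hp_add IHf IHg) => x; rewrite mulrDr.
Qed.

Lemma hp_zero d : hpoly d (fun=> 0).
Proof.
have -> : d = (d + 0 + 0)%N by rewrite !addn0.
by apply: hp_ext (hp_mono 0 d 0 0) => x; rewrite !mul0r.
Qed.

Lemma hp_cst (k : R) : hpoly 0 (fun=> k).
Proof. by apply: hp_ext (hp_mono k 0 0 0) => x; rewrite !expr0 !mulr1. Qed.

Lemma hp_mul d e f g : hpoly d f -> hpoly e g -> hpoly (d + e) (fun x => f x * g x).
Proof.
move=> Hf; elim: Hf e g => [k a b c|d' f1 f2 _ IH1 _ IH2] e g Hg; last first.
  by apply: hp_ext (hp_add (IH1 _ _ Hg) (IH2 _ _ Hg)) => x; rewrite mulrDl.
elim: Hg => [k' a' b' c'|e' g1 g2 _ IH1 _ IH2]; last first.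
  by apply: hp_ext (hp_add IH1 IH2) => x; rewrite mulrDr.
have -> : (a + b + c + (a' + b' + c') = (a + a') + (b + b') + (c + c'))%N.
  by rewrite !addnA; lia.
by apply: hp_ext (hp_mono (k * k') (a + a') (b + b') (c + c')) => x; rewrite !exprD; ring.
Qed.

Lemma hp_coord i : hpoly 1 (fun x => x i 0).
Proof.
have [->|[->|->]] : i = 0 \/ i = 1 \/ i = 2.
  by case: i => -[|[|[|//]]] p; [left|right; left|right; right]; apply/val_inj.
- by apply: hp_ext (hp_mono 1 1 0 0) => x; rewrite !expr0 !expr1 !mulr1 mul1r.
- by apply: hp_ext (hp_mono 1 0 1 0) => x; rewrite !expr0 !expr1 !mulr1 mul1r.
- by apply: hp_ext (hp_mono 1 0 0 1) => x; rewrite !expr0 !expr1 !mulr1 mul1r.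
Qed.

Lemma hp_sum d (I : Type) (r : seq I) (F : I -> 'cV[R]_3 -> R) :
  (forall i, hpoly d (F i)) -> hpoly d (fun x => \sum_(i <- r) F i x).
Proof.
move=> HF; elim: r => [|i r IH].
  by apply: hp_ext (hp_zero d) => x; rewrite big_nil.
by apply: hp_ext (hp_add (HF i) IH) => x; rewrite big_cons.
Qed.

Lemma hp_dot y : hpoly 1 (dot y).
Proof. by apply: hp_sum => i; apply: hp_scale; exact: hp_coord. Qed.

Lemma hp_exp d f k : hpoly d f -> hpoly (k * d) (fun x => f x ^+ k).
Proof.
move=> Hf; elim: k => [|k IH].
  by apply: hp_ext (hp_cst 1) => x; rewrite expr0.
by apply: hp_ext (hp_mul Hf IH) => x; rewrite exprS.
Qed.

Lemma hp_nsq : hpoly 2 (@nsq R 3).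
Proof.
apply: hp_sum => i; exact: hp_mul (hp_coord i) (hp_coord i).
Qed.

Lemma hp_lin d f (A : 'M[R]_3) : hpoly d f -> hpoly d (fun x => f (A *m x)).
Proof.
elim=> [k a b c|d' f' g _ IHf _ IHg]; last exact: hp_add.
have co i : hpoly 1 (fun x => (A *m x) i 0).
  by apply: hp_ext (hp_dot (row i A)^T) => x; rewrite mxE; apply: eq_bigr => j _;
    rewrite !mxE.
have := hp_mul (hp_mul (hp_exp a (co 0)) (hp_exp b (co 1))) (hp_exp c (co 2)).
rewrite !muln1 => /(hp_scale k); apply: hp_ext => x.
by rewrite !mulrA.
Qed.

Lemma hp_homog d f : hpoly d f -> forall (a : R) x, f (a *: x) = a ^+ d * f x.
Proof.
elim=> [k i j l|d' f' g _ IHf _ IHg] a x; last by rewrite IHf IHg mulrDr.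
by rewrite !mxE !exprMn !exprD; ring.
Qed.

Lemma hp_bound d f : hpoly d f -> exists2 C : R, 0 <= C &
  forall x, `|f x| <= C * `|x| ^+ d.
Proof.
elim=> [k i j l|d' f' g _ [C C0 fC] _ [C' C'0 gC]]; last first.
  exists (C + C') => [|x]; first exact: addr_ge0.
  by rewrite (le_trans (ler_normD _ _))// mulrDl lerD.
exists `|k| => // x; rewrite !normrM !normrX !exprD !mulrA.
by rewrite !ler_pM ?mulr_ge0 ?exprn_ge0 ?lerXn2r ?nnegrE ?normr_coord.
Qed.

Definition polyfun f := exists p : mpoly.mpoly 3 R, forall x, f x = peval p x.

Lemma pf_cst (k : R) : polyfun (fun=> k).
Proof. by exists (mpolyC 3 k) => x; rewrite /peval mevalC. Qed.

Lemma pf_coord i : polyfun (fun x => x i 0).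
Proof. by exists (mpolyX R (mnm1 i)) => x; rewrite /peval mevalXU. Qed.

Lemma pf_add f g : polyfun f -> polyfun g -> polyfun (fun x => f x + g x).
Proof. by move=> [p fp] [q gq]; exists (p + q) => x; rewrite /peval mevalD fp gq. Qed.

Lemma pf_mul f g : polyfun f -> polyfun g -> polyfun (fun x => f x * g x).
Proof. by move=> [p fp] [q gq]; exists (p * q) => x; rewrite /peval mevalM fp gq. Qed.

Lemma pf_ext f g : f =1 g -> polyfun f -> polyfun g.
Proof. by move=> /funext ->. Qed.

Lemma pf_exp f k : polyfun f -> polyfun (fun x => f x ^+ k).
Proof.
move=> Hf; elim: k => [|k IH].
  by apply: pf_ext (pf_cst 1) => x; rewrite expr0.
by apply: pf_ext (pf_mul Hf IH) => x; rewrite exprS.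
Qed.

Lemma pf_sum (I : Type) (r : seq I) (F : I -> 'cV[R]_3 -> R) :
  (forall i, polyfun (F i)) -> polyfun (fun x => \sum_(i <- r) F i x).
Proof.
move=> HF; elim: r => [|i r IH].
  by apply: pf_ext (pf_cst 0) => x; rewrite big_nil.
by apply: pf_ext (pf_add (HF i) IH) => x; rewrite big_cons.
Qed.

Lemma pf_prod (I : Type) (r : seq I) (P : pred I) (F : I -> 'cV[R]_3 -> R) :
  (forall i, polyfun (F i)) -> polyfun (fun x => \prod_(i <- r | P i) F i x).
Proof.
move=> HF; elim: r => [|i r IH].
  by apply: pf_ext (pf_cst 1) => x; rewrite big_nil.
case Pi: (P i); last by apply: pf_ext IH => x; rewrite big_cons Pi.
by apply: pf_ext (pf_mul (HF i) IH) => x; rewrite big_cons Pi.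
Qed.

Lemma hp_pf d f : hpoly d f -> polyfun f.
Proof.
elim=> [k a b c|d' f' g _ + _]; last exact: pf_add.
by do !apply: pf_mul; do ?[exact: pf_cst | apply: pf_exp; exact: pf_coord].
Qed.

Lemma pf_dot y : polyfun (dot y).
Proof. exact: hp_pf (hp_dot y). Qed.

Lemma pf_nsq : polyfun (@nsq R 3).
Proof. exact: hp_pf hp_nsq. Qed.

Lemma pf_dot_lin y (A : 'M[R]_3) : polyfun (fun x => dot y (A *m x)).
Proof. exact: hp_pf (hp_lin A (hp_dot y)). Qed.

Lemma pf_decompose f : polyfun f -> exists (r : seq (nat * ('cV[R]_3 -> R))),
  (forall p, List.In p r -> hpoly p.1 p.2) /\ (forall x, f x = \sum_(p <- r) p.2 x).
Proof.
move=> [p fp]; exists (map (fun mm : multinom 3 => ((\sum_(i < 3) mm i)%N,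
   fun x : 'cV[R]_3 => mcoeff mm p * \prod_(i < 3) x i 0 ^+ mm i)) (msupp p)).
split=> [q|x]; last by rewrite fp /peval mevalE [RHS]big_map.
elim: (msupp p : seq _) => //= mm r IH [<-|/IH//] /=.
apply: hp_scale; rewrite !big_ord_recl big_ord0 addn0 addnA.
have -> : lift ord0 ord0 = 1 :> 'I_3 by apply/val_inj.
have -> : lift ord0 (lift ord0 ord0) = 2 :> 'I_3 by apply/val_inj.
apply: hp_ext (hp_mono 1 (mm 0) (mm 1) (mm 2)) => x.
rewrite !big_ord_recl big_ord0 mulr1 mul1r !mulrA.
have -> : lift ord0 ord0 = 1 :> 'I_3 by apply/val_inj.
by have -> : lift ord0 (lift ord0 ord0) = 2 :> 'I_3 by apply/val_inj.
Qed.

(** The degree [d] part of the ideal generated by the forms [h] of degree [i]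
    with [hs i h]. *)
Inductive ideal (hs : nat -> ('cV[R]_3 -> R) -> Prop) : nat -> ('cV[R]_3 -> R) -> Prop :=
| ideal_gen i h e a : hs i h -> hpoly e a -> ideal hs (i + e) (fun x => h x * a x)
| ideal_add d f g : ideal hs d f -> ideal hs d g -> ideal hs d (fun x => f x + g x).

Lemma ideal_ext hs d f g : f =1 g -> ideal hs d f -> ideal hs d g.
Proof. by move=> /funext ->. Qed.

Lemma ideal_mul hs d e f g : ideal hs d f -> hpoly e g -> ideal hs (d + e) (fun x => f x * g x).
Proof.
move=> If Hg; elim: If => [i h e' a hi Ha|d' f1 f2 _ IH1 _ IH2].
  rewrite -addnA; apply: ideal_ext (ideal_gen hi (hp_mul Ha Hg)) => x.
  by rewrite mulrA.
by apply: ideal_ext (ideal_add IH1 IH2) => x; rewrite mulrDl.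
Qed.

Lemma ideal_scale hs d f (k : R) : ideal hs d f -> ideal hs d (fun x => k * f x).
Proof.
move=> If; rewrite -[d]addn0; apply: ideal_ext (ideal_mul If (hp_cst k)) => x.
by rewrite mulrC.
Qed.

Lemma ideal_base hs i h : hs i h -> ideal hs i h.
Proof.
move=> hi; rewrite -[i]addn0; apply: ideal_ext (ideal_gen hi (hp_cst 1)) => x.
by rewrite mulr1.
Qed.

Lemma ideal_lin (hs hs' : nat -> ('cV[R]_3 -> R) -> Prop) (A : 'M[R]_3) d f :
  (forall i h, hs i h -> hs' i (fun x => h (A *m x))) ->
  ideal hs d f -> ideal hs' d (fun x => f (A *m x)).
Proof.
move=> hh; elim=> [i h e a hi Ha|d' f1 f2 _ IH1 _ IH2]; last exact: ideal_add.
by apply: (ideal_gen (hh _ _ hi)); exact: hp_lin.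
Qed.

End PolyFun.

Section Invariants.
Context {R : realType} (G : seq 'M[R]_3) (GG : mxgroup G).
Implicit Types f : 'cV[R]_3 -> R.

Definition ginvariant f := forall g, g \in G -> forall x, f (g *m x) = f x.

Definition reynolds f x := (size G)%:R^-1 * \sum_(g <- G) f (g *m x).

Lemma reynolds_invariant f : ginvariant (reynolds f).
Proof.
move=> g gG x; rewrite /reynolds; congr (_ * _).
rewrite -[RHS](perm_big _ (mxgroup_perm GG gG)) big_map.
by apply: eq_bigr => h _; rewrite mulmxA.
Qed.

Lemma reynolds_id f : ginvariant f -> reynolds f =1 f.
Proof.
move=> If x; rewrite /reynolds big_seq (eq_bigr (fun=> f x)); last by move=> g /If.
rewrite -big_seq big_const_seq count_predT iter_addr_0 -[f x *+ _]mulr_natl mulrA mulVf ?mul1r//.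
by rewrite pnatr_eq0 -lt0n mxgroup_size_gt0.
Qed.

Lemma hp_reynolds d f : hpoly d f -> hpoly d (reynolds f).
Proof. by move=> Hf; apply: hp_scale; apply: hp_sum => g; exact: hp_lin. Qed.

(** The algebra generated by the invariant forms of degree at most [k]. *)
Inductive gen (k : nat) : ('cV[R]_3 -> R) -> Prop :=
| gen_cst c : gen k (fun=> c)
| gen_base d f : (0 < d <= k)%N -> hpoly d f -> ginvariant f -> gen k f
| gen_add f g : gen k f -> gen k g -> gen k (fun x => f x + g x)
| gen_mul f g : gen k f -> gen k g -> gen k (fun x => f x * g x).

Lemma gen_ext k f g : f =1 g -> gen k f -> gen k g.
Proof. by move=> /funext ->. Qed.

Lemma reynoldsD f g x : reynolds (fun x => f x + g x) x = reynolds f x + reynolds g x.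
Proof. by rewrite /reynolds big_split mulrDr. Qed.

(** Averaging the coefficients of an ideal membership over the group shows that
    every invariant is generated by invariant forms of degree at most [k], as
    soon as invariant forms of positive degree at most [k] generate an ideal
    containing all forms of degree above [k]. *)
Lemma gen_of_ideal k (hs : nat -> ('cV[R]_3 -> R) -> Prop) :
  (forall i h, hs i h -> [/\ (0 < i <= k)%N, hpoly i h & ginvariant h]) ->
  (forall d f, (k < d)%N -> hpoly d f -> ideal hs d f) ->
  forall f, polyfun f -> ginvariant f -> gen k f.
Proof.
move=> hsP all_ideal f pf If.
have main d g : hpoly d g -> gen k (reynolds g).
  elim/ltn_ind: d g => d IH g Hg.
  have [dk|kd] := leqP d k.
    case: d dk Hg {IH} => [|d] dk Hg; last first.
      by apply: (@gen_base _ d.+1) => //; [exact: hp_reynolds|exact: reynolds_invariant].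
    suff gc : forall x, reynolds g x = reynolds g 0.
      by apply: gen_ext (gen_cst k (reynolds g 0)) => x.
    move=> x; have := hp_homog (hp_reynolds Hg) 0 x.
    by rewrite scale0r expr0 mul1r.
  have {Hg kd} := all_ideal d g kd Hg => Ig.
  elim: Ig IH => {d g} [i h e a hi Ha|d g1 g2 _ IH1 _ IH2] IH.
    have [/andP[i0 ik] Hh Ih] := hsP i h hi.
    have E x : reynolds (fun x => h x * a x) x = h x * reynolds a x.
      rewrite /reynolds mulrCA; congr (_ * _); rewrite mulr_sumr big_seq [RHS]big_seq.
      by apply: eq_bigr => g gG; rewrite Ih.
    apply: gen_ext (fun x => esym (E x)) _; apply: gen_mul.
      by apply: gen_base Hh Ih; rewrite i0.
    by apply: (IH e) => //; rewrite -[ltnLHS]add0n ltn_add2r.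
  by apply: gen_ext (fun x => esym (reynoldsD g1 g2 x)) _; apply: gen_add; [exact: IH1|exact: IH2].
have [r [rP fE]] := pf_decompose pf.
apply: (@gen_ext _ (fun x => \sum_(p <- r) reynolds p.2 x)) => [x|].
  rewrite -(reynolds_id If) /reynolds; under [in RHS]eq_bigr do rewrite fE.
  by rewrite exchange_big /= mulr_sumr.
elim: r rP {fE} => [_|p r IH rP].
  by apply: gen_ext (gen_cst k 0) => x; rewrite big_nil.
apply: gen_ext (gen_add (main _ _ (rP p _)) (IH _)) => [x||q qr].
- by rewrite big_cons.
- by left.
- by apply: rP; right.
Qed.

End Invariants.

(** * Directions in general position *)

Section Directions.
Context {R : realType}.

Lemma dot3 (x y : 'cV[R]_3) : dot x y = x 0 0 * y 0 0 + x 1 0 * y 1 0 + x 2 0 * y 2 0.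
Proof.
rewrite /dot !big_ord_recl big_ord0 addr0 addrA.
have -> : lift ord0 ord0 = 1 :> 'I_3 by apply/val_inj.
by have -> : lift ord0 (lift ord0 ord0) = 2 :> 'I_3 by apply/val_inj.
Qed.

Lemma cV3P (x y : 'cV[R]_3) : x 0 0 = y 0 0 -> x 1 0 = y 1 0 -> x 2 0 = y 2 0 -> x = y.
Proof.
move=> e0 e1 e2; apply/matrixP => i j; rewrite ord1.
have [->|[->|->]] // : i = 0 \/ i = 1 \/ i = 2.
by case: i => -[|[|[|//]]] p; [left|right; left|right; right]; apply/val_inj.
Qed.

Lemma vec3E (a b c : R) : [/\ vec3 a b c 0 0 = a, vec3 a b c 1 0 = b & vec3 a b c 2 0 = c].
Proof. by rewrite /vec3 !mxE. Qed.

Lemma norm3_le (x : 'cV[R]_3) (c : R) : `|x 0 0| <= c -> `|x 1 0| <= c -> `|x 2 0| <= c ->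
  `|x| <= c.
Proof.
move=> e0 e1 e2; apply: normr_le_coord => [|i j]; first exact: le_trans e0.
rewrite ord1; have [->|[->|->]] // : i = 0 \/ i = 1 \/ i = 2.
by case: i => -[|[|[|//]]] p; [left|right; left|right; right]; apply/val_inj.
Qed.

(** Divided differences recover [w] from the values of a quadratic polynomial
    with coefficients [w] at three nodes. *)
Lemma moment_curve (M : R) : 0 <= M -> exists2 K : R, 0 < K &
  forall (w : 'cV[R]_3) (a b c e : R), 0 <= a -> a + 1 <= b -> b + 1 <= c -> c <= M ->
  `|dot (vec3 1 a (a ^+ 2)) w| <= e -> `|dot (vec3 1 b (b ^+ 2)) w| <= e ->
  `|dot (vec3 1 c (c ^+ 2)) w| <= e -> `|w| <= K * e.
Proof.
move=> M0; exists (7 + 10 * M + 12 * M ^+ 2) => [|w a b c e a0 ab bc cM].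
  by rewrite ltr_wpDr ?mulr_ge0 ?sqr_ge0// ltr_wpDr// mulr_ge0.
rewrite !dot3; have [-> -> ->] := vec3E 1 a (a ^+ 2).
have [-> -> ->] := vec3E 1 b (b ^+ 2); have [-> -> ->] := vec3E 1 c (c ^+ 2).
set w0 := w 0 0; set w1 := w 1 0; set w2 := w 2 0; rewrite !mul1r => ha hb hc.
have e0 : 0 <= e by exact: le_trans ha.
have slope u v : u + 1 <= v -> `|w0 + u * w1 + u ^+ 2 * w2| <= e ->
    `|w0 + v * w1 + v ^+ 2 * w2| <= e -> `|w1 + (u + v) * w2| <= 2 * e.
  move=> uv hu hv.
  have E : (w1 + (u + v) * w2) * (v - u) =
     (w0 + v * w1 + v ^+ 2 * w2) - (w0 + u * w1 + u ^+ 2 * w2) by ring.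
  have vu : 1 <= v - u by lra.
  apply: (@le_trans _ _ (`|w1 + (u + v) * w2| * (v - u))).
    by rewrite ler_peMr.
  rewrite -[X in _ * X](ger0_norm (le_trans ler01 vu)) -normrM E.
  by rewrite (le_trans (ler_normB _ _))//; lra.
have s1 := slope a b ab ha hb; have s2 := slope b c bc hb hc.
have h2 : `|w2| <= 4 * e.
  apply: (@le_trans _ _ (`|w2| * (c - a))); first by rewrite ler_peMr//; lra.
  have ca : 0 <= c - a by lra.
  rewrite -[X in _ * X](ger0_norm ca) -normrM.
  have -> : w2 * (c - a) = (w1 + (b + c) * w2) - (w1 + (a + b) * w2) by ring.
  by rewrite (le_trans (ler_normB _ _))//; lra.
have abM : 0 <= a + b <= 2 * M by apply/andP; split; lra.
have h1 : `|w1| <= 2 * e + 8 * M * e.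
  rewrite -(addrK ((a + b) * w2) w1) (le_trans (ler_normB _ _))// lerD//.
  rewrite normrM ger0_norm; last by case/andP: abM.
  apply: (@le_trans _ _ ((2 * M) * (4 * e))); last by lra.
  by rewrite ler_pM//; case/andP: abM.
have aM : 0 <= a <= M by apply/andP; split; lra.
have h0 : `|w0| <= e + M * (2 * e + 8 * M * e) + M ^+ 2 * (4 * e).
  have -> : w0 = (w0 + a * w1 + a ^+ 2 * w2) - a * w1 - a ^+ 2 * w2 by ring.
  rewrite (le_trans (ler_normB _ _))// lerD//.
    rewrite (le_trans (ler_normB _ _))// lerD// normrM ler_pM//.
    by rewrite ger0_norm//; case/andP: aM.
  rewrite normrM normrX ler_pM ?exprn_ge0// lerXn2r ?nnegrE//.
  by rewrite ger0_norm//; case/andP: aM.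
have Me : 0 <= M * e by rewrite mulr_ge0.
have MMe : 0 <= M ^+ 2 * e by rewrite mulr_ge0// sqr_ge0.
apply: norm3_le; [apply: le_trans h0 _|apply: le_trans h1 _|apply: le_trans h2 _]; lra.
Qed.

(** A direction on the moment curve that is bad for a given vector is one of at
    most two, so that a long enough list contains a direction that is good for
    all the vectors. *)
Lemma good_direction m : exists (N : seq 'cV[R]_3) (c : R), 0 < c /\
  forall ws : seq 'cV[R]_3, (size ws <= m)%N ->
  exists2 n, n \in N & forall w, w \in ws -> c * `|w| <= `|dot n w|.
Proof.
pose M := 2 * m; pose d (j : nat) : 'cV[R]_3 := vec3 1 j%:R (j%:R ^+ 2).
have [K K0 HK] := @moment_curve M%:R (ler0n _ _).
have K1 : 0 < K + 1 by lra.
pose c := (K + 1)^-1; have c0 : 0 < c by rewrite invr_gt0.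
exists (map d (iota 0 M.+1)), c; split=> // ws sws.
pose bad w j := `|dot (d j) w| < c * `|w|.
have few w : (count (bad w) (iota 0 M.+1) <= 2)%N.
  rewrite leqNgt -size_filter; apply/negP => s3.
  have srt : sorted ltn [seq j <- iota 0 M.+1 | bad w j].
    by apply: sorted_filter; [exact: ltn_trans|exact: iota_ltn_sorted].
  have mem j : j \in [seq j <- iota 0 M.+1 | bad w j] -> bad w j /\ (j <= M)%N.
    by rewrite mem_filter mem_iota add0n ltnS => /andP[-> /andP[_ ->]].
  move: s3 srt mem; case: [seq _ <- _ | _] => [|j1 [|j2 [|j3 r]]]//= _ /and3P[j12 j23 _] mem.
  have [b1 _] : bad w j1 /\ (j1 <= M)%N by apply: mem; rewrite !inE eqxx.
  have [b2 _] : bad w j2 /\ (j2 <= M)%N by apply: mem; rewrite !inE eqxx orbT.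
  have [b3 l3] : bad w j3 /\ (j3 <= M)%N by apply: mem; rewrite !inE eqxx !orbT.
  have w0 : 0 < `|w|.
    by rewrite -(pmulr_rgt0 _ c0); exact: le_lt_trans (normr_ge0 _) b1.
  have := HK w j1%:R j2%:R j3%:R (c * `|w|).
  rewrite !natr1 !ler_nat ler0n => /(_ isT j12 j23 l3 (ltW b1) (ltW b2) (ltW b3)).
  by rewrite mulrA ler_pMl// /c ler_pdivlMr//; lra.
have tot : (count (fun j => has (bad^~ j) ws) (iota 0 M.+1) <= 2 * size ws)%N.
  elim: ws {sws} => [|w ws IH] /=; first by rewrite count_pred0.
  rewrite -[count _ _]/(count (predU (bad w) (fun j => has (bad^~ j) ws)) _).
  rewrite mulnS; apply: leq_trans (leq_add (few w) IH).
  by rewrite -count_predUI leq_addr.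
have : ~~ all (fun j => has (bad^~ j) ws) (iota 0 M.+1).
  by rewrite all_count size_iota; apply/negP => /eqP; rewrite /M in tot *; lia.
move=> /allPn[j jM /hasPn good]; exists (d j); first exact: map_f.
by move=> w /good; rewrite /bad -leNgt.
Qed.

End Directions.

(** * Rotations *)

Section Rotation.
Context {R : realType}.
Implicit Types (x y : 'cV[R]_3) (g : 'M[R]_3).

Lemma unitmx_norm_bound n (A : 'M[R]_n) : (forall x : 'cV[R]_n, A *m x = 0 -> x = 0) ->
  exists2 C : R, 0 < C & forall x : 'cV[R]_n, `|x| <= C * `|A *m x|.
Proof.
move=> inj; have uA : A \in unitmx.
  rewrite -unitmx_tr -row_free_unit; apply: inj_row_free => v vA.
  apply: trmx_inj; rewrite trmx0; apply: inj.
  by rewrite -[A]trmxK -trmx_mul vA trmx0.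
exists (n%:R * `|invmx A| + 1) => [|x]; first by rewrite ltr_wpDl// mulr_ge0.
rewrite -[X in `|X| <= _](mulKmx uA x) (le_trans (mulmx_norm_le _ _))//.
by rewrite ler_wpM2r// lerDl.
Qed.

(** The direction orthogonal to the two fixed ones is an eigenvector, and the
    determinant gives its eigenvalue. *)
Lemma rotation_two_fixed g x y : orthogonal_mx g -> \det g = 1 ->
  x != 0 -> y != 0 -> dot x y = 0 -> g *m x = x -> g *m y = y -> g = 1%:M.
Proof.
move=> og dg x0 y0 xy gx gy.
pose w : 'cV[R]_3 := vec3 (x 1 0 * y 2 0 - x 2 0 * y 1 0)
  (x 2 0 * y 0 0 - x 0 0 * y 2 0) (x 0 0 * y 1 0 - x 1 0 * y 0 0).
have [w1 w2 w3] : [/\ w 0 0 = x 1 0 * y 2 0 - x 2 0 * y 1 0,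
    w 1 0 = x 2 0 * y 0 0 - x 0 0 * y 2 0 & w 2 0 = x 0 0 * y 1 0 - x 1 0 * y 0 0].
  exact: vec3E.
clearbody w.
have xw : dot x w = 0 by rewrite dot3 w1 w2 w3; ring.
have yw : dot y w = 0 by rewrite dot3 w1 w2 w3; ring.
have ww : 0 < nsq w.
  have -> : nsq w = nsq x * nsq y - dot x y ^+ 2.
    by rewrite /nsq !dot3 w1 w2 w3; ring.
  by rewrite xy expr0n/= subr0 mulr_gt0 ?nsq_gt0.
have gt u v : g *m u = u -> dot u (g *m v) = dot u v.
  by move=> gu; rewrite -{1}gu orthogonal_dot.
(* [x], [y], [w] are orthogonal, so they separate points *)
pose B : 'M[R]_3 := \matrix_(i, j) (if j == 0 then x i 0 else if j == 1 then y i 0 else w i 0).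
have BE u : B^T *m u = vec3 (dot x u) (dot y u) (dot w u).
  have [e0 e1 e2] := vec3E (dot x u) (dot y u) (dot w u).
  by apply: cV3P; rewrite ?e0 ?e1 ?e2 mxE; apply: eq_bigr => i _; rewrite !mxE.
pose l := dot w (g *m w) / nsq w.
have sep u : dot x u = 0 -> dot y u = 0 -> dot w u = 0 -> u = 0.
  move=> xu yu wu; have nx : nsq x != 0 by rewrite nsq_eq0.
  have ny : nsq y != 0 by rewrite nsq_eq0.
  have nw : nsq w != 0 by rewrite gt_eqF.
  pose P : 'M[R]_3 := \matrix_(i, j) (if j == 0 then x i 0 / nsq x else
     if j == 1 then y i 0 / nsq y else w i 0 / nsq w).
  have : B^T *m P = 1%:M.
    apply/matrixP => i j.
    have -> : (B^T *m P) i j = (B^T *m (col j P)) i 0.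
      by rewrite !mxE; apply: eq_bigr => k _; rewrite !mxE.
    have colE : col j P = (if j == 0 then (nsq x)^-1 *: x else
       if j == 1 then (nsq y)^-1 *: y else (nsq w)^-1 *: w).
      apply/matrixP => k k'; rewrite ord1 [LHS]mxE [LHS]mxE.
      by case: ifP => _; [|case: ifP => _]; rewrite [RHS]mxE mulrC.
    rewrite BE colE; have [e0 e1 e2] := vec3E (dot x (col j P)) (dot y (col j P)) (dot w (col j P)).
    rewrite -colE mxE [RHS]mxE; rewrite colE.
    have I3 (k : 'I_3) : k = 0 \/ k = 1 \/ k = 2.
      by case: k => -[|[|[|//]]] p; [left|right; left|right; right]; apply/val_inj.
    by have [->|[->|->]] := I3 i; have [->|[->|->]] := I3 j; rewrite /= !dotZr
       ?(dotC y x) ?(dotC w) ?xy ?xw ?yw ?mulr0 //= mulVf.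
  move=> BP; have : B^T *m u = 0.
    by rewrite BE xu yu wu; apply/matrixP => i j; rewrite !mxE; case: i => -[|[|[|]]].
  by move=> /(congr1 (mulmx P)); rewrite mulmxA (mulmx1C BP) mul1mx mulmx0.
have gw : g *m w = l *: w.
  apply/subr0_eq/sep; rewrite dotBr dotZr ?(gt x _ gx) ?(gt y _ gy) ?xw ?yw ?mulr0 ?subr0//.
  by rewrite /l -/(nsq w) divfK ?subrr// gt_eqF.
pose D : 'rV[R]_3 := \row_j (if j == 2 then l else 1).
have gB : g *m B = B *m diag_mx D.
  apply/matrixP => i j; rewrite mul_mx_diag [RHS]mxE.
  have -> : (g *m B) i j = (g *m col j B) i 0.
    by rewrite !mxE; apply: eq_bigr => k _; rewrite !mxE.
  have I3 (k : 'I_3) : k = 0 \/ k = 1 \/ k = 2.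
    by case: k => -[|[|[|//]]] p; [left|right; left|right; right]; apply/val_inj.
  have colE : col j B = if j == 0 then x else if j == 1 then y else w.
    by apply/matrixP => k k'; rewrite ord1 !mxE; case: ifP => _ //; case: ifP.
  rewrite colE; have [->|[->|->]] := I3 j; rewrite /= ?gx ?gy ?gw !mxE /= ?mulr1//.
  by rewrite mulrC.
have uB : \det B != 0.
  rewrite -unitfE -[_ \is a _]/(B \in unitmx) -row_free_unit.
  apply: inj_row_free => v vB; apply: trmx_inj; rewrite trmx0.
  have : B^T *m v^T = 0 by rewrite -trmx_mul vB trmx0.
  rewrite BE => E; apply: sep.
  - by have [<- _ _] := vec3E (dot x v^T) (dot y v^T) (dot w v^T); rewrite E mxE.
  - by have [_ <- _] := vec3E (dot x v^T) (dot y v^T) (dot w v^T); rewrite E mxE.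
  - by have [_ _ <-] := vec3E (dot x v^T) (dot y v^T) (dot w v^T); rewrite E mxE.
have l1 : l = 1.
  have := congr1 determinant gB; rewrite !det_mulmx dg mul1r det_diag.
  rewrite !big_ord_recl big_ord0 !mxE /= mul1r mul1r mulr1 => /esym.
  by rewrite -[RHS]mulr1 => /(mulfI uB).
have D1 : diag_mx D = 1%:M.
  by rewrite (_ : D = const_mx 1) ?diag_const_mx//; apply/rowP => j; rewrite !mxE l1 if_same.
have uB' : B \in unitmx by rewrite unitmxE unitfE.
by rewrite -[g](mulmxK uB') gB D1 mulmx1 mulmxV.
Qed.

End Rotation.

Section AxisDistance.
Context {R : realType}.
Implicit Types (e x y : 'cV[R]_3) (g : 'M[R]_3).

(** [nsq e] times the squared distance of [x] to the line spanned by [e]. *)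
Definition axisq e x := nsq e * nsq x - dot e x ^+ 2.

Lemma axisq_ge0 e x : 0 <= axisq e x.
Proof.
have -> : axisq e x = (e 0 0 * x 1 0 - e 1 0 * x 0 0) ^+ 2 +
  (e 0 0 * x 2 0 - e 2 0 * x 0 0) ^+ 2 + (e 1 0 * x 2 0 - e 2 0 * x 1 0) ^+ 2.
  by rewrite /axisq /nsq !dot3; ring.
by rewrite !addr_ge0 ?sqr_ge0.
Qed.

Lemma axisq_le e x : axisq e x <= nsq e * nsq x.
Proof. by rewrite /axisq gerBl sqr_ge0. Qed.

Lemma axisq_shift e x : axisq e x = axisq e (x - e).
Proof. by rewrite /axisq nsqB dotBr (dotC x e) /nsq; ring. Qed.

Lemma axisq_eq0 e x : axisq e x = 0 -> e != 0 -> nsq x = nsq e -> x = e \/ x = - e.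
Proof.
rewrite /axisq => + e0 xe; rewrite xe => /eqP; rewrite subr_eq0 -expr2 eq_sym eqf_sqr.
move=> /orP[/eqP E|/eqP E].
  by left; apply/subr0_eq/eqP; rewrite -nsq_eq0 nsqB xe dotC E; apply/eqP; ring.
right; apply/subr0_eq/eqP; rewrite -nsq_eq0 nsqB dotNr dotC E.
by rewrite xe -[- e]scaleN1r nsqZ; apply/eqP; ring.
Qed.

Lemma pf_axisq_lin e (A : 'M[R]_3) : polyfun (fun x => axisq e (A *m x)).
Proof.
have pf_nsqA : polyfun (fun x => nsq (A *m x)) by exact: hp_pf (hp_lin A hp_nsq).
have := pf_add (pf_mul (pf_cst (nsq e)) pf_nsqA)
  (pf_mul (pf_cst (-1)) (pf_exp 2 (pf_dot_lin e A))).
by apply: pf_ext => x; rewrite mulN1r.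
Qed.

Lemma axisq_mul e g x : orthogonal_mx g -> axisq e (g *m x) = axisq (g^T *m e) x.
Proof.
move=> og; rewrite /axisq dot_mulmx orthogonal_nsq//.
by rewrite (@orthogonal_nsq _ _ g^T)// /orthogonal_mx trmxK; exact: mulmx1C.
Qed.

Lemma axisqN e x : axisq (- e) x = axisq e x.
Proof.
by rewrite /axisq -[- e]scaleN1r nsqZ dotZl; ring.
Qed.

Lemma nsq_le_normr x : nsq x <= 3 * `|x| ^+ 2.
Proof.
by rewrite (le_trans (ler_norm _))// (le_trans (dot_le _ _))// expr2 mulrA.
Qed.

(** A rotation about [e] other than the identity has no other fixed direction,
    so it displaces every point by an amount comparable with its distance to
    the axis. *)
Lemma rotation_moves e g : orthogonal_mx g -> \det g = 1 -> e != 0 ->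
  g *m e = e -> g != 1%:M ->
  exists2 c : R, 0 < c & forall x, c * axisq e x <= nsq (g *m x - x).
Proof.
move=> og dg e0 ge g1; have ne : 0 < nsq e by rewrite nsq_gt0.
(* [A] is injective, and it agrees with [g - 1] on the plane orthogonal to [e] *)
pose A := g - 1%:M + e *m e^T.
have AE x : A *m x = g *m x - x + dot e x *: e.
  rewrite /A mulmxDl mulmxBl mul1mx -mulmxA; congr (_ + _).
  have -> : e^T *m x = (dot e x)%:M.
    by apply/matrixP => i j; rewrite !ord1 !mxE eqxx mulr1n; apply: eq_bigr => k _; rewrite mxE.
  by rewrite mul_mx_scalar.
have dg0 x : dot e (g *m x) = dot e x by rewrite -{1}ge orthogonal_dot.
have [|C C0 bnd] := @unitmx_norm_bound R 3 A.
  move=> x; rewrite AE => Ax.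
  have : dot e (g *m x - x + dot e x *: e) = 0 by rewrite Ax dot0r.
  rewrite dotDr dotBr dg0 subrr add0r dotZr => /eqP.
  rewrite mulf_eq0 (gt_eqF ne) orbF => /eqP ex.
  move: Ax; rewrite ex scale0r addr0 => /subr0_eq gx.
  by apply/eqP; apply: contraNT g1 => x0; apply/eqP; exact: (rotation_two_fixed og dg e0 x0).
exists (3 * C ^+ 2 * nsq e)^-1 => [|x].
  by rewrite invr_gt0 !mulr_gt0// exprn_gt0.
rewrite ler_pdivrMl; last by rewrite !mulr_gt0// exprn_gt0.
pose z := x - (dot e x / nsq e) *: e.
have ez : dot e z = 0 by rewrite dotBr dotZr -/(nsq e) divfK ?subrr// gt_eqF.
have Az : A *m z = g *m x - x.
  by rewrite AE ez scale0r addr0 /z mulmxBr -scalemxAr ge opprB addrA subrK.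
have -> : axisq e x = nsq e * nsq z.
  rewrite /z nsqB nsqZ dotZr (dotC x) /axisq; field.
  by rewrite gt_eqF.
rewrite -Az; have -> : 3 * C ^+ 2 * nsq e * nsq (A *m z) =
    nsq e * (3 * (C ^+ 2 * nsq (A *m z))) by ring.
rewrite ler_wpM2l ?(ltW ne)// (le_trans (nsq_le_normr z))// ler_wpM2l//.
apply: (@le_trans _ _ ((C * `|A *m z|) ^+ 2)).
  by rewrite lerXn2r ?nnegrE ?mulr_ge0 ?(ltW C0).
by rewrite exprMn ler_wpM2l ?exprn_ge0 ?(ltW C0)// sqr_normr_le_nsq.
Qed.

Lemma pf_continuous (f : 'cV[R]_3 -> R) x : polyfun f -> forall e : R, 0 < e ->
  exists2 d : R, 0 < d & forall y, `|y - x| < d -> `|f y - f x| < e.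
Proof.
move=> pf; suff cf : {for x, continuous f}.
  move=> e e0; have /cvgrPdist_lt/(_ e e0) := cf.
  move=> /nbhs_ballP[d /= d0 dP]; exists d => // y yx; rewrite distrC; apply: dP.
  by rewrite -ball_normE /ball_/= distrC.
have hc d (h : 'cV[R]_3 -> R) : hpoly d h -> {for x, continuous h}.
  elim=> [k a b c|d' g1 g2 _ IH1 _ IH2]; last exact: (cvgD IH1 IH2).
  have co i m : {for x, continuous (fun y : 'cV[R]_3 => y i 0 ^+ m)}.
    apply: (@continuous_comp _ _ _ (fun y : 'cV[R]_3 => y i 0) (fun u : R => u ^+ m)).
      exact: coord_continuous.
    exact: exprn_continuous.
  have ck : {for x, continuous (fun _ : 'cV[R]_3 => k)} by exact: cst_continuous.
  exact: (cvgM (cvgM (cvgM ck (co 0 a)) (co 1 b)) (co 2 c)).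
have [r [rP fE]] := pf_decompose pf.
have -> : f = (fun x => \sum_(p <- r) p.2 x) by apply/funext.
elim: r rP {fE} => [_|p r IH rP].
  have -> : (fun x : 'cV[R]_3 => \sum_(p <- [::]) (p : nat * ('cV[R]_3 -> R)).2 x) = cst 0.
    by apply/funext => y; rewrite big_nil.
  exact: cst_continuous.
have -> : (fun x => \sum_(q <- p :: r) q.2 x) = (fun x => p.2 x + \sum_(q <- r) q.2 x).
  by apply/funext => y; rewrite big_cons.
have cp : {for x, continuous p.2} by apply: (hc p.1); apply: rP; left.
apply: (cvgD cp).
by apply: IH => q qr; apply: rP; right.
Qed.

End AxisDistance.

Section Products.
Context {R : realType}.

Lemma prod_bound (T : eqType) (r : seq T) (P : pred T) (F : T -> R) (K : R) : 1 <= K ->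
  (forall i, i \in r -> 0 <= F i <= K) -> 0 <= \prod_(i <- r | P i) F i <= K ^+ size r.
Proof.
move=> K1; have K0 : 0 <= K by exact: le_trans K1.
elim: r => [|i r IH] FK; first by rewrite big_nil expr0 ler01 lexx.
have /andP[IH0 {}IH] : 0 <= \prod_(i <- r | P i) F i <= K ^+ size r.
  by apply: IH => j jr; apply: FK; rewrite inE jr orbT.
rewrite big_cons exprS; have /andP[F0 FiK] := FK i (mem_head _ _).
case: ifP => _; first by rewrite mulr_ge0//= ler_pM.
by rewrite IH0/= (le_trans IH)// ler_peMl// exprn_ge0.
Qed.

Lemma prod_lower (T : eqType) (r : seq T) (P : pred T) (F : T -> R) (a b : R) :
  0 <= a -> 0 <= b -> (forall i, i \in r -> P i -> a <= F i) ->
  (forall i, i \in r -> ~~ P i -> b <= F i) ->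
  a ^+ count P r * b ^+ (size r - count P r) <= \prod_(i <- r) F i.
Proof.
move=> a0 b0; elim: r => [|i r IH] aF bF; first by rewrite big_nil subnn !expr0 mulr1.
have {}IH : a ^+ count P r * b ^+ (size r - count P r) <= \prod_(i <- r) F i.
  by apply: IH => j jr; [apply: aF|apply: bF]; rewrite inE jr orbT.
rewrite big_cons /=; case Pi: (P i).
  rewrite add1n subSS exprS -mulrA ler_pM// ?mulr_ge0 ?exprn_ge0//.
  by apply: aF => //; exact: mem_head.
rewrite add0n subSn ?count_size// exprS mulrCA ler_pM// ?mulr_ge0 ?exprn_ge0//.
by apply: bF; [exact: mem_head|rewrite Pi].
Qed.

Lemma prod_upper (T : eqType) (r : seq T) (P : pred T) (F : T -> R) (a b : R) :
  (forall i, i \in r -> P i -> 0 <= F i <= a) ->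
  (forall i, i \in r -> ~~ P i -> 0 <= F i <= b) ->
  0 <= \prod_(i <- r) F i <= a ^+ count P r * b ^+ (size r - count P r).
Proof.
elim: r => [|i r IH] aF bF; first by rewrite big_nil subnn !expr0 mulr1 ler01 lexx.
have /andP[IH0 {}IH] : 0 <= \prod_(i <- r) F i <= a ^+ count P r * b ^+ (size r - count P r).
  by apply: IH => j jr; [apply: aF|apply: bF]; rewrite inE jr orbT.
rewrite big_cons /=; case Pi: (P i).
  have /andP[F0 Fa] : 0 <= F i <= a by apply: aF => //; exact: mem_head.
  by rewrite add1n subSS exprS -mulrA mulr_ge0//= ler_pM.
have /andP[F0 Fb] : 0 <= F i <= b by apply: bF; [exact: mem_head|rewrite Pi].
by rewrite add0n subSn ?count_size// exprS mulrCA mulr_ge0//= ler_pM.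
Qed.

End Products.

(** * Orbits near a point *)

Section RotationGroup.
Context {R : realType} (G : seq 'M[R]_3) (GG : mxgroup G).
Hypothesis OG : forall g, g \in G -> orthogonal_mx g.
Implicit Types (e x : 'cV[R]_3).

Lemma trmx_in g : g \in G -> g^T \in G.
Proof.
move=> gG; have [_ _ _ GV] := GG; have [h hG hg] := GV g gG.
suff -> : g^T = h by [].
by rewrite -[g^T]mul1mx -hg -mulmxA OG// mulmx1.
Qed.

Lemma trmx_fixed g e v : g \in G -> g *m e = v -> g^T *m v = e.
Proof. by move=> gG <-; rewrite mulmxA (mulmx1C (OG gG)) mul1mx. Qed.

(** The sum over the group of the products of the squared distances to the
    conjugate axes; near [e], the distances to the axes other than the one of [e]
    are bounded below. *)
Lemma axis_invariant e : e != 0 -> exists Q, [/\ polyfun Q, ginvariant G Q,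
  forall x, 0 <= Q x,
  forall B, exists2 C, 0 <= C & forall x, nsq x <= B -> Q x <= C * axisq e x &
  exists r c : R, [/\ 0 < r, 0 < c & forall x, `|x - e| < r -> c * axisq e x <= Q x]].
Proof.
move=> e0; have [Gu G1 GM GV] := GG.
pose other (g : 'M[R]_3) := (g *m e != e) && (g *m e != - e).
pose Psi x := \prod_(g <- G | other g) axisq e (g^T *m x).
pose phi x := axisq e x * Psi x.
have Psi0 x : 0 <= Psi x by apply: prodr_ge0 => g _; exact: axisq_ge0.
have phi0 x : 0 <= phi x by rewrite mulr_ge0// axisq_ge0.
have pfPsi A : polyfun (fun x => Psi (A *m x)).
  apply: pf_prod => g.
  by apply: pf_ext (pf_axisq_lin e (g^T *m A)) => x; rewrite mulmxA.
have pfphi A : polyfun (fun x => phi (A *m x)).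
  exact: pf_mul (pf_axisq_lin e A) (pfPsi A).
pose Q x := \sum_(h <- G) phi (h *m x).
exists Q; split.
- exact: pf_sum.
- move=> g gG x; rewrite /Q -[RHS](perm_big _ (mxgroup_perm GG gG)) big_map.
  by apply: eq_bigr => h _; rewrite mulmxA.
- by move=> x; apply: sumr_ge0 => h _.
- move=> B; pose K := 1 + nsq e * `|B|.
  have K1 : 1 <= K by rewrite lerDl mulr_ge0// nsq_ge0.
  have K0 : 0 <= K by exact: le_trans K1.
  exists ((size G)%:R * (K * K ^+ size G)) => [|x xB]; first by rewrite !mulr_ge0// exprn_ge0.
  have qK g : g \in G -> 0 <= axisq e (g *m x) <= K.
    move=> gG; rewrite axisq_ge0/= (le_trans (axisq_le _ _))// (orthogonal_nsq _ (OG gG)).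
    apply: (@le_trans _ _ (nsq e * `|B|)); last by rewrite lerDr.
    by rewrite ler_wpM2l ?nsq_ge0// (le_trans xB)// ler_norm.
  suff H h : h \in G -> phi (h *m x) <= K * K ^+ size G * axisq e x.
    apply: (@le_trans _ _ (\sum_(h <- G) K * K ^+ size G * axisq e x)).
      by rewrite /Q big_seq [leRHS]big_seq; exact: ler_sum.
    by rewrite big_const_seq count_predT iter_addr_0 -[leLHS]mulr_natl -!mulrA.
  move=> hG; rewrite /phi; have qhx : 0 <= axisq e (h *m x) <= K by exact: qK.
  have qgh g : g \in G -> 0 <= axisq e (g^T *m (h *m x)) <= K.
    by move=> gG; rewrite mulmxA qK// GM// trmx_in.
  have [/andP[he1 he2]|] := boolP (other h).
    rewrite /Psi (big_rem h)//= {1}/other he1 he2 /=.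
    rewrite mulmxA (mulmx1C (OG hG)) mul1mx.
    rewrite mulrCA mulrC ler_wpM2r ?axisq_ge0//.
    have /andP[p0 pK] := @prod_bound _ _ (rem h G) other
      (fun g => axisq e (g^T *m (h *m x))) K K1 (fun g gr => qgh g (mem_rem gr)).
    have /andP[q0 qK'] := qhx; rewrite ler_pM// (le_trans pK)//.
    by rewrite ler_weXn2l// size_rem// leq_pred.
  rewrite negb_and !negbK => he.
  have -> : axisq e (h *m x) = axisq e x.
    rewrite (axisq_mul _ _ (OG hG)); case/orP: he => /eqP he.
      by rewrite (trmx_fixed hG he).
    have := trmx_fixed hG he; rewrite mulmxN => E.
    by rewrite -axisqN E.
  rewrite mulrC ler_wpM2r ?axisq_ge0//.
  apply: (@le_trans _ _ (K ^+ size G)); last by rewrite ler_peMl// exprn_ge0.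
  by have /andP[] := @prod_bound _ _ G other (fun g => axisq e (g^T *m (h *m x))) K K1 qgh.
- have Psie : 0 < Psi e.
    rewrite /Psi big_seq_cond; apply: prodr_gt0 => g /andP[gG /andP[ge1 ge2]].
    rewrite lt_def axisq_ge0 andbT; apply/negP => /eqP.
    rewrite (axisq_mul _ _ (OG (trmx_in gG))) trmxK => Z.
    have nge : g *m e != 0.
      by rewrite -nsq_eq0 (orthogonal_nsq _ (OG gG)) nsq_eq0.
    have [|E|E] := axisq_eq0 Z nge; first by rewrite (orthogonal_nsq _ (OG gG)).
      by rewrite -E eqxx in ge1.
    by move: ge2; rewrite [X in _ != - X]E opprK eqxx.
  have [||r r0 rP] := @pf_continuous R Psi e _ (Psi e / 2).
    by apply: pf_ext (pfPsi 1%:M) => x; rewrite mul1mx.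
    by rewrite divr_gt0.
  exists r, (Psi e / 2); split; [by []|by rewrite divr_gt0|move=> x /rP].
  rewrite ltr_distl => /andP[lo _].
  rewrite /Q (bigD1_seq 1%:M)//= mul1mx ler_wpDr ?sumr_ge0// /phi mulrC.
  by rewrite ler_wpM2l ?axisq_ge0//; lra.
Qed.

(** The product of the squared distances from the points of the orbit to [e] is
    small only if one of the factors is. *)
Lemma orbit_close e (r : R) : 0 < r -> exists N, [/\ polyfun N, ginvariant G N, N e = 0 &
  exists2 d : R, 0 < d & forall x, N x < d -> exists2 g, g \in G & `|g *m x - e| < r].
Proof.
move=> r0; have [Gu G1 GM GV] := GG.
pose N x := \prod_(g <- G) nsq (g *m x - e).
exists N; split.
- apply: pf_prod => g.
  have pf_nsqg : polyfun (fun x => nsq (g *m x)) by exact: hp_pf (hp_lin g hp_nsq).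
  have := pf_add (pf_add pf_nsqg (pf_mul (pf_cst (- 2)) (pf_dot_lin e g))) (pf_cst (nsq e)).
  by apply: pf_ext => x; rewrite nsqB (dotC _ e) mulNr.
- move=> g gG x; rewrite /N -[RHS](perm_big _ (mxgroup_perm GG gG)) big_map.
  by apply: eq_bigr => h _; rewrite mulmxA.
- rewrite /N (bigD1_seq 1%:M)//= mul1mx subrr.
  have -> : nsq (0 : 'cV[R]_3) = 0 by rewrite /nsq dot0r.
  by rewrite mul0r.
- exists ((r ^+ 2) ^+ size G) => [|x]; first by rewrite !exprn_gt0.
  move=> Nx; apply: contrapT => far; move: Nx; apply/negP; rewrite -leNgt.
  have := @prod_lower R _ G xpredT (fun g => nsq (g *m x - e)) (r ^+ 2) 1 _ ler01.
  rewrite count_predT subnn expr0 mulr1; apply=> //; first by rewrite exprn_ge0// ltW.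
  move=> g gG _; apply: le_trans (sqr_normr_le_nsq _).
  rewrite lerXn2r ?nnegrE ?(ltW r0)// leNgt; apply/negP => lt.
  by apply: far; exists g.
Qed.

(** Along the axis one uses that
    [(D - a) (D + a) = a (X - a) - q], where [a], [X] are the squared norms of
    [e], [x], and [D], [q] stand for [dot e x], [axisq e x]. *)
Lemma near_axis_estimate e x (t K1 K2 : R) : e != 0 -> 0 <= dot e x ->
  0 <= t <= 1 -> 0 <= K1 -> 0 <= K2 ->
  axisq e x <= K1 * t ^+ 2 -> `|nsq x - nsq e| <= K2 * t ->
  nsq (x - e) <= (K1 + (K2 + K1 / nsq e) ^+ 2) / nsq e * t ^+ 2.
Proof.
move=> e0 D0 /andP[t0 t1] K10 K20; have a0 : 0 < nsq e by rewrite nsq_gt0.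
have q0 := axisq_ge0 e x.
have qE : axisq e x = nsq e * nsq x - dot e x ^+ 2 by [].
rewrite nsqB (dotC x); move: a0 q0 qE D0.
move: (nsq e) (axisq e x) (nsq x) (dot e x) => a q X D a0 q0 qE D0 hq hX.
rewrite mulrAC ler_pdivlMr//.
have -> : (X - 2 * D + a) * a = q + (D - a) ^+ 2 by rewrite qE; ring.
rewrite mulrDl lerD//.
have Da : `|D - a| <= (K2 + K1 / a) * t.
  have E : (D - a) * (D + a) = a * (X - a) - q by rewrite qE; ring.
  have Dpa : a <= D + a by rewrite lerDr.
  have h1 : `|D - a| * a <= a * `|X - a| + q.
    apply: (@le_trans _ _ (`|D - a| * (D + a))); first by rewrite ler_wpM2l.
    rewrite -[X in _ * X]ger0_norm ?addr_ge0 ?(ltW a0)// -normrM E.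
    by rewrite (le_trans (ler_normB _ _))// normrM (gtr0_norm a0) (ger0_norm q0).
  have h2 : q <= K1 * t.
    rewrite (le_trans hq)// ler_wpM2l// expr2 ler_piMl//.
  rewrite -(ler_pM2r a0) (le_trans h1)// mulrDl mulrDl.
  have -> : K1 / a * t * a = K1 * t by field; rewrite gt_eqF.
  by rewrite lerD// mulrC ler_wpM2r// ltW.
have -> : (K2 + K1 / a) ^+ 2 * t ^+ 2 = ((K2 + K1 / a) * t) ^+ 2 by rewrite exprMn.
rewrite -[leLHS]real_normK ?num_real// lerXn2r ?nnegrE//.
by rewrite mulr_ge0// addr_ge0// divr_ge0// ltW.
Qed.

(** If the curve starts close to [e], its orbit stays close to [e] for a
    proportional time: transversally to the axis because the invariant
    comparable with the squared distance is nonnegative, along the axis because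
    the norm is an invariant. *)
Lemma orbit_stays_close (T : Type) (A : set T) (d : R) (y : T -> R -> 'cV[R]_3) e :
  0 < d -> e != 0 ->
  (forall f, polyfun f -> ginvariant G f -> UB A d 15 (fun i s => f (y i s))) ->
  exists C r : R, [/\ 0 < C, 0 < r <= d & forall i, A i -> `|y i 0 - e| < r ->
    forall s, `|s| < r -> exists2 g, g \in G &
      `|g *m y i s - e| <= C * (`|y i 0 - e| + `|s|)].
Proof.
move=> d0 e0 UBf; have [Gu G1 GM GV] := GG.
have a0 : 0 < nsq e by rewrite nsq_gt0.
have inv_nsq : ginvariant G (@nsq R 3) by move=> g gG x; rewrite (orthogonal_nsq _ (OG gG)).
have UBn := UBf _ pf_nsq inv_nsq.
have [B B0 nsqB_] := UB_bound UBn.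
have [Q [pfQ invQ Q0 Qup [r1 [c [r10 c0 Qlo]]]]] := axis_invariant e0.
have [CQ CQ0 {}Qup] := Qup B.
have UBQ := UBf Q pfQ invQ.
have [M M0 grow] : exists2 M, 0 < M & forall i, A i -> forall s, `|s| < d ->
    Q (y i s) <= 2 * Q (y i 0) + M * s ^+ 2.
  by apply: UB_growth => //; apply: UB_le UBQ.
have [Ln Ln0 lipn] := UB_lipschitz UBn.
(* near [e] the scalar product with [e] is positive *)
have [r2 r20 dotpos] := @pf_continuous R (dot e) e (pf_dot e) _ a0.
pose r3 := Num.min r1 r2; have r30 : 0 < r3 by rewrite lt_min r10.
have [N [pfN invN Ne [dN dN0 Nclose]]] := orbit_close e r30.
have [LN LN0 lipN] := UB_lipschitz (UBf N pfN invN).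
have dN2 : 0 < dN / 2 by rewrite divr_gt0.
have [r4 r40 Nnear] := @pf_continuous R N e pfN _ dN2.
pose E1 := 3 * (2 * `|e| + 1).
have E10 : 0 <= E1 by rewrite mulr_ge0// addr_ge0// mulr_ge0.
pose K1 := (2 * CQ * (nsq e * 3) + M) / c.
pose K2 := Ln + E1.
have K10 : 0 <= K1.
  by rewrite divr_ge0 ?(ltW c0)// addr_ge0 ?(ltW M0)// !mulr_ge0// ltW.
have K20 : 0 <= K2 by rewrite addr_ge0// ltW.
pose C2 := (K1 + (K2 + K1 / nsq e) ^+ 2) / nsq e.
have C20 : 0 <= C2 by rewrite divr_ge0 ?(ltW a0)// addr_ge0// sqr_ge0.
pose r := Num.min (Num.min d (1 / 2)) (Num.min r4 (dN / 2 / LN)).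
have r0 : 0 < r by rewrite !lt_min d0 r40 !divr_gt0.
exists (1 + C2), r; split; [by rewrite ltr_wpDr|by rewrite r0/= !ge_min lexx|].
move=> i Ai; rewrite !lt_min => /andP[/andP[ed e12] /andP[er4 _]] s.
rewrite !lt_min => /andP[/andP[sd s12] /andP[_ sN]].
set eta := `|y i 0 - e| in ed e12 er4 *.
have eta0 : 0 <= eta by exact: normr_ge0.
have zd : `|0 : R| < d by rewrite normr0.
have [|g gG gclose] := Nclose (y i s).
  have := lipN i Ai s sd; rewrite ler_distl => /andP[_ up].
  have := Nnear _ er4; rewrite Ne subr0 => /(le_lt_trans (ler_norm _)) N0.
  move: sN; rewrite ltr_pdivlMr// mulrC => sN.
  by lra.
exists g => //; set x := g *m y i s in gclose *.
have nx : nsq x = nsq (y i s) by rewrite (orthogonal_nsq _ (OG gG)).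
move: gclose; rewrite lt_min => /andP[xr1 xr2].
have D0 : 0 <= dot e x.
  have := dotpos x xr2; rewrite ltr_distl => /andP[+ _].
  by rewrite -/(nsq e) subrr => /ltW.
pose t := eta + `|s|.
have t01 : 0 <= t <= 1 by rewrite addr_ge0//=; rewrite /t; lra.
have st : `|s| <= t by rewrite lerDr.
have et : eta <= t by rewrite lerDl.
have hq : axisq e x <= K1 * t ^+ 2.
  rewrite /K1 mulrAC ler_pdivlMr// mulrC (le_trans (Qlo x xr1))//.
  rewrite /x invQ// (le_trans (grow i Ai s sd))//.
  have Qi : Q (y i 0) <= CQ * (nsq e * (3 * t ^+ 2)).
    rewrite (le_trans (Qup _ _))//.
      by have := nsqB_ i Ai 0 zd; rewrite ger0_norm ?nsq_ge0.
    rewrite ler_wpM2l// axisq_shift (le_trans (axisq_le _ _))// ler_wpM2l ?(ltW a0)//.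
    by rewrite (le_trans (nsq_le_normr _))// ler_wpM2l// lerXn2r// nnegrE addr_ge0.
  have s2 : s ^+ 2 <= t ^+ 2.
    by rewrite -real_normK ?num_real// lerXn2r// nnegrE addr_ge0.
  have : M * s ^+ 2 <= M * t ^+ 2 by rewrite ler_wpM2l// ltW.
  by lra.
have hX : `|nsq x - nsq e| <= K2 * t.
  rewrite nx -(subrKA (nsq (y i 0))) (le_trans (ler_normD _ _))// mulrDl lerD//.
    by rewrite (le_trans (lipn i Ai s sd))// ler_wpM2l// ltW.
  have -> : nsq (y i 0) - nsq e = dot (y i 0 - e) (y i 0 + e).
    by rewrite dotBl !dotDr (dotC e (y i 0)) /nsq; ring.
  rewrite (le_trans (dot_le _ _))// -/eta.
  have ye : `|y i 0 + e| <= 2 * `|e| + 1.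
    have -> : y i 0 + e = (y i 0 - e) + 2 *: e.
      by rewrite scaler_nat mulr2n addrA subrK.
    rewrite (le_trans (ler_normD _ _))// -/eta normrZ normr_nat.
    by lra.
  rewrite /E1 -!mulrA ler_wpM2l// mulrC ler_pM//.
have := near_axis_estimate e0 D0 t01 K10 K20 hq hX; rewrite -/C2 => fin.
have t0 : 0 <= t by case/andP: t01.
have C21 : 0 <= 1 + C2 by rewrite addr_ge0.
rewrite -(@ler_pXn2r _ 2) ?nnegrE ?mulr_ge0// (le_trans (sqr_normr_le_nsq _))//.
rewrite (le_trans fin)// -/t exprMn ler_wpM2r ?sqr_ge0//.
by nra.
Qed.

End RotationGroup.

(** * Expansions at nonzero values *)

Section RootPolynomial.
Context {R : realType} (G : seq 'M[R]_3) (GG : mxgroup G).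
Implicit Types (n x : 'cV[R]_3).

(** The polynomial in [c] whose roots are the values of the linear form [n] on
    the orbit of [x]. *)
Definition root_poly n (c : R) x : R := \prod_(g <- G) (dot n (g *m x) - c).

Lemma root_poly_invariant n c : ginvariant G (root_poly n c).
Proof.
move=> g gG x; rewrite /root_poly -[RHS](perm_big _ (mxgroup_perm GG gG)) big_map.
by apply: eq_bigr => h _; rewrite mulmxA.
Qed.

(** The coefficients are invariant polynomials, which keeps the polynomial under
    control when [c] varies. *)
Lemma root_poly_expand n : exists E : nat -> 'cV[R]_3 -> R,
  (forall j, polyfun (E j) /\ ginvariant G (E j)) /\
  forall c x, root_poly n c x = \sum_(j < (size G).+1) c ^+ j * E j x.
Proof.
pose pp (s : seq 'M[R]_3) x : {poly R} := \prod_(g <- s) ((dot n (g *m x))%:P - 'X).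
exists (fun j x => (pp G x)`_j); split=> [j|c x].
  split; last first.
    move=> g gG x; congr ((_ : {poly R})`_j).
    rewrite /pp -[RHS](perm_big _ (mxgroup_perm GG gG)) big_map.
    by apply: eq_bigr => h _; rewrite mulmxA.
  elim: (G : seq _) j => [|g s IH] j.
    by apply: pf_ext (pf_cst (1 : {poly R})`_j) => x; rewrite /pp big_nil.
  have pfX : polyfun (fun x => if j == 0%N then 0 else - (pp s x)`_j.-1).
    case: j => [|j]; first exact: pf_cst.
    by apply: pf_ext (pf_mul (pf_cst (-1)) (IH j)) => x; rewrite mulN1r.
  apply: pf_ext (pf_add (pf_mul (pf_dot_lin n g) (IH j)) pfX) => x.
  rewrite {3}/pp big_cons -/(pp s x) mulrBl coefB coefCM coefXM.
  by case: (j == 0%N); rewrite ?subr0 ?addr0.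
have -> : root_poly n c x = (pp G x).[c].
  by rewrite /pp horner_prod; apply: eq_bigr => g _; rewrite !hornerE.
have sz s : (size (pp s x) <= (size s).+1)%N.
  elim: s => [|g s IH]; first by rewrite /pp big_nil size_poly1.
  rewrite /pp big_cons -/(pp s x) (leq_trans (size_polyMleq _ _))//.
  have : (size ((dot n (g *m x))%:P - 'X : {poly R})%R <= 2)%N.
    rewrite -opprB size_polyN; apply: leq_trans (size_polyD _ _) _.
    by rewrite size_polyX geq_max/= size_polyN (leq_trans (size_polyC_leq1 _)).
  by move: IH => /=; lia.
by rewrite (horner_coef_wide c (sz G)); apply: eq_bigr => j _; rewrite mulrC.
Qed.

Lemma UB_root_poly (T : Type) (A : set T) (d : R) (y : T -> R -> 'cV[R]_3) n k
    (c : T -> R -> R) :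
  (forall f, polyfun f -> ginvariant G f -> UB A d k (fun i s => f (y i s))) ->
  UB A d k c -> UB A d k (fun i s => root_poly n (c i s) (y i s)).
Proof.
move=> UBf UBc; have [E [EP EE]] := root_poly_expand n.
apply: (@UB_ext _ _ _ _ _ (fun i s => \sum_(j < (size G).+1) c i s ^+ j * E j (y i s))).
  by move=> i _ s _; rewrite EE.
apply: UB_sum => j; apply: UB_mul; first exact: UB_exp.
by have [pfE invE] := EP j; exact: UBf.
Qed.

End RootPolynomial.

Section Compactness.
Context {R : realType}.

Lemma bounded_cluster (u : nat -> 'cV[R]_3) (C : R) : (forall k, `|u k| <= C) ->
  exists v, forall e : R, 0 < e -> forall k, exists2 l, (k <= l)%N & `|u l - v| < e.
Proof.
move=> uC; pose B : set 'rV[R]_3 := [set w | `|w| <= C].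
have cB : compact B.
  apply: bounded_closed_compact.
    exists C; split; first exact: num_real.
    by move=> D CD w /= wC; rewrite (le_trans wC)// ltW.
  have -> : B = (fun w => `|w|) @^-1` [set r : R | r <= C] by [].
  by apply: closed_comp => [w _|]; [exact: norm_continuous|exact: closed_le].
have nT (w : 'cV[R]_3) : `|w^T| <= `|w|.
  by apply: normr_le_coord => // i j; rewrite mxE normr_coord.
have [|v [_ vcl]] := cB ((fun k => (u k)^T) @ \oo) _.
  by exists 0%N => // k _ /=; rewrite /B/= (le_trans (nT _)).
exists v^T => e e0 k.
have [||w [/= [l kl <-] wb]] := vcl [set (u l)^T | l in [set l | (k <= l)%N]] (ball v e).
- by exists k => // l kl; exists l.
- exact: nbhsx_ballx.
exists l => //; move: wb; rewrite -ball_normE /ball_/= => wb.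
apply: le_lt_trans wb; rewrite -normrN opprB.
have -> : v^T - u l = (v - (u l)^T)^T by rewrite linearB/= trmxK.
by apply: normr_le_coord => // i j; rewrite mxE normr_coord.
Qed.

Lemma common_bound (T : eqType) (s : seq T) (P : T -> R -> Prop) :
  (forall y d d', d <= d' -> P y d -> P y d') ->
  (forall y, y \in s -> exists2 d, 0 < d & P y d) ->
  exists2 d, 0 < d & forall y, y \in s -> P y d.
Proof.
move=> mono; elim: s => [|y s IH] H; first by exists 1.
have [d d0 Pd] := H y (mem_head _ _).
have [|d' d'0 Pd'] := IH; first by move=> z zs; apply: H; rewrite inE zs orbT.
exists (d + d') => [|z]; first by rewrite addr_gt0.
rewrite inE => /orP[/eqP->|zs].
  by apply: mono Pd; rewrite lerDl ltW.
by apply: mono (Pd' z zs); rewrite lerDr ltW.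
Qed.

End Compactness.

Section JetNonzero.
Context {R : realType} (G : seq 'M[R]_3) (GG : mxgroup G).
Hypothesis OG : forall g, g \in G -> orthogonal_mx g.
Implicit Types (n x e v : 'cV[R]_3).

Lemma count_stab e : count (fun g => g *m e == e) G = size (stab G e).
Proof. by rewrite /stab size_filter. Qed.

Lemma stab_gt0 e : (0 < size (stab G e))%N.
Proof. exact: mxgroup_size_gt0 (mxgroup_stab e GG). Qed.

Lemma norm_dot_le n x (c : R) : `|x| <= c -> `|dot n x| <= 3 * `|n| * c.
Proof. by move=> xc; rewrite (le_trans (dot_le _ _))// ler_wpM2l// mulr_ge0. Qed.

(** The factors that belong to the stabiliser are of size [s], the one of the
    identity is even of size [eps * s], and the others are bounded. *)
Lemma root_poly_upper e v n (C0 : R) : 0 <= C0 -> exists2 M : R, 0 <= M &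
  forall (x : 'cV[R]_3) (s eps : R), `|s| <= 1 -> 0 <= eps <= C0 ->
    `|x - e| <= C0 * `|s| -> `|x - e - s *: v| <= eps * `|s| ->
    `|root_poly G n (dot n e + s * dot n v) x| <= M * eps * `|s| ^+ size (stab G e).
Proof.
move=> C00; have [Gu G1 GM GV] := GG; have [CG CG1 GC] := seq_norm_bound G.
have CG0 : 0 <= CG by exact: le_trans CG1.
pose B1 := 3 * `|n| * (CG * C0 + `|v|).
pose B2 := 3 * `|n| * (CG * C0 + CG * `|e| + `|e| + `|v|).
have B10 : 0 <= B1 by rewrite !mulr_ge0// addr_ge0// mulr_ge0.
have B20 : 0 <= B2 by rewrite !mulr_ge0// !addr_ge0// mulr_ge0.
set p := size (stab G e); have p0 : (0 < p)%N by exact: stab_gt0.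
set q := (size (rem 1%:M G) - p.-1)%N.
exists (3 * `|n| * B1 ^+ p.-1 * B2 ^+ q) => [|x s eps s1 /andP[eps0 epsC] xe xv].
  by rewrite !mulr_ge0// exprn_ge0.
have s0 := normr_ge0 s.
have fE g : dot n (g *m x) - (dot n e + s * dot n v) = dot n (g *m x - e - s *: v).
  by rewrite !dotBr dotZr opprD addrA.
rewrite /root_poly; under eq_bigr do rewrite fE.
rewrite (big_rem 1%:M)//= mul1mx normrM normr_prod.
have first_ : `|dot n (x - e - s *: v)| <= 3 * `|n| * (eps * `|s|) by exact: norm_dot_le.
have cnt : count (fun g => g *m e == e) (rem 1%:M G) = p.-1.
  rewrite /p -count_stab (permP (perm_to_rem G1)) /= mul1mx eqxx add1n.
  by [].
have near g : g \in rem 1%:M G -> g *m e == e ->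
    0 <= `|dot n (g *m x - e - s *: v)| <= B1 * `|s|.
  move=> /mem_rem gG ge; rewrite normr_ge0/= /B1 -mulrA norm_dot_le//.
  have -> : g *m x - e - s *: v = g *m (x - e) - s *: v by rewrite mulmxBr (eqP ge).
  rewrite (le_trans (ler_normB _ _))// mulrDl normrZ (mulrC `|s|) lerD2r.
  by rewrite (le_trans (GC _ gG _))// -mulrA ler_wpM2l.
have far g : g \in rem 1%:M G -> g *m e != e ->
    0 <= `|dot n (g *m x - e - s *: v)| <= B2.
  move=> /mem_rem gG ge; rewrite normr_ge0/= /B2 norm_dot_le//.
  have -> : g *m x - e - s *: v = g *m (x - e) + g *m e - e - s *: v.
    by rewrite mulmxBr subrK.
  rewrite (le_trans (ler_normB _ _))// lerD//.
    rewrite (le_trans (ler_normB _ _))// lerD2r (le_trans (ler_normD _ _))// lerD ?GC//.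
    by rewrite (le_trans (GC _ gG _))// ler_wpM2l// (le_trans xe)// ler_piMr.
  by rewrite normrZ ler_piMl.
have /andP[pr0 prU] := prod_upper near far.
rewrite cnt -/q in prU.
apply: (@le_trans _ _ (3 * `|n| * (eps * `|s|) * ((B1 * `|s|) ^+ p.-1 * B2 ^+ q))).
  by rewrite ler_pM.
have -> : `|s| ^+ p = `|s| * `|s| ^+ p.-1 by rewrite -exprS prednK.
rewrite exprMn; move: (B1 ^+ p.-1) (B2 ^+ q) (`|s| ^+ p.-1) (3 * `|n|) => a1 a2 a3 a4.
by rewrite le_eqVlt; apply/orP; left; apply/eqP; ring.
Qed.

(** At a nonzero value the velocity is a cluster point of difference quotients,
    and it is the only one up to the group: the root polynomials vanish to the
    order of the stabiliser, so their quotients by that power converge, and they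
    converge to zero along the cluster sequence. *)
Lemma jet_nonzero (d : R) (y : R -> 'cV[R]_3) : 0 < d -> y 0 != 0 ->
  (forall f, polyfun f -> ginvariant G f -> UB setT d 15 (fun (_ : unit) s => f (y s))) ->
  (size (stab G (y 0%R)) <= 15)%N -> exists v, orbit_jet G y 0 v.
Proof.
set e := y 0 => d0 e0 UBf p15; have [Gu G1 GM GV] := GG.
have [CG CG1 GC] := seq_norm_bound G; have CG0 : 0 <= CG by exact: le_trans CG1.
have [C [r [C0 /andP[r0 rd] stay]]] := orbit_stays_close GG OG (y := fun _ => y) d0 e0 UBf.
have {}stay s : `|s| < r -> exists2 g, g \in G & `|g *m y s - e| <= C * `|s|.
  move=> sr; have [|g gG h] := stay tt I _ s sr; first by rewrite subrr normr0.
  by exists g => //; move: h; rewrite -/e subrr normr0 add0r.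
have /choice[sel selP] : forall s, exists g, g \in G /\ (`|s| < r -> `|g *m y s - e| <= C * `|s|).
  move=> s; have [/stay[g gG h]|?] := pselect (`|s| < r); first by exists g.
  by exists 1%:M.
pose x s := sel s *m y s.
have xe s : `|s| < r -> `|x s - e| <= C * `|s| by move=> sr; have [_] := selP s; apply.
(* a cluster point of the difference quotients *)
pose sk (k : nat) : R := r / k.+2%:R.
have sk0 k : 0 < sk k by rewrite divr_gt0.
have skr k : `|sk k| < r by rewrite gtr0_norm// ltr_pdivrMr// ltr_pMr// ltr1n.
have [|v vcl] := @bounded_cluster R (fun k => (sk k)^-1 *: (x (sk k) - e)) C.
  move=> k; rewrite normrZ normfV ler_pdivrMl ?normr_gt0 ?gt_eqF// mulrC.
  exact: xe.
exists v.
pose C1 := C + `|v|; have C10 : 0 <= C1 by rewrite addr_ge0// ltW.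
set p := size (stab G e) in p15; have p0 : (0 < p)%N by exact: stab_gt0.
have xeC s : `|s| < r -> `|x s - e| <= C1 * `|s|.
  by move=> sr; rewrite (le_trans (xe s sr))// ler_wpM2r// lerDl.
pose F n s := root_poly G n (dot n e + s * dot n v) (y s).
have FE n s : F n s = root_poly G n (dot n e + s * dot n v) (x s).
  by have [sG _] := selP s; rewrite /x root_poly_invariant.
have xv s : `|s| < r -> `|x s - e - s *: v| <= C1 * `|s|.
  move=> sr; rewrite (le_trans (ler_normB _ _))// mulrDl lerD ?xe//.
  by rewrite normrZ mulrC.
have littleo n : forall eps : R, 0 < eps -> exists2 dl : R, 0 < dl &
    forall s, `|s| < dl -> `|F n s| <= eps * `|s| ^+ p.
  have [M M0 up] := root_poly_upper e v n C10.
  pose r1 := Num.min r 1; have r10 : 0 < r1 by rewrite lt_min r0 ltr01.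
  have UBF : UB setT r1 15 (fun (_ : unit) s => F n s).
    apply: (@UB_root_poly R G GG unit setT r1 (fun _ => y) n 15
       (fun _ s => dot n e + s * dot n v)).
      move=> f pf invf; apply: (@UB_restrict _ _ setT setT d) => //; last exact: UBf.
      by rewrite ge_min rd.
    apply: UB_add; first by apply: (@UB_cst _ _ _ _ _ _ `|dot n e|).
    apply: UB_mul; last by apply: (@UB_cst _ _ _ _ _ _ `|dot n v|).
    apply: (@UB_S _ _ _ _ _ _ (fun _ _ => 1) r1) => [_ _ s /ltW//|_ _ s _|].
      exact: dif_id.
    by apply: (@UB_cst _ _ _ _ _ (fun=> 1) 1) => _ _; rewrite normr1.
  have bnd s : `|s| < r1 -> `|F n s| <= M * C1 * `|s| ^+ p.
    rewrite lt_min => /andP[sr s1]; rewrite FE; apply: up (xeC s sr) (xv s sr).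
      exact: ltW.
    by rewrite C10 lexx.
  have [|L LP] := @UB_peano R unit setT r1 15 _ tt p _ r10 UBF I _ bnd; first by rewrite p0.
  suff L0 : L = 0.
    move=> eps eps0; have [dl dl0 dlP] := LP eps eps0; exists dl => // s /dlP.
    by rewrite L0 mul0r subr0.
  apply/eqP; rewrite -normr_le0; apply/ler_addgt0Pl => eps eps0; rewrite addr0.
  have eps2 : 0 < eps / 2 by rewrite divr_gt0.
  have [dl dl0 dlP] := LP _ eps2.
  have M1 : 0 < M + 1 by rewrite ltr_wpDl.
  pose eta := Num.min (C1 + 1) (eps / 2 / (M + 1)).
  have eta0 : 0 < eta by rewrite lt_min ltr_wpDl//= divr_gt0.
  have [k0 k0P] : exists k0, forall l, (k0 <= l)%N -> sk l < Num.min dl r1.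
    have m0 : 0 < Num.min dl r1 by rewrite lt_min dl0.
    pose k0 := Num.truncn (r / Num.min dl r1); exists k0 => l kl.
    rewrite /sk ltr_pdivrMr// mulrC -ltr_pdivrMr//.
    apply: (lt_le_trans (truncnS_gt (r / Num.min dl r1))).
    by rewrite ler_nat -/k0 !ltnS (leq_trans kl)// leqnSn.
  have [l kl hl] := vcl _ eta0 k0.
  have := k0P l kl; rewrite !lt_min => /and3P[sdl sr s1].
  have s0 := sk0 l; have ns : `|sk l| = sk l by rewrite gtr0_norm.
  have xvl : `|x (sk l) - e - sk l *: v| <= Num.min C1 eta * `|sk l|.
    have := xv (sk l) (skr l).
    have : `|x (sk l) - e - sk l *: v| <= eta * `|sk l|.
      have -> : x (sk l) - e - sk l *: v = sk l *: ((sk l)^-1 *: (x (sk l) - e) - v).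
        by rewrite scalerBr scalerA mulfV ?scale1r// gt_eqF.
      by rewrite normrZ mulrC ler_wpM2r// ltW.
    by rewrite /Num.min; case: ifP.
  have := up (x (sk l)) (sk l) (Num.min C1 eta) _ _ (xeC _ (skr l)) xvl.
  rewrite ns => /(_ (ltW s1)).
  rewrite le_min C10 (ltW eta0) ge_min lexx => /(_ isT); rewrite -FE => Fup.
  have := dlP (sk l); rewrite ns => /(_ sdl) Flim.
  have sp : 0 < sk l ^+ p by rewrite exprn_gt0.
  rewrite -(ler_pM2r sp) -[X in _ * X <= _]gtr0_norm// -normrM.
  have -> : L * sk l ^+ p = F n (sk l) - (F n (sk l) - L * sk l ^+ p) by rewrite subKr.
  rewrite (le_trans (ler_normB _ _))//.
  have : M * Num.min C1 eta * sk l ^+ p <= eps / 2 * sk l ^+ p.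
    rewrite ler_wpM2r ?(ltW sp)//.
    apply: (@le_trans _ _ ((M + 1) * (eps / 2 / (M + 1)))).
      apply: ler_pM; [by []| |by rewrite lerDl|by rewrite /eta !ge_min lexx !orbT].
      by rewrite le_min C10 (ltW eta0).
    by rewrite mulrC divfK// gt_eqF.
  by move=> h; rewrite [in leRHS](splitr eps) mulrDl lerD//; exact: le_trans Fup h.
(* a direction that is good for all the elements of the orbit *)
have [N [c [c0 NP]]] := @good_direction R (size G).
have [mu mu0 sep] := orbit_separation G e.
move=> eps eps0.
pose q := (size G - p)%N.
pose low := (c * eps) ^+ p * (c * mu / 2) ^+ q.
have low0 : 0 < low by rewrite mulr_gt0// exprn_gt0 ?mulr_gt0// divr_gt0 ?mulr_gt0.
have [|n nN|dl dl0 dlP] := @common_delta R _ N (fun n dl => forall s, `|s| < dl ->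
    `|F n s| <= low / 2 * `|s| ^+ p /\
    3 * `|n| * (CG * C + `|v|) * `|s| <= c * mu / 2).
- by move=> n dl dl' le H s sd; apply: H; exact: lt_le_trans sd le.
- have [dl dl0 dlP] := littleo n (low / 2) ltac:(by rewrite divr_gt0).
  pose B := 3 * `|n| * (CG * C + `|v|) + 1.
  have B0 : 0 < B by rewrite ltr_wpDl// !mulr_ge0// addr_ge0// mulr_ge0// ltW.
  exists (Num.min dl (c * mu / 2 / B)) => [|s].
    by rewrite lt_min dl0 !divr_gt0// mulr_gt0.
  rewrite lt_min => /andP[/dlP ? sB]; split=> //.
  move: sB; rewrite ltr_pdivlMr// => /ltW /(le_trans _); apply.
  by rewrite mulrC ler_wpM2l// lerDl.
exists (Num.min dl r) => [|s]; first by rewrite lt_min dl0.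
rewrite lt_min add0r => /andP[sdl sr].
have [->|s0] := eqVneq s 0.
  exists 1%:M => //.
  by rewrite mul1mx subrr scale0r subrr !normr0 mulr0.
have ns : 0 < `|s| by rewrite normr_gt0.
apply: contrapT => far.
have far' g : g \in G -> eps * `|s| < `|g *m x s - e - s *: v|.
  move=> gG; rewrite ltNge; apply/negP => h; apply: far; have [sG _] := selP s.
  by exists (g *m sel s); [exact: GM|rewrite -mulmxA].
pose ws := [seq (if g *m e == e then g *m x s - e - s *: v else g *m e - e) | g <- G].
have [|n nN good] := NP ws; first by rewrite size_map.
have [Fup small] := dlP n nN s sdl.
have Flow : low * `|s| ^+ p <= `|F n s|.
  rewrite FE /root_poly normr_prod.
  have := @prod_lower R _ G (fun g => g *m e == e)
    (fun g => `|dot n (g *m x s) - (dot n e + s * dot n v)|) (c * eps * `|s|) (c * mu / 2).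
  have -> : (c * eps * `|s|) ^+ count (fun g => g *m e == e) G *
      (c * mu / 2) ^+ (size G - count (fun g => g *m e == e) G) = low * `|s| ^+ p.
    by rewrite count_stab exprMn mulrAC.
  apply.
  - by rewrite !mulr_ge0// ltW.
  - by rewrite divr_ge0// mulr_ge0// ltW.
  - move=> g gG ge; rewrite opprD addrA -dotZr -!dotBr.
    apply: le_trans (good (g *m x s - e - s *: v) _).
      by rewrite -mulrA ler_wpM2l ?(ltW c0)// ltW// far'.
    by apply/mapP; exists g; rewrite ?ge.
  - move=> g gG ge.
    have h1 : c * mu <= `|dot n (g *m e - e)|.
      apply: le_trans (good (g *m e - e) _).
        rewrite ler_wpM2l ?(ltW c0)// leNgt; apply/negP => /(sep g gG) E.
        by rewrite E eqxx in ge.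
      by apply/mapP; exists g; rewrite ?(negbTE ge).
    have h2 : `|dot n (g *m (x s - e) - s *: v)| <= c * mu / 2.
      apply: le_trans small; rewrite -mulrA norm_dot_le//.
      rewrite (le_trans (ler_normB _ _))// mulrDl normrZ (mulrC `|s|) lerD2r.
      by rewrite (le_trans (GC _ gG _))// -mulrA ler_wpM2l// xe.
    have -> : dot n (g *m x s) - (dot n e + s * dot n v) =
        dot n (g *m e - e) + dot n (g *m (x s - e) - s *: v).
      by rewrite mulmxBr !dotBr dotZr; ring.
    apply: le_trans (lerB_normD _ _); rewrite lerBrDr; apply: le_trans h1.
    by rewrite [leRHS]splitr lerD2l.
have sp : 0 < `|s| ^+ p by rewrite exprn_gt0.
by have := le_trans Flow Fup; rewrite ler_pM2r// ler_pdivlMr// ger_pMr// lern1.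
Qed.

End JetNonzero.

(** * Speed near a point of the unit sphere *)

Section SpeedBound.
Context {R : realType} (G : seq 'M[R]_3) (GG : mxgroup G).
Hypothesis OG : forall g, g \in G -> orthogonal_mx g.
Hypothesis DG : forall g, g \in G -> \det g = 1.
Implicit Types (n x e v : 'cV[R]_3).

(** The stabiliser of [e0] consists of rotations about [e0], which displace a
    point in proportion to its distance to the axis; the other elements move [e0]
    itself. *)
Lemma displacement_lower e0 : nsq e0 = 1 -> exists c r : R, [/\ 0 < c, 0 < r &
  forall e, nsq e = 1 -> `|e - e0| < r -> forall g, g \in G -> g != 1%:M ->
    (g *m e0 == e0 -> c * `|e - e0| <= `|g *m e - e|) /\
    (g *m e0 != e0 -> c <= `|g *m e - e|)].
Proof.
move=> ne0; have [mu mu0 sep] := orbit_separation G e0.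
have [CG CG1 GC] := seq_norm_bound G; have CG0 : 0 <= CG by exact: le_trans CG1.
have e00 : e0 != 0 by rewrite -nsq_gt0 ne0.
pose r := Num.min (1 / 2) (mu / 2 / (CG + 1)).
have r0 : 0 < r by rewrite lt_min !divr_gt0 ?ltr_wpDl.
have [|g gG|c c0 cP] := @common_delta R _ G (fun g c => forall e, nsq e = 1 ->
    `|e - e0| < r -> g != 1%:M ->
    (g *m e0 == e0 -> c * `|e - e0| <= `|g *m e - e|) /\
    (g *m e0 != e0 -> c <= `|g *m e - e|)).
- move=> g c c' cc H e ne er g1; have [H1 H2] := H e ne er g1.
  split=> [/H1|/H2]; apply: le_trans => //.
  by rewrite ler_wpM2r.
- have [->|g1] := eqVneq g 1%:M; first by exists 1 => // e _ _; rewrite eqxx.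
  have [ge|ge] := eqVneq (g *m e0) e0; last first.
    exists (mu / 2) => [|e _ er _]; first by rewrite divr_gt0.
    split=> // _.
    have ge0 : mu <= `|g *m e0 - e0|.
      by rewrite leNgt; apply/negP => /(sep g gG) E; rewrite E eqxx in ge.
    have : `|g *m (e - e0) - (e - e0)| <= mu / 2.
      rewrite (le_trans (ler_normB _ _))//.
      apply: (@le_trans _ _ ((CG + 1) * `|e - e0|)); first by rewrite mulrDl mul1r lerD2r GC.
      have := er; rewrite lt_min => /andP[_].
      by rewrite ltr_pdivlMr ?ltr_wpDl// mulrC => /ltW.
    have -> : g *m e - e = (g *m e0 - e0) + (g *m (e - e0) - (e - e0)).
      rewrite mulmxBr; move: (g *m e) (g *m e0) => a b.
      by apply/matrixP => i j; rewrite !mxE; ring.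
    have := lerB_normD (g *m e0 - e0) (g *m (e - e0) - (e - e0)).
    lra.
  have [c c0 cP] := rotation_moves (OG gG) (DG gG) e00 ge g1.
  pose c1 := Num.min 1 (c / 6); have c10 : 0 < c1 by rewrite lt_min ltr01 divr_gt0.
  have c1c : c1 ^+ 2 <= c / 6.
    apply: (@le_trans _ _ c1); last by rewrite ge_min lexx orbT.
    by rewrite expr2 ler_piMl ?(ltW c10)// ge_min lexx.
  exists c1 => // e ne er _; split=> // _.
  have er2 : `|e - e0| <= 1 / 2 by apply/ltW/(lt_le_trans er); rewrite ge_min lexx.
  have nee : nsq (e - e0) = 2 - 2 * dot e e0 by rewrite nsqB ne ne0; lra.
  have D0 : 0 <= dot e e0.
    have := nsq_le_normr (e - e0); have : `|e - e0| ^+ 2 <= (1 / 2) ^+ 2.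
      by rewrite lerXn2r// nnegrE.
    rewrite nee; lra.
  have q1 : nsq (e - e0) / 2 <= axisq e0 e.
    have := axisq_ge0 e0 e; have := nsq_ge0 (e - e0).
    by rewrite nee /axisq ne ne0 (dotC e0); nra.
  rewrite -(@ler_pXn2r _ 2) ?nnegrE ?mulr_ge0// ?(ltW c10)//.
  have := cP e; have := nsq_le_normr (g *m e - e); have := sqr_normr_le_nsq (e - e0).
  rewrite exprMn; set X := `|e - e0| ^+ 2; set Y := `|_| ^+ 2 => h1 h2 h3.
  have X0 : 0 <= X by rewrite sqr_ge0.
  have h4 : c1 ^+ 2 * X <= c / 6 * X by rewrite ler_wpM2r.
  have h5 : c * (X / 2) <= c * axisq e0 e by rewrite ler_wpM2l ?(ltW c0)//; lra.
  lra.
- by exists c, r; split=> // e ne er g gG; exact: cP.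
Qed.

(** The factor that belongs to the identity vanishes at [t]. *)
Lemma dif_root_poly n (f : R -> 'cV[R]_3) t v (c : R) : dif f t v ->
  dot n (f t) = c ->
  dif (fun s => root_poly G n c (f s)) t
    (dot n v * \prod_(g <- rem 1%:M G) (dot n (g *m f t) - c)).
Proof.
move=> D fc; have [_ G1 _ _] := GG.
have -> : (fun s => root_poly G n c (f s)) = (fun s => (dot n (f s) - c) *
    \prod_(g <- rem 1%:M G) (dot n (g *m f s) - c)).
  by apply/funext => s; rewrite /root_poly (big_rem 1%:M)//= mul1mx.
have [w Dw] : exists w, dif (fun s => \prod_(g <- rem 1%:M G) (dot n (g *m f s) - c)) t w.
  elim: (rem _ _) => [|g r [w Dw]].
    exists 0; have -> : (fun s => \prod_(g <- [::]) (dot n (g *m f s) - c)) = (fun=> 1).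
      by apply/funext => s; rewrite big_nil.
    exact: dif_cst.
  have Dg := difB (dif_dot n (dif_mulmx g D)) (dif_cst c t).
  eexists; have -> : (fun s => \prod_(h <- g :: r) (dot n (h *m f s) - c)) =
     (fun s => (dot n (g *m f s) - c) * \prod_(h <- r) (dot n (h *m f s) - c)).
    by apply/funext => s; rewrite big_cons.
  exact: difM Dg Dw.
have := difM (difB (dif_dot n D) (dif_cst c t)) Dw.
by rewrite fc subrr mul0r addr0 subr0.
Qed.

(** The factors that belong to the stabiliser of [e0] are of size [eta], the
    others are bounded. *)
Lemma root_poly_scale e0 n (C0 : R) : 0 <= C0 -> exists2 M : R, 0 <= M &
  forall (x e : 'cV[R]_3) (eta : R), 0 <= eta <= 1 -> `|e - e0| <= eta ->
    `|x - e0| <= C0 * eta ->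
    `|root_poly G n (dot n e) x| <= M * eta ^+ size (stab G e0).
Proof.
move=> C00; have [CG CG1 GC] := seq_norm_bound G.
have CG0 : 0 <= CG by exact: le_trans CG1.
pose B1 := 3 * `|n| * (CG * C0 + 1).
pose B2 := 3 * `|n| * (CG * C0 + CG * `|e0| + `|e0| + 1).
set p := size (stab G e0); pose q := (size G - p)%N.
have B10 : 0 <= B1 by rewrite !mulr_ge0// addr_ge0// mulr_ge0.
have B20 : 0 <= B2 by rewrite !mulr_ge0// !addr_ge0// mulr_ge0.
exists (B1 ^+ p * B2 ^+ q) => [|x e eta /andP[eta0 eta1] ee xe].
  by rewrite mulr_ge0// exprn_ge0.
rewrite /root_poly normr_prod.
have near g : g \in G -> g *m e0 == e0 -> 0 <= `|dot n (g *m x) - dot n e| <= B1 * eta.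
  move=> gG ge; rewrite normr_ge0/= -dotBr /B1 -mulrA norm_dot_le//.
  have -> : g *m x - e = g *m (x - e0) - (e - e0).
    by rewrite mulmxBr (eqP ge) opprB addrA subrK.
  rewrite (le_trans (ler_normB _ _))// mulrDl mul1r lerD//.
  by rewrite (le_trans (GC _ gG _))// -mulrA ler_wpM2l.
have far g : g \in G -> g *m e0 != e0 -> 0 <= `|dot n (g *m x) - dot n e| <= B2.
  move=> gG ge; rewrite normr_ge0/= -dotBr /B2 norm_dot_le//.
  have -> : g *m x - e = g *m (x - e0) + g *m e0 - e0 - (e - e0).
    rewrite mulmxBr; move: (g *m x) (g *m e0) => a b.
    by apply/matrixP => i j; rewrite !mxE; ring.
  rewrite (le_trans (ler_normB _ _))// lerD//; last exact: le_trans ee eta1.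
  rewrite (le_trans (ler_normB _ _))// lerD2r (le_trans (ler_normD _ _))// lerD ?GC//.
  by rewrite (le_trans (GC _ gG _))// ler_wpM2l// (le_trans xe)// ler_piMr.
have /andP[_] := prod_upper near far.
by rewrite count_stab -/p -/q exprMn mulrAC.
Qed.

Lemma dif_norm_le (f : R -> 'cV[R]_3) e v (C r : R) : 0 < r -> f 0 = e -> dif f 0 v ->
  (forall s, `|s| < r -> `|f s - e| <= C * `|s|) -> `|v| <= C + 1.
Proof.
move=> r0 f0 D fC; have [d d0 dP] := D 1 ltr01.
pose s := Num.min r d / 2; have m0 : 0 < Num.min r d by rewrite lt_min r0.
have s0 : 0 < s by rewrite divr_gt0.
have sm : `|s| < Num.min r d by rewrite gtr0_norm// ltr_pdivrMr// ltr_pMr// ltr1n.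
move: sm; rewrite lt_min => /andP[/fC h1 /dP]; rewrite add0r f0 mul1r => h2.
have ns : 0 < `|s| by rewrite gtr0_norm.
rewrite -(ler_pM2r ns) mulrC -normrZ.
have -> : s *: v = (f s - e) - (f s - e - s *: v) by rewrite subKr.
by rewrite (le_trans (ler_normB _ _))// mulrDl mul1r lerD.
Qed.

(** Let [eta] be the distance from the starting point to [e0], and [p] the order
    of the stabiliser of [e0]. By Landau's inequality the derivative of a root
    polynomial at the start is of order [eta ^ (p - 1)]; it is the velocity, seen
    in a good direction, times [p - 1] factors of size [eta] and factors that are
    bounded below. *)
Lemma local_speed_bound (T : Type) (A : set T) (d : R) (y : T -> R -> 'cV[R]_3) e0 :
  0 < d -> nsq e0 = 1 -> (size (stab G e0) <= 15)%N ->
  (forall f, polyfun f -> ginvariant G f -> UB A d 15 (fun i s => f (y i s))) ->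
  (forall i, A i -> nsq (y i 0) = 1) ->
  exists C r : R, 0 < r /\ forall i, A i -> `|y i 0 - e0| < r ->
    forall v, dif (y i) 0 v -> `|v| <= C.
Proof.
move=> d0 ne0 p15 UBf ny; have [Gu G1 GM GV] := GG.
have e00 : e0 != 0 by rewrite -nsq_gt0 ne0.
have [CG CG1 GC] := seq_norm_bound G; have CG0 : 0 <= CG by exact: le_trans CG1.
have [C [r [C0 /andP[r0 rd] stay]]] := orbit_stays_close GG OG d0 e00 UBf.
have [c1 [r1 [c10 r10 disp]]] := displacement_lower ne0.
have [mu mu0 sep] := orbit_separation G e0.
have [N [c [c0 NP]]] := @good_direction R (size G).
set p := size (stab G e0) in p15.
have pE : p = p.-1.+1 by rewrite prednK// (stab_gt0 GG).
set k := p.-1 in pE.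
have C20 : 0 <= 2 * C by rewrite mulr_ge0// ltW.
(* the upper bound, uniformly over the finitely many directions *)
have [|n nN|M M0 MP] := @common_bound R _ N (fun n M => forall i, A i ->
    forall eta v, 0 < eta < Num.min r 1 -> `|y i 0 - e0| = eta -> dif (y i) 0 v ->
    `|dot n v * \prod_(g <- rem 1%:M G) (dot n (g *m y i 0) - dot n (y i 0))| <= M * eta ^+ k).
- move=> n M M' MM H i Ai eta v er ee D; rewrite (le_trans (H i Ai eta v er ee D))//.
  by case/andP: er => eta0 _; rewrite ler_wpM2r// exprn_ge0// ltW.
- have UBF : UB A d k.+1 (fun i s => root_poly G n (dot n (y i 0)) (y i s)).
    apply: (@UB_le _ _ _ _ 15); first by rewrite -pE.
    apply: (@UB_root_poly R G GG T A d y n 15 (fun i _ => dot n (y i 0))) => //.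
    apply: (@UB_cst _ _ _ _ _ (fun i => dot n (y i 0)) (3 * `|n| * 1)) => i Ai.
    apply: norm_dot_le; rewrite -(@ler_pXn2r _ 2) ?nnegrE// expr1n.
    by rewrite (le_trans (sqr_normr_le_nsq _))// ny.
  have [C' C'0 UBC] := UB_first_derivative UBF.
  have [B B0 BP] := root_poly_scale e0 n C20.
  exists (C' * (B + 1)) => [|i Ai eta v]; first by rewrite mulr_gt0// ltr_wpDl.
  rewrite lt_min => /and3P[eta0 etar eta1] ee D.
  have Dr := dif_root_poly (c := dot n (y i 0)) D erefl.
  apply: (UBC i Ai eta B _ _ _ Dr) => //.
    by rewrite eta0 (lt_le_trans etar).
  move=> s seta; have [|g gG h] := stay i Ai _ s (lt_trans seta etar); first by rewrite ee.
  rewrite -(root_poly_invariant GG n (dot n (y i 0)) gG) -pE.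
  apply: BP; [by rewrite !ltW|by rewrite ee|].
  rewrite (le_trans h)// ee (mulrC 2) -mulrA ler_wpM2l ?(ltW C0)//.
  by move: seta => /ltW; lra.
pose q := (size (rem 1%:M G) - k)%N.
pose low := (c * c1) ^+ k * (c * c1) ^+ q.
have low0 : 0 < low by rewrite mulr_gt0// exprn_gt0// mulr_gt0.
exists (M / (c * low) + (CG * C + 1)), (Num.min (Num.min r 1) r1).
split=> [|i Ai]; first by rewrite !lt_min r0 ltr01 r10.
rewrite lt_min => /andP[er er1] v D.
have B1 : 0 <= M / (c * low) by rewrite divr_ge0 ?(ltW M0)// mulr_ge0 ?ltW.
have B2 : 0 <= CG * C + 1 by rewrite addr_ge0// mulr_ge0// ltW.
set eta := `|y i 0 - e0| in er er1.
have cnt : count (fun g => g *m e0 == e0) (rem 1%:M G) = k.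
  by rewrite /k /p -count_stab (permP (perm_to_rem G1)) /= mul1mx eqxx add1n.
have [eta0|eta0] := eqVneq eta 0.
  have ye : y i 0 = e0 by apply/subr0_eq/normr0_eq0.
  apply: (@le_trans _ _ (CG * C + 1)); last by rewrite lerDr.
  have [d1 d10 lip] := dif_lip D.
  pose L := CG * (1 + `|v|) + C; have L0 : 0 < L by rewrite ltr_wpDl// mulr_ge0// addr_ge0.
  apply: (@dif_norm_le (y i) e0 v (CG * C) (Num.min (Num.min r d1) (mu / L))) => //.
    by rewrite !lt_min r0 d10 divr_gt0.
  move=> s; rewrite !lt_min => /andP[/andP[sr sd]].
  rewrite ltr_pdivlMr// => sL.
  have [|g gG] := stay i Ai _ s sr; first by rewrite -/eta eta0.
  rewrite -/eta eta0 add0r => h.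
  have h2 := lip s sd; rewrite add0r ye in h2.
  have ge : g *m e0 = e0.
    apply: sep => //; apply: le_lt_trans sL.
    have -> : g *m e0 - e0 = (g *m y i s - e0) - g *m (y i s - e0).
      rewrite mulmxBr; move: (g *m e0) (g *m y i s) => a b.
      by apply/matrixP => i' j; rewrite !mxE; ring.
    rewrite (le_trans (ler_normB _ _))// mulrC /L mulrDl [leRHS]addrC lerD//.
    by rewrite (le_trans (GC _ gG _))// -mulrA ler_wpM2l.
  have -> : y i s - e0 = g^T *m (g *m y i s - e0).
    by rewrite mulmxBr mulmxA (mulmx1C (OG gG)) mul1mx (trmx_fixed OG gG ge).
  by rewrite (le_trans (GC _ (trmx_in GG OG gG) _))// -mulrA ler_wpM2l.
have eta_pos : 0 < eta by rewrite lt_def eta0 normr_ge0.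
apply: (@le_trans _ _ (M / (c * low))); last by rewrite lerDl.
pose ws := v :: [seq g *m y i 0 - y i 0 | g <- rem 1%:M G].
have [|n nN good] := NP ws.
  rewrite /= size_map size_rem// prednK//; exact: mxgroup_size_gt0.
have er' : 0 < eta < Num.min r 1 by rewrite eta_pos.
have := MP n nN i Ai eta v er' erefl D.
rewrite normrM normr_prod => up.
have lowP : low * eta ^+ k <=
    \prod_(g <- rem 1%:M G) `|dot n (g *m y i 0) - dot n (y i 0)|.
  have := @prod_lower R _ (rem 1%:M G) (fun g => g *m e0 == e0)
    (fun g => `|dot n (g *m y i 0) - dot n (y i 0)|) (c * c1 * eta) (c * c1).
  have -> : (c * c1 * eta) ^+ count (fun g => g *m e0 == e0) (rem 1%:M G) * (c * c1) ^+
      (size (rem 1%:M G) - count (fun g => g *m e0 == e0) (rem 1%:M G)) = low * eta ^+ k.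
    by rewrite cnt exprMn mulrAC.
  apply.
  - by rewrite !mulr_ge0// ltW.
  - by rewrite mulr_ge0// ltW.
  - move=> g gr ge; have gG := mem_rem gr.
    have g1 : g != 1%:M by apply: contraTneq gr => ->; rewrite mem_rem_uniqF.
    have [/(_ ge) h _] := disp (y i 0) (ny i Ai) er1 g gG g1.
    rewrite -dotBr; apply: le_trans (good _ _); last first.
      by rewrite inE; apply/orP; right; apply: map_f.
    by rewrite -mulrA ler_wpM2l// ltW.
  - move=> g gr ge; have gG := mem_rem gr.
    have g1 : g != 1%:M by apply: contraTneq gr => ->; rewrite mem_rem_uniqF.
    have [_ /(_ ge) h] := disp (y i 0) (ny i Ai) er1 g gG g1.
    rewrite -dotBr; apply: le_trans (good _ _); last first.
      by rewrite inE; apply/orP; right; apply: map_f.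
    by rewrite ler_wpM2l// ltW.
have vn : c * `|v| <= `|dot n v| by apply: good; exact: mem_head.
have ek : 0 < eta ^+ k by rewrite exprn_gt0.
have key : (c * `|v|) * (low * eta ^+ k) <= M * eta ^+ k.
  apply: le_trans up; apply: ler_pM => //; first by rewrite mulr_ge0// ltW.
  by rewrite mulr_ge0// ltW.
rewrite ler_pdivlMr ?(mulr_gt0 c0 low0)//.
move: key; rewrite mulrA ler_pM2r// => key; apply: le_trans key.
by rewrite mulrA (mulrC c).
Qed.

End SpeedBound.

(** * Lifting curves for a group of rotations *)

Section GlobalLift.
Context {R : realType} (G : seq 'M[R]_3) (GG : mxgroup G).
Hypothesis OG : forall g, g \in G -> orthogonal_mx g.
Hypothesis DG : forall g, g \in G -> \det g = 1.
Hypothesis gen15 : forall f, polyfun f -> ginvariant G f -> gen G 15 f.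
Hypothesis stab15 : forall e : 'cV[R]_3, e != 0 -> (size (stab G e) <= 15)%N.
Implicit Types (n e v : 'cV[R]_3).

Lemma nsq_invariant : ginvariant G (@nsq R 3).
Proof. by move=> g gG z; rewrite (orthogonal_nsq _ (OG gG)). Qed.

(** At a zero the quotients of the invariant forms of degree [d] by the power [d]
    of the parameter converge; as these forms generate the invariants, all
    invariants of the difference quotient converge, hence so does its orbit. *)
Lemma jet_zero (d : R) (y : R -> 'cV[R]_3) : 0 < d -> y 0 = 0 ->
  (forall f, polyfun f -> ginvariant G f -> UB setT d 15 (fun (_ : unit) s => f (y s))) ->
  exists v, orbit_jet G y 0 v.
Proof.
move=> d0 y0 UBf; have UBn := UBf _ (pf_nsq) nsq_invariant.
have [M M0 grow] : exists2 M, 0 < M & forall (i : unit), setT i -> forall s, `|s| < d ->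
    nsq (y s) <= 2 * nsq (y 0) + M * s ^+ 2.
  apply: (@UB_growth R unit setT d (fun _ s => nsq (y s))) => //.
    by apply: UB_le UBn.
  by move=> _ _ s _; exact: nsq_ge0.
pose C := 1 + M; have C0 : 0 < C by rewrite addr_gt0.
have yC s : `|s| < d -> `|y s| <= C * `|s|.
  move=> sd; have := grow tt I s sd; rewrite y0 /nsq dot0r mulr0 add0r => h.
  rewrite -(@ler_pXn2r _ 2) ?nnegrE ?mulr_ge0 ?(ltW C0)//.
  rewrite (le_trans (sqr_normr_le_nsq _))// (le_trans h)// exprMn real_normK ?num_real//.
  by rewrite ler_wpM2r ?sqr_ge0// /C; nra.
pose z s := s^-1 *: y s.
have lim f : gen G 15 f -> exists L : R, f (z s) @[s --> 0^'] --> L.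
  elim=> {f} [c|k f kd Hf If|f g _ [L1 h1] _ [L2 h2]|f g _ [L1 h1] _ [L2 h2]].
  - by exists c; exact: cvg_cst.
  - have [B B0 fB] := hp_bound Hf.
    have [s sd|L LP] := @UB_peano R unit setT d 15 _ tt k (B * C ^+ k) d0
        (UBf f (hp_pf Hf) If) I kd.
      by rewrite (le_trans (fB _))// -mulrA -exprMn ler_wpM2l// lerXn2r ?nnegrE//
         ?yC// mulr_ge0// ltW.
    exists L; apply/cvgrPdist_le => /= e e0; have [r r0 rP] := LP e e0.
    exists r => //= s; rewrite /= sub0r normrN => sr s0.
    have sk : 0 < `|s| ^+ k by rewrite exprn_gt0// normr_gt0.
    rewrite /z (hp_homog Hf) exprVn.
    rewrite -(ler_pM2r sk) -[X in _ * X <= _]normrX -normrM mulrBl mulrAC.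
    by rewrite mulVf ?expf_neq0// mul1r distrC rP.
  - by exists (L1 + L2); exact: cvgD.
  - by exists (L1 * L2); exact: cvgM.
pose sk (k : nat) : R := d / k.+2%:R.
have sk0 k : 0 < sk k by rewrite divr_gt0.
have skd k : `|sk k| < d by rewrite gtr0_norm// ltr_pdivrMr// ltr_pMr// ltr1n.
have [|v vcl] := @bounded_cluster R (fun k => z (sk k)) C.
  by move=> k; rewrite normrZ normfV ler_pdivrMl ?normr_gt0 ?gt_eqF// mulrC yC.
exists v => eps eps0.
have [N [pfN invN Nv [dN dN0 close]]] := orbit_close GG v eps0.
have [L NL] := lim N (gen15 pfN invN).
have L0 : L = 0.
  apply/eqP; rewrite -normr_le0; apply/ler_addgt0Pl => eta eta0; rewrite addr0.
  have eta2 : 0 < eta / 2 by rewrite divr_gt0.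
  have [r r0 rP] := @pf_continuous R N v pfN _ eta2.
  move/cvgrPdist_le : NL => /(_ _ eta2)[r' /= r'0 r'P].
  have [k0 k0P] : exists k0, forall l, (k0 <= l)%N -> sk l < r'.
    pose k0 := Num.truncn (d / r'); exists k0 => l kl.
    rewrite /sk ltr_pdivrMr// mulrC -ltr_pdivrMr//.
    apply: (lt_le_trans (truncnS_gt (d / r'))).
    by rewrite ler_nat -/k0 !ltnS (leq_trans kl)// leqnSn.
  have [l kl hl] := vcl _ r0 k0.
  have h1 := rP _ hl; rewrite Nv subr0 in h1.
  have h2 : `|L - N (z (sk l))| <= eta / 2.
    by apply: r'P; rewrite /= ?sub0r ?normrN ?gtr0_norm ?k0P ?gt_eqF.
  have -> : L = (L - N (z (sk l))) + N (z (sk l)) by rewrite subrK.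
  rewrite (le_trans (ler_normD _ _))//; lra.
move/cvgrPdist_lt : NL => /(_ _ dN0)[r /= r0 rP].
exists r => // s sr; rewrite add0r.
have [->|s0] := eqVneq s 0.
  have [_ G1 _ _] := GG; exists 1%:M => //.
  by rewrite y0 mulmx0 scale0r !subr0 !normr0 mulr0.
have : `|L - N (z s)| < dN by apply: rP; rewrite /= ?sub0r ?normrN.
rewrite L0 sub0r normrN => /(le_lt_trans (ler_norm _)) /close[g gG h].
exists g => //; rewrite y0 subr0.
have -> : g *m y s - s *: v = s *: (g *m z s - v).
  by rewrite scalerBr /z -scalemxAr scalerA mulfV// scale1r.
by rewrite normrZ mulrC ler_wpM2r// ltW.
Qed.

Section Curve.
Variables (x : R -> 'cV[R]_3) (t0 d : R) (d0 : 0 < d).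
Hypothesis UBx : forall f, polyfun f -> ginvariant G f ->
  UB [set t | `|t - t0| < d] d 15 (fun t s => f (x (t + s))).

Lemma curve_jets t : `|t - t0| < d -> exists v, orbit_jet G x t v.
Proof.
move=> td; pose y s := x (t + s).
have UBy f : polyfun f -> ginvariant G f -> UB setT d 15 (fun (_ : unit) s => f (y s)).
  move=> pf If; have [D [D0 ch DM]] := UBx pf If.
  exists (fun j (_ : unit) s => D j t s); split.
  - by rewrite D0.
  - by move=> j jk _ _; exact: ch.
  - by move=> j jk; have [M MP] := DM j jk; exists M => _ _; exact: MP.
have [v jv] : exists v, orbit_jet G y 0 v.
  have [y0|y0] := eqVneq (y 0) 0; first exact: (jet_zero d0).
  by apply: (jet_nonzero GG OG d0) => //; exact: stab15.
exists v => e /jv[r r0 rP]; exists r => // h /rP[g gG].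
by rewrite /y add0r addr0 => hg; exists g.
Qed.

Lemma dif_scale (c : R) (f : R -> 'cV[R]_3) t v : dif f t v ->
  dif (fun s => c *: f s) t (c *: v).
Proof.
move=> /(dif_mulmx c%:M); rewrite mul_scalar_mx.
by have -> : (fun s => c%:M *m f s) = (fun s => c *: f s);
  [apply/funext => s; rewrite mul_scalar_mx|].
Qed.

Section Speed.
Variable xb : R -> 'cV[R]_3.
Hypothesis Lxb : is_lift G x [set t | `|t - t0| < d] xb.

Lemma lift_invariant f t : ginvariant G f -> `|t - t0| < d -> f (xb t) = f (x t).
Proof. by move=> If td; have [[g gG ->] _] := Lxb td; exact: If. Qed.

Let radius t : R := Num.sqrt (nsq (x t)).

(** The lift near [t] in the scale that brings [xb t] to the unit sphere; both
    time and space are rescaled, which does not change the speed. *)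
Let rescaled t s : 'cV[R]_3 := (radius t)^-1 *: xb (t + radius t * s).

Let nonzero : set R := [set t | `|t - t0| < d / 2 /\ x t != 0].

Let nonzero_half t : nonzero t -> `|t - t0| < d / 2.
Proof. by case. Qed.

Let nonzero_ball t : nonzero t -> `|t - t0| < d.
Proof. by move=> /nonzero_half td; have := d0; lra. Qed.

Let radius_gt0 t : nonzero t -> 0 < radius t.
Proof. by move=> [_ xt]; rewrite sqrtr_gt0 nsq_gt0. Qed.

Let sqr_radius t : radius t ^+ 2 = nsq (x t).
Proof. by rewrite sqr_sqrtr// nsq_ge0. Qed.

(** Rescaled by its norm, the curve has bounded invariants: a form of degree [k]
    is bounded because the norm does not grow on this scale, its derivatives of
    order at least [k] by homogeneity, the others by interpolation. *)
Lemma rescaled_bounds : exists2 r : R, 0 < r & forall f, polyfun f -> ginvariant G f ->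
  UB nonzero r 15 (fun t s => f (rescaled t s)).
Proof.
have UBn := UBx pf_nsq nsq_invariant.
have [B B0 nB] := UB_bound UBn.
have [M M0 grow] := UB_growth d0 (UB_le (isT : (2 <= 15)%N) UBn)
  (fun t td s sd => nsq_ge0 _).
have rB t : nonzero t -> radius t <= B + 1.
  move=> nt; rewrite -(@ler_pXn2r _ 2) ?nnegrE ?sqrtr_ge0//; last by rewrite addr_ge0// ltW.
  have tdd := nonzero_ball nt.
  have z0 : `|0 : R| < d by rewrite normr0.
  have := nB t tdd 0 z0; rewrite addr0 ger0_norm ?nsq_ge0// sqr_radius => h.
  by rewrite (le_trans h)//; have := sqr_ge0 B; lra.
pose r := d / 2 / (B + 1); have r0 : 0 < r by rewrite !divr_gt0// addr_gt0.
have small t s : nonzero t -> `|s| < r -> `|radius t * s| < d / 2.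
  move=> nt sr; rewrite normrM (gtr0_norm (radius_gt0 nt)).
  apply: (@le_lt_trans _ _ ((B + 1) * `|s|)); first by rewrite ler_wpM2r// rB.
  by move: sr; rewrite /r ltr_pdivlMr ?addr_gt0// mulrC.
have inball t s : nonzero t -> `|s| < r -> `|t + radius t * s - t0| < d.
  move=> nt sr; have := small t s nt sr; have td := nonzero_half nt.
  rewrite addrAC => h; rewrite (le_lt_trans (ler_normD _ _))//; lra.
have fE f t s : ginvariant G f -> nonzero t -> `|s| < r ->
    f (xb (t + radius t * s)) = f (x (t + radius t * s)).
  by move=> If nt sr; apply: lift_invariant => //; exact: inball.
exists r => // f pf If; elim: (gen15 pf If) => {f pf If}
  [c|k f k15 Hf If|f g _ IHf _ IHg|f g _ IHf _ IHg].
- by apply: (@UB_cst _ _ _ _ _ (fun=> c) `|c|).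
- have [D [D0 ch DM]] := UBx (hp_pf Hf) If.
  pose D' j t s := radius t ^+ j / radius t ^+ k * D j t (radius t * s).
  have ch' j : (j < 15)%N -> forall t, nonzero t -> forall s, `|s| < r ->
      dif (D' j t) s (D' j.+1 t s).
    move=> j15 t nt s sr; have td := nonzero_half nt.
    have := ch j j15 t _ (radius t * s) _.
    have tdd := nonzero_ball nt.
    have sd : `|radius t * s| < d by have := small t s nt sr; have := d0; lra.
    move=> /(_ tdd sd); rewrite -[X in dif _ X]add0r => /dif_affine Da.
    have := difM (dif_cst (radius t ^+ j / radius t ^+ k) s) Da.
    rewrite mul0r add0r -[_ *: _]/(_ * _).
    have -> : (fun s0 => radius t ^+ j / radius t ^+ k * D j t (0 + radius t * s0)) = D' j t.
      by apply/funext => u; rewrite /D' add0r.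
    by rewrite /D' exprS; congr dif; ring.
  have D'0 t s : nonzero t -> `|s| < r -> D' 0%N t s = f (rescaled t s).
    move=> nt sr; rewrite /rescaled (hp_homog Hf) fE// /D' expr0 div1r D0.
    by rewrite exprVn.
  have [Cf Cf0 fC] := hp_bound Hf.
  pose K := 1 + (2 + M * r ^+ 2).
  have K1 : 1 <= K by rewrite lerDl addr_ge0// mulr_ge0 ?sqr_ge0// ltW.
  have resc t s : nonzero t -> `|s| < r -> `|rescaled t s| <= K.
    move=> nt sr; have rt := radius_gt0 nt; have td := nonzero_half nt.
    have K0 : 0 <= K by exact: le_trans K1.
    rewrite -(@ler_pXn2r _ 2) ?nnegrE// (le_trans (sqr_normr_le_nsq _))//.
    rewrite /rescaled nsqZ fE//; last exact: nsq_invariant.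
    rewrite exprVn ler_pdivrMl ?exprn_gt0//.
    have tdd := nonzero_ball nt.
    have sd : `|radius t * s| < d by have := small t s nt sr; have := d0; lra.
    have := grow t tdd _ sd; rewrite addr0 -(sqr_radius t) exprMn => /le_trans; apply.
    have s2 : s ^+ 2 <= r ^+ 2.
      by rewrite -real_normK ?num_real// lerXn2r ?nnegrE ?(ltW r0)// ltW.
    have P0 : 0 <= radius t ^+ 2 by rewrite sqr_ge0.
    have KK : 2 + M * s ^+ 2 <= K ^+ 2.
      apply: (@le_trans _ _ K); last by rewrite expr2 ler_peMl.
      by rewrite /K; have := ler_wpM2l (ltW M0) s2; lra.
    have -> : 2 * radius t ^+ 2 + M * (radius t ^+ 2 * s ^+ 2) =
       radius t ^+ 2 * (2 + M * s ^+ 2) by ring.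
    by rewrite ler_wpM2l.
  have D'bound j : (j <= 15)%N -> exists M', forall t, nonzero t -> forall s, `|s| < r ->
      `|D' j t s| <= M'.
    have hi l : (k <= l <= 15)%N -> exists M', forall t, nonzero t -> forall s, `|s| < r ->
        `|D' l t s| <= M'.
      move=> /andP[kl l15]; have [M' MP] := DM l l15.
      exists ((B + 1) ^+ (l - k) * `|M'|) => t nt s sr; have td := nonzero_half nt.
      have rt := radius_gt0 nt.
      rewrite /D' -{1}(subnK kl) exprD mulfK ?expf_neq0 ?gt_eqF// normrM.
      apply: ler_pM; [by []|by []| |].
        have B1 : 0 <= B + 1 by rewrite addr_ge0// ltW.
        by rewrite normrX (gtr0_norm rt) lerXn2r// ?nnegrE ?(ltW rt)// rB.
      apply: le_trans (MP t (nonzero_ball nt) _ _) (ler_norm _).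
      by have := small t s nt sr; have := d0; lra.
    have [kj|jk] := leqP k j; first by move=> j15; apply: hi; rewrite kj.
    have k15' : (k <= 15)%N by case/andP: k15.
    have [|B' B'P] := hi k; first by rewrite leqnn.
    move=> _; apply: (@UB_interpolate R _ nonzero r k D' (Cf * K ^+ k) B') => //.
    - by move=> l lk; apply: ch'; exact: leq_trans lk k15'.
    - move=> t nt s sr; rewrite D'0// (le_trans (fC _))// ler_wpM2l//.
      by rewrite lerXn2r ?nnegrE ?resc// (le_trans _ K1).
    - exact: ltnW.
  apply: (@UB_ext _ _ _ _ _ (D' 0%N)); first by move=> t nt s sr; exact: D'0.
  by exists D'.
- exact: UB_add.
- exact: UB_mul.
Qed.

(** At a zero the growth of the norm bounds the speed. Elsewhere rescaling moves
    the starting point to the unit sphere, and the sphere is compact. *)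
Lemma speed_bound : exists C : R, forall t v, `|t - t0| < d / 2 -> dif xb t v -> `|v| <= C.
Proof.
have d2 : 0 < d / 2 by rewrite divr_gt0.
have d_0 := d0.
have UBn := UBx pf_nsq nsq_invariant.
have [M M0 grow] := UB_growth d0 (UB_le (isT : (2 <= 15)%N) UBn)
  (fun t td s sd => nsq_ge0 _).
have zero t v : `|t - t0| < d / 2 -> x t = 0 -> dif xb t v -> `|v| <= 1 + M + 1.
  move=> td xt D; have tdd : `|t - t0| < d by have := d0; lra.
  have D' : dif (fun s => xb (t + s)) 0 v.
    have := @dif_affine R _ xb t 1 0 v; rewrite mul1r addr0 scale1r => /(_ D).
    by have -> : (fun s => xb (t + 1 * s)) = (fun s => xb (t + s));
      [apply/funext => s; rewrite mul1r|].
  apply: (@dif_norm_le R (fun s => xb (t + s)) 0 v _ (d / 2)) => //.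
    apply/eqP; rewrite addr0 -nsq_eq0 lift_invariant//; last exact: nsq_invariant.
    by rewrite xt /nsq dot0r.
  move=> s sd; rewrite subr0.
  have sdd : `|s| < d by have := d0; lra.
  have td' : `|t + s - t0| < d.
    by rewrite addrAC (le_lt_trans (ler_normD _ _))//; lra.
  have := grow t tdd s sdd; rewrite addr0 xt {2}/nsq dot0r mulr0 add0r => h.
  rewrite -(@ler_pXn2r _ 2) ?nnegrE ?mulr_ge0 ?addr_ge0 ?(ltW M0)//.
  rewrite (le_trans (sqr_normr_le_nsq _))// lift_invariant//; last exact: nsq_invariant.
  rewrite (le_trans h)// exprMn real_normK ?num_real//.
  by rewrite ler_wpM2r ?sqr_ge0//; nra.
have [r r0 UBr] := rescaled_bounds.
have unit_start t : nonzero t -> nsq (rescaled t 0) = 1.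
  move=> nt; rewrite /rescaled mulr0 addr0 nsqZ lift_invariant; last 2 first.
  - exact: nsq_invariant.
  - exact: nonzero_ball.
  by rewrite exprVn sqr_radius mulVf// gt_eqF// nsq_gt0; case: nt.
have start_le t : nonzero t -> `|rescaled t 0| <= 1.
  move=> nt; rewrite -(@ler_pXn2r _ 2) ?nnegrE// expr1n -(unit_start t nt).
  exact: sqr_normr_le_nsq.
have dif_rescaled t v : nonzero t -> dif xb t v -> dif (rescaled t) 0 v.
  move=> nt D; have rt := radius_gt0 nt.
  have := @dif_affine R _ xb t (radius t) 0 v; rewrite mulr0 addr0 => /(_ D) Da.
  have := dif_scale (radius t)^-1 Da; rewrite scalerA mulVf ?scale1r//.
  by rewrite gt_eqF.
(* otherwise the directions at which the speed is large accumulate somewhere *)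
suff [C CP] : exists C : R, forall t v, nonzero t -> dif xb t v -> `|v| <= C.
  exists (`|C| + (1 + M + 1)) => t v td D; have [xt|xt] := eqVneq (x t) 0.
    by rewrite (le_trans (zero t v td xt D))// lerDr.
  rewrite (le_trans (CP t v (conj td xt) D))// (le_trans (ler_norm _))// lerDl.
  by rewrite !addr_ge0// ltW.
apply: contrapT => NC.
have /choice[tv tvP] : forall k : nat, exists tv : R * 'cV[R]_3,
    [/\ nonzero tv.1, dif xb tv.1 tv.2 & k%:R < `|tv.2|].
  move=> k; apply: contrapT => N; apply: NC; exists k%:R => t v nt D.
  by rewrite leNgt; apply/negP => kv; apply: N; exists (t, v).
have [|e0 cl] := @bounded_cluster R (fun k => rescaled (tv k).1 0) 1.
  by move=> k; apply: start_le; have [] := tvP k.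
have ne0 : nsq e0 = 1.
  apply/eqP; rewrite -subr_eq0 -normr_le0; apply/ler_addgt0Pl => e e_0; rewrite addr0.
  have [r1 r10 r1P] := @pf_continuous R (@nsq R 3) e0 pf_nsq e e_0.
  have [l _ /r1P] := cl _ r10 0%N; rewrite unit_start; last by have [] := tvP l.
  by rewrite distrC => /ltW.
have p15 : (size (stab G e0) <= 15)%N.
  by apply: stab15; rewrite -nsq_gt0 ne0.
have [C [r1 [r10 CP]]] := local_speed_bound GG OG DG r0 ne0 p15 UBr unit_start.
have [l kl hl] := cl _ r10 (Num.truncn C).+1.
have [nt D lv] := tvP l.
have := CP _ nt hl _ (dif_rescaled _ _ nt D); rewrite leNgt => /negP; apply.
apply: le_lt_trans lv; apply: (le_trans (ltW (truncnS_gt C))).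
by rewrite ler_nat.
Qed.

End Speed.

Theorem curve_lift : exists xb, is_lift G x [set t | `|t - t0| < d] xb /\
  exists C : R, forall t v, `|t - t0| < d / 2 -> dif xb t v -> `|v| <= C.
Proof.
have [xb Lxb] := lift_of_jets GG (@nbhd_ball R t0 d) curve_jets.
by exists xb; split=> //; exact: speed_bound.
Qed.

End Curve.
End GlobalLift.

(** * Forms invariant under the icosahedral group *)

Section IcosahedralForms.
Context {R : realType}.
Implicit Types (x v : 'cV[R]_3).

Local Notation p := (@golden R).

Lemma golden_sqr : p ^+ 2 = p + 1.
Proof.
have s5 : Num.sqrt 5 ^+ 2 = 5 :> R by rewrite sqr_sqrtr.
rewrite /golden; move: s5; set w := Num.sqrt 5 => s5.
have -> : ((1 + w) / 2) ^+ 2 = (1 + 2 * w + w ^+ 2) / 4 by field.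
by rewrite s5; field.
Qed.

Lemma golden_gt1 : 1 < p.
Proof.
have p0 : 0 < p by rewrite divr_gt0// ltr_wpDr// sqrtr_ge0.
have := golden_sqr; nra.
Qed.

(** An explicit list, so that sums over the vertices can be expanded. *)
Definition verts : seq 'cV[R]_3 := flatten
  [seq [:: vec3 0 ab.1 ab.2; vec3 ab.1 ab.2 0; vec3 ab.2 0 ab.1]
     | ab <- [:: (1, p); (1, - p); (-1, p); (-1, - p)]].

Definition power_sum (k : nat) x : R := \sum_(v <- verts) dot v x ^+ k.

Lemma hp_power_sum k : hpoly k (power_sum k).
Proof. by apply: hp_sum => v; rewrite -[X in hpoly X]muln1; apply: hp_exp; exact: hp_dot. Qed.

(** Invariants of the standard icosahedron that vanish together only at the
    origin, even over the complex numbers; therefore they generate an ideal that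
    contains all forms of large degree. *)
Inductive basic_form : nat -> ('cV[R]_3 -> R) -> Prop :=
| basic2 : basic_form 2 (@nsq R 3)
| basic6 : basic_form 6 (power_sum 6)
| basic10 : basic_form 10 (power_sum 10).

(** The forms that occur are polynomials in the squares of the coordinates. *)
Definition tm (c : R) i j k x : R :=
  c * (x 0 0 ^+ 2) ^+ i * (x 1 0 ^+ 2) ^+ j * (x 2 0 ^+ 2) ^+ k.

Lemma hp_tm c i j k d : (2 * (i + j + k) = d)%N -> hpoly d (tm c i j k).
Proof.
move=> <-; have -> : (2 * (i + j + k) = 2 * i + 2 * j + 2 * k)%N by rewrite !mulnDr.
by apply: hp_ext (hp_mono c (2 * i) (2 * j) (2 * k)) => x; rewrite /tm -!exprM.
Qed.

Ltac hp_tms := do ?[exact: hp_tm | apply: hp_add].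
Ltac tm_ring := rewrite /tm; ring.

Lemma nsqE x : nsq x = x 0 0 ^+ 2 + x 1 0 ^+ 2 + x 2 0 ^+ 2.
Proof. by rewrite /nsq dot3 !expr2. Qed.

(** Dividing the sums of sixth and of tenth powers by [nsq], with respect to the
    third coordinate, gives up to constant factors the quotients [T6], [T10] and
    the binary remainders [B3], [B5]. *)
Definition T6 x :=
  tm (21 + 38 * p) 2 0 0 x + tm ((- 33) + (- 44) * p) 1 1 0 x + tm (9 + 7 * p) 1 0 1 x +
  tm ((- 9) + (- 22) * p) 0 2 0 x + tm (24 + 37 * p) 0 1 1 x + tm (6 + 8 * p) 0 0 2 x.

Definition B3 x :=
  tm ((- 15) + (- 30) * p) 3 0 0 x + tm (27 + 21 * p) 2 1 0 x +
  tm (72 + 111 * p) 1 2 0 x + tm (15 + 30 * p) 0 3 0 x.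

Definition T10 x :=
  tm ((- 11) + (- 19) * p) 4 0 0 x + tm ((- 158) + (- 256) * p) 3 1 0 x +
  tm (128 + 208 * p) 3 0 1 x + tm ((- 42) + (- 66) * p) 2 2 0 x +
  tm (30 + 48 * p) 2 1 1 x + tm (82 + 128 * p) 2 0 2 x + tm (4 + 14 * p) 1 3 0 x +
  tm (12 + 18 * p) 1 2 1 x + tm ((- 112) + (- 176) * p) 1 1 2 x +
  tm (2 + (- 2) * p) 1 0 3 x + tm (25 + 41 * p) 0 4 0 x +
  tm ((- 16) + (- 32) * p) 0 3 1 x + tm (100 + 158 * p) 0 2 2 x +
  tm (110 + 178 * p) 0 1 3 x + tm (7 + 11 * p) 0 0 4 x.

Definition B5 x :=
  tm (18 + 30 * p) 5 0 0 x + tm (178 + 284 * p) 4 1 0 x + tm (284 + 448 * p) 3 2 0 x +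
  tm (248 + 388 * p) 2 3 0 x + tm (88 + 134 * p) 1 4 0 x + tm ((- 18) + (- 30) * p) 0 5 0 x.

(** [C3] is [B3] divided by the constant [3 * (1 + 2 * p)], which leaves rational
    extreme coefficients; modulo [C3], the form [B5] is a constant multiple of
    the cube of the first square times the quadratic form [q2]. *)
Definition C3 x :=
  tm (- 5) 3 0 0 x + tm ((- 13) + 11 * p) 2 1 0 x + tm (2 + 11 * p) 1 2 0 x + tm 5 0 3 0 x.

Definition q2 x :=
  tm ((- 30) + 5 * p) 2 0 0 x + tm ((- 99) + 88 * p) 1 1 0 x + tm ((- 44) + 88 * p) 0 2 0 x.

Lemma golden_powers : [/\ p ^+ 4 = 3 * p + 2, p ^+ 6 = 8 * p + 5, p ^+ 8 = 21 * p + 13 &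
  p ^+ 10 = 55 * p + 34].
Proof.
have p2 := golden_sqr.
have p4 : p ^+ 4 = 3 * p + 2.
  have -> : p ^+ 4 = (p ^+ 2) ^+ 2 by rewrite -exprM.
  rewrite p2; have -> : (p + 1) ^+ 2 = p ^+ 2 + 2 * p + 1 by ring.
  by rewrite p2; ring.
have p6 : p ^+ 6 = 8 * p + 5.
  have -> : p ^+ 6 = p ^+ 4 * p ^+ 2 by rewrite -exprD.
  rewrite p4 p2; have -> : (3 * p + 2) * (p + 1) = 3 * p ^+ 2 + 5 * p + 2 by ring.
  by rewrite p2; ring.
have p8 : p ^+ 8 = 21 * p + 13.
  have -> : p ^+ 8 = p ^+ 6 * p ^+ 2 by rewrite -exprD.
  rewrite p6 p2; have -> : (8 * p + 5) * (p + 1) = 8 * p ^+ 2 + 13 * p + 5 by ring.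
  by rewrite p2; ring.
split=> //; have -> : p ^+ 10 = p ^+ 8 * p ^+ 2 by rewrite -exprD.
rewrite p8 p2; have -> : (21 * p + 13) * (p + 1) = 21 * p ^+ 2 + 34 * p + 13 by ring.
by rewrite p2; ring.
Qed.

Lemma power_sumE k x : power_sum k x =
  ((x 1 0 + p * x 2 0) ^+ k + (x 1 0 - p * x 2 0) ^+ k +
   (- x 1 0 + p * x 2 0) ^+ k + (- x 1 0 - p * x 2 0) ^+ k) +
  ((x 0 0 + p * x 1 0) ^+ k + (x 0 0 - p * x 1 0) ^+ k +
   (- x 0 0 + p * x 1 0) ^+ k + (- x 0 0 - p * x 1 0) ^+ k) +
  ((x 2 0 + p * x 0 0) ^+ k + (x 2 0 - p * x 0 0) ^+ k +
   (- x 2 0 + p * x 0 0) ^+ k + (- x 2 0 - p * x 0 0) ^+ k).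
Proof.
have d3 (a b c : R) : dot (vec3 a b c) x = a * x 0 0 + b * x 1 0 + c * x 2 0.
  by rewrite dot3; have [-> -> ->] := vec3E a b c.
rewrite /power_sum /verts /= !big_cons big_nil !d3.
rewrite !mul0r !mul1r !mulN1r !mulNr !add0r !addr0.
by rewrite ![p * _ + _]addrC ![- (p * _) + _]addrC; ring.
Qed.

Lemma power_sum6E x : power_sum 6 x = 4 * (B3 x + nsq x * T6 x).
Proof.
have [p4 p6 _ _] := golden_powers; have p2 := golden_sqr.
have E (X Y q : R) : (X + q * Y) ^+ 6 + (X - q * Y) ^+ 6 + (- X + q * Y) ^+ 6 + (- X - q * Y) ^+ 6 =
   4 * ((X ^+ 2) ^+ 3 + 15 * q ^+ 2 * (X ^+ 2) ^+ 2 * Y ^+ 2 + 15 * q ^+ 4 * X ^+ 2 * (Y ^+ 2) ^+ 2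
     + q ^+ 6 * (Y ^+ 2) ^+ 3) by ring.
rewrite power_sumE !E p2 p4 p6 nsqE /B3 /T6 /tm.
by move: (x 0 0 ^+ 2) (x 1 0 ^+ 2) (x 2 0 ^+ 2) => X Y Z; ring.
Qed.

Lemma power_sum10E x : power_sum 10 x = 20 * (B5 x + nsq x * T10 x).
Proof.
have [p4 p6 p8 p10] := golden_powers; have p2 := golden_sqr.
have E (X Y q : R) : (X + q * Y) ^+ 10 + (X - q * Y) ^+ 10 + (- X + q * Y) ^+ 10 +
    (- X - q * Y) ^+ 10 =
   4 * ((X ^+ 2) ^+ 5 + 45 * q ^+ 2 * (X ^+ 2) ^+ 4 * Y ^+ 2 +
    210 * q ^+ 4 * (X ^+ 2) ^+ 3 * (Y ^+ 2) ^+ 2 + 210 * q ^+ 6 * (X ^+ 2) ^+ 2 * (Y ^+ 2) ^+ 3 +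
    45 * q ^+ 8 * X ^+ 2 * (Y ^+ 2) ^+ 4 + q ^+ 10 * (Y ^+ 2) ^+ 5) by ring.
rewrite power_sumE !E p2 p4 p6 p8 p10 nsqE /B5 /T10 /tm.
by move: (x 0 0 ^+ 2) (x 1 0 ^+ 2) (x 2 0 ^+ 2) => X Y Z; ring.
Qed.

Local Notation I := (ideal basic_form).

Lemma ideal_comb d (f g h : 'cV[R]_3 -> R) (a b : R) : I d f -> I d g ->
  (forall x, h x = a * f x + b * g x) -> I d h.
Proof.
move=> If Ig E; apply: ideal_ext (fun x => esym (E x)) _.
by apply: ideal_add; exact: ideal_scale.
Qed.

Lemma ideal_nsq d f : hpoly d f -> I (2 + d) (fun x => nsq x * f x).
Proof. exact: (ideal_gen basic2). Qed.

Lemma ideal_B3 : I 6 B3.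
Proof.
have HT : hpoly 4 T6 by hp_tms.
apply: (@ideal_comb 6 _ _ _ 4^-1 (-1) (ideal_base basic6) (ideal_nsq HT)) => x.
by rewrite power_sum6E; field.
Qed.

Lemma ideal_B5 : I 10 B5.
Proof.
have HT : hpoly 8 T10 by hp_tms.
apply: (@ideal_comb 10 _ _ _ 20^-1 (-1) (ideal_base basic10) (ideal_nsq HT)) => x.
by rewrite power_sum10E; field.
Qed.

(** In the identities below the multiple of [p ^ 2 - p - 1] is spelled out, so
    that they hold for an indeterminate [p]. *)
Lemma golden_rel : p ^+ 2 - p - 1 = 0.
Proof. by rewrite golden_sqr; ring. Qed.

Lemma ideal_C3 : I 6 C3.
Proof.
have p1 := golden_gt1; have c0 : 3 * (1 + 2 * p) != 0 by rewrite gt_eqF//; lra.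
apply: (@ideal_comb 6 B3 B3 _ (3 * (1 + 2 * p))^-1 0 ideal_B3 ideal_B3) => x.
rewrite mul0r addr0; apply: (mulfI c0); rewrite mulVKf//.
have -> : 3 * (1 + 2 * p) * C3 x = B3 x + (p ^+ 2 - p - 1) * (6 * (tm 11 2 1 0 x + tm 11 1 2 0 x)).
  rewrite /C3 /B3 /tm.
  by move: (x 0 0 ^+ 2) (x 1 0 ^+ 2) (x 2 0 ^+ 2) p => X Y Z q; ring.
by rewrite golden_rel mul0r addr0.
Qed.

(** Division of [B5] by [C3]. *)
Lemma ideal_q2 : I 10 (fun x => tm 1 3 0 0 x * q2 x).
Proof.
pose quot x := tm ((- 798) + 128 * p) 2 0 0 x + tm ((- 158) + 256 * p) 1 1 0 x +
  tm (- 30) 0 2 0 x.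
have Hq : hpoly 4 quot by hp_tms.
apply: (@ideal_comb 10 B5 _ _ (128^-1 * (25 * (5 * p - 8))) (- 128^-1) ideal_B5
  (ideal_mul ideal_C3 Hq)) => x.
have n0 : 128 != 0 :> R by [].
apply: (mulfI n0).
have -> (a b c : R) : 128 * (128^-1 * a * b + - 128^-1 * c) = a * b - c by field.
have E : 25 * (5 * p - 8) * B5 x - C3 x * quot x - 128 * (tm 1 3 0 0 x * q2 x) =
   (p ^+ 2 - p - 1) * (125 * (tm 30 5 0 0 x + tm 284 4 1 0 x + tm 448 3 2 0 x + tm 388 2 3 0 x +
      tm 134 1 4 0 x + tm (- 30) 0 5 0 x) -
      (tm 11 2 1 0 x + tm 11 1 2 0 x) * (tm 128 2 0 0 x + tm 256 1 1 0 x)).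
  rewrite /C3 /B5 /quot /q2 /tm.
  by move: (x 0 0 ^+ 2) (x 1 0 ^+ 2) (x 2 0 ^+ 2) p => X Y Z q; ring.
by apply/esym/eqP; rewrite -subr_eq0 E golden_rel mul0r.
Qed.

(** The quadratic and the cubic form are coprime: a combination of them is a
    constant multiple of a monomial of degree [4]. *)
Lemma ideal_eliminate (k l k' l' : 'cV[R]_3 -> R) (N : R) (i j : nat) :
  N != 0 -> (i + j = 4)%N ->
  hpoly 4 k -> hpoly 2 l ->
  (forall x, q2 x * k x + C3 x * l x - N * tm 1 i j 0 x =
     (p ^+ 2 - p - 1) * ((tm 5 2 0 0 x + tm 88 1 1 0 x + tm 88 0 2 0 x) * k' x +
       (tm 11 2 1 0 x + tm 11 1 2 0 x) * l' x)) ->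
  I 14 (tm 1 (3 + i) j 0).
Proof.
move=> n0 ij Hk Hl E.
have H3 : hpoly 6 (tm 1 3 0 0) by exact: hp_tm.
apply: (@ideal_comb 14 _ _ _ N^-1 N^-1 (ideal_mul ideal_q2 Hk)
  (ideal_mul ideal_C3 (hp_mul H3 Hl))) => x.
apply: (mulfI n0); rewrite mulrDr !mulVKf//.
have := E x; rewrite golden_rel mul0r => /subr0_eq => {}E.
have -> : tm 1 (3 + i) j 0 x = tm 1 3 0 0 x * tm 1 i j 0 x.
  by rewrite /tm exprD !expr0 !mulr1 !mul1r mulrA.
rewrite [LHS]mulrCA -E.
by move: (tm 1 3 0 0 x) (q2 x) (C3 x) (k x) (l x) => a1 a2 a3 a4 a5; ring.
Qed.

(** The cofactors solve a linear system over the field generated by [p]. *)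
Lemma ideal_top j : (j <= 2)%N -> I 14 (tm 1 (7 - j) j 0).
Proof.
have N0 : 40 * 40 != 0 :> R by rewrite mulf_neq0.
case: j => [|[|[|//]]] _.
- pose k x := tm (675 + (- 591) * p) 2 0 0 x + tm (616 + 286 * p) 1 1 0 x +
    tm ((- 143) + 286 * p) 0 2 0 x.
  pose l x := tm ((- (50 * 99 + 11)) + 3630 * p) 1 0 0 x + tm (- (62 * 100 + 92)) 0 1 0 x.
  apply: (@ideal_eliminate k l (fun x => tm (- 591) 2 0 0 x + tm 286 1 1 0 x + tm 286 0 2 0 x)
    (fun x => tm 3630 1 0 0 x) (40 * 40) 4 0); [exact: N0|by []|by hp_tms|by hp_tms|].
  move=> x; rewrite /q2 /C3 /k /l /tm.
  by move: (x 0 0 ^+ 2) (x 1 0 ^+ 2) (x 2 0 ^+ 2) p => X Y Z q; ring.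
- pose k x := tm ((- 143) + 286 * p) 2 0 0 x + tm ((- 326) + (- 162) * p) 1 1 0 x +
    tm (44 + (- 143) * p) 0 2 0 x.
  pose l x := tm (1144 + (- 1573) * p) 1 0 0 x + tm (2904 + 484 * p) 0 1 0 x.
  apply: (@ideal_eliminate k l (fun x => tm 286 2 0 0 x + tm (- 162) 1 1 0 x + tm (- 143) 0 2 0 x)
    (fun x => tm (- 1573) 1 0 0 x + tm 484 0 1 0 x) (40 * 40) 3 1); [exact: N0|by []|by hp_tms|by hp_tms|].
  move=> x; rewrite /q2 /C3 /k /l /tm.
  by move: (x 0 0 ^+ 2) (x 1 0 ^+ 2) (x 2 0 ^+ 2) p => X Y Z q; ring.
- pose k x := tm (44 + (- 143) * p) 2 0 0 x + tm (286 + 132 * p) 1 1 0 x +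
    tm ((- 29) + 113 * p) 0 2 0 x.
  pose l x := tm ((- 407) + 759 * p) 1 0 0 x + tm ((- 2244) + (- 484) * p) 0 1 0 x.
  apply: (@ideal_eliminate k l (fun x => tm (- 143) 2 0 0 x + tm 132 1 1 0 x + tm 113 0 2 0 x)
    (fun x => tm 759 1 0 0 x + tm (- 484) 0 1 0 x) (40 * 40) 2 2); [exact: N0|by []|by hp_tms|by hp_tms|].
  move=> x; rewrite /q2 /C3 /k /l /tm.
  by move: (x 0 0 ^+ 2) (x 1 0 ^+ 2) (x 2 0 ^+ 2) p => X Y Z q; ring.
Qed.

(** By means of [C3] a monomial is expressed through the three preceding ones. *)
Lemma ideal_binary j : (j <= 7)%N -> I 14 (tm 1 (7 - j) j 0).
Proof.
elim/ltn_ind: j => j IH j7; have [j2|] := leqP j 2; first exact: ideal_top.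
case: j IH j7 => [|[|[|j]]]// IH j7 _.
have I0 : I 14 (tm 1 (7 - j) j 0) by apply: IH; lia.
have I1 : I 14 (tm 1 (7 - j.+1) j.+1 0) by apply: IH; lia.
have I2 : I 14 (tm 1 (7 - j.+2) j.+2 0) by apply: IH; lia.
have [i ij] : exists i, (i + j = 4)%N by exists (4 - j)%N; lia.
have H : hpoly 8 (tm 1 i j 0) by apply: hp_tm; lia.
have e0 : (7 - j = i.+3)%N by lia.
have e1 : (7 - j.+1 = i.+2)%N by lia.
have e2 : (7 - j.+2 = i.+1)%N by lia.
have e3 : (7 - j.+3 = i)%N by lia.
rewrite e0 in I0; rewrite e1 in I1; rewrite e2 in I2; rewrite e3.
have J1 := ideal_add (ideal_mul ideal_C3 H) (ideal_scale 5 I0).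
have J2 := ideal_add (ideal_scale (- (- 13 + 11 * p)) I1) (ideal_scale (- (2 + 11 * p)) I2).
apply: (@ideal_comb 14 _ _ _ 5^-1 5^-1 J1 J2) => x.
have n5 : 5 != 0 :> R by [].
apply: (mulfI n5); rewrite mulrDr !mulVKf//.
rewrite /C3 /tm !exprS !expr0.
move: ((x 0 0 * (x 0 0 * 1)) ^+ i) ((x 1 0 * (x 1 0 * 1)) ^+ j) => X Y.
by move: (x 0 0) (x 1 0) (x 2 0) p => x0 x1 x2 q; ring.
Qed.

(** Modulo [nsq] the third coordinate is eliminated. *)
Lemma ideal_ternary k i j : (i + j + k = 7)%N -> I 14 (tm 1 i j k).
Proof.
elim: k i j => [|k IH] i j ijk.
  have -> : i = (7 - j)%N by lia.
  by apply: ideal_binary; lia.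
have H : hpoly 12 (tm 1 i j k) by apply: hp_tm; lia.
have I1 : I 14 (tm 1 i.+1 j k) by apply: IH; lia.
have I2 : I 14 (tm 1 i j.+1 k) by apply: IH; lia.
have J1 := ideal_add I1 I2.
apply: (@ideal_comb 14 _ _ _ 1 (-1) (ideal_nsq H) J1) => x.
by rewrite nsqE /tm !exprSr; ring.
Qed.

Lemma ideal_squares i j k : (7 <= i + j + k)%N -> I (2 * (i + j + k)) (tm 1 i j k).
Proof.
move=> h7.
have [i1 [j1 [k1 [i1i j1j k1k e7]]]] : exists i1 j1 k1,
    [/\ (i1 <= i)%N, (j1 <= j)%N, (k1 <= k)%N & (i1 + j1 + k1 = 7)%N].
  exists (minn i 7), (minn j (7 - minn i 7)), (7 - minn i 7 - minn j (7 - minn i 7))%N.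
  by split; lia.
have H : hpoly (2 * ((i - i1) + (j - j1) + (k - k1))) (tm 1 (i - i1) (j - j1) (k - k1)).
  exact: hp_tm.
have -> : (2 * (i + j + k) = 14 + 2 * ((i - i1) + (j - j1) + (k - k1)))%N by lia.
apply: ideal_ext (ideal_mul (ideal_ternary e7) H) => x.
rewrite /tm -[in RHS](subnKC i1i) -[in RHS](subnKC j1j) -[in RHS](subnKC k1k) !exprD.
by ring.
Qed.

(** A monomial of degree at least [16] is a monomial in the squares, of degree at
    least [7], times a product of distinct coordinates. *)
Lemma ideal_all d (f : 'cV[R]_3 -> R) : (15 < d)%N -> hpoly d f -> I d f.
Proof.
move=> + Hf; elim: Hf => [c i j k|d' f1 f2 _ IH1 _ IH2] d15; last first.
  by apply: ideal_add; [exact: IH1|exact: IH2].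
have H : hpoly (odd i + odd j + odd k)
   (fun x => c * x 0 0 ^+ odd i * x 1 0 ^+ odd j * x 2 0 ^+ odd k) by exact: hp_mono.
have oi := odd_double_half i; have oj := odd_double_half j; have ok := odd_double_half k.
have I1 : I (2 * (i./2 + j./2 + k./2)) (tm 1 i./2 j./2 k./2).
  by apply: ideal_squares; move: oi oj ok; case: (odd i); case: (odd j); case: (odd k); lia.
have -> : (i + j + k = 2 * (i./2 + j./2 + k./2) + (odd i + odd j + odd k))%N by lia.
apply: ideal_ext (ideal_mul I1 H) => x.
rewrite /tm -[in RHS]oi -[in RHS]oj -[in RHS]ok -!mul2n !(exprD _ (nat_of_bool _)) -!exprM.
by move: (x 0 0 ^+ (2 * _)) (x 1 0 ^+ (2 * _)) (x 2 0 ^+ (2 * _)) => a1 a2 a3; ring.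
Qed.

End IcosahedralForms.

(** * The rotation group of the icosahedron *)

Section Icosahedron.
Context {R : realType}.
Implicit Types (x v : 'cV[R]_3).

Local Notation p := (@golden R).
Local Notation verts := (@verts R).

Lemma vec3_inj (a b c a' b' c' : R) : vec3 a b c = vec3 a' b' c' -> [/\ a = a', b = b' & c = c'].
Proof.
move=> E; have [e0 e1 e2] := vec3E a b c; have [e0' e1' e2'] := vec3E a' b' c'.
by split; [rewrite -e0 -e0' E|rewrite -e1 -e1' E|rewrite -e2 -e2' E].
Qed.

Lemma verts_uniq : uniq verts.
Proof.
have p1 := @golden_gt1 R; rewrite /verts /= !inE !negb_or !andbT.
by do !(apply/andP; split); apply/eqP => /vec3_inj[*]; lra.
Qed.

Lemma mem_verts v : icosahedron_vertices v <-> v \in verts.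
Proof.
split.
  move=> [[] [[]]] /=; rewrite ?expr0 ?expr1 ?mul1r ?mulN1r => -[] ->;
    by rewrite /verts /= !inE eqxx ?orbT.
case/flatten_mapP=> ab abV vab.
have [e [f abE]] : exists e f : bool, ab = ((-1) ^+ e, (-1) ^+ f * p).
  move: abV; rewrite !inE => /or4P[] /eqP ->; [exists false, false|exists false, true
    |exists true, false|exists true, true];
    by rewrite /= ?expr0 ?expr1 ?mul1r ?mulN1r.
exists e, f; move: vab; rewrite abE !inE => /or3P[] /eqP ->;
  [exact: Or31|exact: Or32|exact: Or33].
Qed.

Lemma nsq_verts v : v \in verts -> nsq v = p + 2.
Proof.
have p2 := @golden_sqr R; move=> /mem_verts[e [f]] /=.
have e2 : ((-1) ^+ e : R) ^+ 2 = 1 by rewrite sqrr_sign.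
have f2 : ((-1) ^+ f * p : R) ^+ 2 = p + 1 by rewrite exprMn sqrr_sign mul1r.
move: e2 f2; move: ((-1) ^+ e) ((-1) ^+ f * p) => a b a2 b2.
have N (x y z : R) : nsq (vec3 x y z) = x ^+ 2 + y ^+ 2 + z ^+ 2.
  by rewrite nsqE; have [-> -> ->] := vec3E x y z.
by case=> ->; rewrite N a2 b2 expr0n /=; ring.
Qed.

(** A convex combination of vectors of the same norm has this norm only if the
    vectors with nonzero weight coincide with it. *)
Lemma hull_extreme x : convex_hull_of icosahedron_vertices x -> nsq x = p + 2 -> x \in verts.
Proof.
move=> [N [w [y [w0 w1 Vy xE]]]] nx.
have nonneg i : 0 <= w i * nsq (y i - x) by rewrite mulr_ge0// nsq_ge0.
have sum0 : \sum_i w i * nsq (y i - x) = 0.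
  have E i : w i * nsq (y i - x) = 2 * (p + 2) * w i - 2 * (w i * dot (y i) x).
    by rewrite nsqB nx nsq_verts; [ring|exact/mem_verts].
  rewrite (eq_bigr _ (fun i _ => E i)) sumrB -!mulr_sumr w1 mulr1.
  suff -> : \sum_i w i * dot (y i) x = p + 2 by rewrite subrr.
  rewrite -nx; transitivity (dot (\sum_i w i *: y i) x); last by rewrite -xE.
  elim/big_rec2 : _ => [|i a b _ ->]; first by rewrite dotC dot0r.
  by rewrite dotDl dotZl.
have [i wi] : exists i, w i != 0.
  apply: contrapT => N0; have := oner_neq0 R; rewrite -w1 big1 ?eqxx// => i _.
  by apply/eqP; apply: contrapT => /negP wi; apply: N0; exists i.
have : w i * nsq (y i - x) = 0 by apply: (psumr_eq0P _ sum0) => // j _; exact: nonneg.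
move=> /eqP; rewrite mulf_eq0 (negbTE wi)/= nsq_eq0 subr_eq0 => /eqP <-.
exact/mem_verts.
Qed.

Lemma hull_vertex v : v \in verts -> convex_hull_of icosahedron_vertices v.
Proof.
move=> /mem_verts Vv; exists 1%N, (fun=> 1), (fun=> v); split=> //.
  by rewrite big_ord1.
by rewrite big_ord1 scale1r.
Qed.

Section Symmetries.
Variables (s : R) (Q : 'M[R]_3).
Hypotheses (s0 : 0 < s) (OQ : orthogonal_mx Q).

Let P : set 'cV[R]_3 := [set s *: (Q *m x) | x in convex_hull_of icosahedron_vertices].
Let W := [seq Q *m v | v <- verts].

Lemma vertex_images_uniq : uniq W.
Proof.
rewrite map_inj_uniq ?verts_uniq// => u v /(congr1 (mulmx Q^T)).
by rewrite !mulmxA (mulmx1C OQ) !mul1mx.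
Qed.

(** A symmetry preserves the solid and the norm, hence the points of maximal
    norm, which are the vertices. *)
Lemma symmetry_vertex A w : rotational_symmetries P A -> w \in W -> A *m w \in W.
Proof.
move=> [OA _ AP] /mapP[v vV ->].
have : P (A *m (s *: (Q *m v))).
  by rewrite -[P]AP; exists (s *: (Q *m v)) => //; exists v => //; exact: hull_vertex.
move=> [x hx]; rewrite -scalemxAr => /(scalerI (lt0r_neq0 s0)) E.
have nx : nsq x = p + 2.
  by rewrite -(orthogonal_nsq x OQ) E (orthogonal_nsq _ OA) (orthogonal_nsq _ OQ) nsq_verts.
by rewrite -E; apply: map_f; exact: hull_extreme.
Qed.

Definition cols3 (a b c : 'cV[R]_3) : 'M[R]_3 :=
  \matrix_(i, j) (if j == 0 then a i 0 else if j == 1 then b i 0 else c i 0).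

Lemma mul_cols3 A a b c : A *m cols3 a b c = cols3 (A *m a) (A *m b) (A *m c).
Proof.
apply/matrixP => i j; rewrite !mxE.
by case: ifP => j0; last case: ifP => j1; apply: eq_bigr => k _; rewrite mxE j0 ?j1.
Qed.

Let v1 : 'cV[R]_3 := vec3 0 1 p.
Let v2 : 'cV[R]_3 := vec3 1 p 0.
Let v3 : 'cV[R]_3 := vec3 p 0 1.

Lemma frame_unit : cols3 v1 v2 v3 \in unitmx.
Proof.
rewrite -row_free_unit; apply: inj_row_free => u uB.
have dotu v : dot u^T v = (u *m v) 0 0.
  by rewrite mxE; apply: eq_bigr => i _; rewrite mxE.
have colu j : (u *m cols3 v1 v2 v3) 0 j = dot u^T (if j == 0 then v1 else if j == 1 then v2 else v3).
  rewrite dotu [LHS]mxE [RHS]mxE; apply: eq_bigr => k _; rewrite [cols3 _ _ _ _ _]mxE.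
  by case: (j == 0) => //; case: (j == 1).
have h1 := colu 0; have h2 := colu 1; have h3 := colu 2.
rewrite uB !mxE /= in h1 h2 h3; apply: trmx_inj; rewrite trmx0.
move: h1 h2 h3; rewrite !dot3 /v1 /v2 /v3.
have [-> -> ->] := vec3E 0 1 p; have [-> -> ->] := vec3E 1 p 0; have [-> -> ->] := vec3E p 0 1.
move: (u^T 0 0) (u^T 1 0) (u^T 2 0) (cV3P (x := u^T) (y := 0)) => a b c H h1 h2 h3.
have p1 := @golden_gt1 R; have p2 := @golden_sqr R.
have b0 : b = 0.
  have bE : b = - (p * c) by lra.
  have aE : a = p ^+ 2 * c.
    by have := h2; rewrite bE => h2'; rewrite expr2; lra.
  have : (p ^+ 3 + 1) * c = 0.
    by have := h3; rewrite aE => h3'; rewrite !exprS expr0; lra.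
  move=> /eqP; rewrite mulf_eq0 => /orP[/eqP k0|/eqP c0]; last by rewrite bE c0 mulr0 oppr0.
  by have : 0 < p ^+ 3 + 1 by [rewrite addr_gt0// exprn_gt0//; lra]; rewrite k0 ltxx.
have c0 : c = 0.
  apply/eqP; have : p * c = 0 by lra.
  by move=> /eqP; rewrite mulf_eq0 gt_eqF//; lra.
have a0 : a = 0 by move: h2; rewrite b0; lra.
by apply: H; rewrite mxE.
Qed.

(** A symmetry is determined by the images of three linearly independent
    vertices, so that it can be found in a finite list. *)
Definition symmetry_seq : seq 'M[R]_3 :=
  undup [seq A <- flatten [seq [seq cols3 a b c *m invmx (cols3 (Q *m v1) (Q *m v2) (Q *m v3))
    | b <- W, c <- W] | a <- W] | `[< rotational_symmetries P A >]].

Lemma mem_symmetry_seq A : A \in symmetry_seq <-> rotational_symmetries P A.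
Proof.
rewrite mem_undup mem_filter; split=> [/andP[/asboolP]//|SA].
apply/andP; split; first exact/asboolP.
have W1 : Q *m v1 \in W by apply: map_f; rewrite /verts /= !inE eqxx ?orbT.
have W2 : Q *m v2 \in W by apply: map_f; rewrite /verts /= !inE eqxx ?orbT.
have W3 : Q *m v3 \in W by apply: map_f; rewrite /verts /= !inE eqxx ?orbT.
have AW v : Q *m v \in W -> A *m (Q *m v) \in W by exact: symmetry_vertex.
apply/flatten_mapP; exists (A *m (Q *m v1)); first exact: AW.
apply/allpairsPdep; exists (A *m (Q *m v2)), (A *m (Q *m v3)); split; rewrite ?AW//.
have uB : cols3 (Q *m v1) (Q *m v2) (Q *m v3) \in unitmx.
    rewrite -mul_cols3 unitmx_mul frame_unit andbT.
    by have [] := mulmx1_unit OQ.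
  by rewrite -mul_cols3 mulmxK.
Qed.

Let G := symmetry_seq.

Lemma symmetry_group : mxgroup G.
Proof.
split.
- exact: undup_uniq.
- apply/mem_symmetry_seq; split; rewrite ?det1//.
    by rewrite /orthogonal_mx trmx1 mulmx1.
  apply/seteqP; split=> [_ [x Px <-]|x Px]; first by rewrite mul1mx.
  by exists x; rewrite ?mul1mx.
- move=> g h /mem_symmetry_seq[Og dg gP] /mem_symmetry_seq[Oh dh hP].
  apply/mem_symmetry_seq; split.
  + by rewrite /orthogonal_mx trmx_mul mulmxA -(mulmxA g) Oh mulmx1.
  + by rewrite det_mulmx dg dh mulr1.
  + rewrite -[in RHS]gP -[in RHS]hP; apply/seteqP; split=> [_ [x Px <-]|_ [_ [x Px <-] <-]].
      by exists (h *m x); [exists x|rewrite mulmxA].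
    by exists x; rewrite ?mulmxA.
- move=> g /mem_symmetry_seq[Og dg gP]; exists g^T; last exact: mulmx1C.
  apply/mem_symmetry_seq; split.
  + by rewrite /orthogonal_mx trmxK; exact: mulmx1C.
  + by rewrite det_tr.
  + rewrite -[in LHS]gP; apply/seteqP; split=> [_ [_ [x Px <-] <-]|x Px].
      by rewrite mulmxA (mulmx1C Og) mul1mx.
    by exists (g *m x); [exists x|rewrite mulmxA (mulmx1C Og) mul1mx].
Qed.

Lemma symmetry_orthogonal g : g \in G -> orthogonal_mx g.
Proof. by move=> /mem_symmetry_seq[]. Qed.

Lemma symmetry_det g : g \in G -> \det g = 1.
Proof. by move=> /mem_symmetry_seq[]. Qed.

Lemma symmetry_perm g : g \in G -> perm_eq [seq g *m w | w <- W] W.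
Proof.
move=> gG; have inj : injective (mulmx g : 'cV[R]_3 -> 'cV[R]_3).
  move=> u v /(congr1 (mulmx g^T)).
  by rewrite !mulmxA (mulmx1C (symmetry_orthogonal gG)) !mul1mx.
have uW : uniq [seq g *m w | w <- W] by rewrite map_inj_uniq ?vertex_images_uniq.
have sub : {subset [seq g *m w | w <- W] <= W}.
  by move=> _ /mapP[w wW ->]; apply: symmetry_vertex wW; exact/mem_symmetry_seq.
have sz : (size W <= size [seq g *m w | w <- W])%N by rewrite size_map.
have [_ E] := uniq_min_size uW sub sz.
exact: uniq_perm uW vertex_images_uniq E.
Qed.

(** A nontrivial rotation about [e] moves every vertex off the axis, so that the
    stabiliser of [e] acts freely on the orbit of such a vertex. *)
Lemma symmetry_stab e : e != 0 -> (size (stab G e) <= 15)%N.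
Proof.
move=> e0; have GG := symmetry_group; have ne : nsq e != 0 by rewrite nsq_eq0.
have [w wW off] : exists2 w, w \in W & axisq e w != 0.
  have W1 : Q *m v1 \in W by apply: map_f; rewrite /verts /= !inE eqxx ?orbT.
  have W2 : Q *m v2 \in W by apply: map_f; rewrite /verts /= !inE eqxx ?orbT.
  have [h1|?] := eqVneq (axisq e (Q *m v1)) 0; last by exists (Q *m v1).
  have [h2|?] := eqVneq (axisq e (Q *m v2)) 0; last by exists (Q *m v2).
  exfalso.
  have line a : axisq e a = 0 -> a = (dot e a / nsq e) *: e.
    move=> /subr0_eq ha; apply/subr0_eq/eqP; rewrite -nsq_eq0 nsqB nsqZ dotZr (dotC a).
    have : nsq a = dot e a ^+ 2 / nsq e by rewrite -ha mulrC mulKf.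
    by move=> ->; apply/eqP; field.
  have E : dot (Q *m v1) (Q *m v2) ^+ 2 = nsq (Q *m v1) * nsq (Q *m v2).
    rewrite (line _ h1) (line _ h2) dotZl dotZr !nsqZ /nsq.
    by ring.
  have n1 : nsq (Q *m v1) = p + 2.
    by rewrite (orthogonal_nsq _ OQ) nsq_verts// /verts /= !inE eqxx ?orbT.
  have n2 : nsq (Q *m v2) = p + 2.
    by rewrite (orthogonal_nsq _ OQ) nsq_verts// /verts /= !inE eqxx ?orbT.
  move: E; rewrite n1 n2 (orthogonal_dot _ _ OQ) dot3 /v1 /v2.
  have [-> -> ->] := vec3E 0 1 p; have [-> -> ->] := vec3E 1 p 0.
  have p1 := @golden_gt1 R; have p2 := @golden_sqr R.
  have -> : (0 * 1 + 1 * p + p * 0) ^+ 2 = p + 1 by rewrite mul0r mulr0 mul1r add0r addr0.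
  have -> : (p + 2) * (p + 2) = p ^+ 2 + 4 * p + 4 by ring.
  by rewrite p2; lra.
suff inj : {in stab G e &, injective (fun g => g *m w)}.
  have sW : (size W <= 15)%N by rewrite size_map.
  rewrite -(size_map (fun g => g *m w)); apply: leq_trans sW; apply: uniq_leq_size.
    by rewrite map_inj_in_uniq//; have [] := mxgroup_stab e GG.
  move=> _ /mapP[g gS ->]; move: gS; rewrite mem_stab => /andP[gG _].
  by apply: symmetry_vertex wW; exact/mem_symmetry_seq.
move=> g h; rewrite !mem_stab => /andP[gG /eqP ge] /andP[hG /eqP he] gh.
have [Gu G1 GM GV] := GG; have OG := symmetry_orthogonal.
have hTG : h^T \in G by exact: (trmx_in GG OG).
pose k := h^T *m g; have kG : k \in G by exact: GM.
have ke : k *m e = e by rewrite /k -mulmxA ge (trmx_fixed OG hG he).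
have kw : k *m w = w by rewrite /k -mulmxA gh mulmxA (mulmx1C (OG _ hG)) mul1mx.
have k1 : k = 1%:M.
  apply/eqP; apply: contraNT off => k1.
  have [c c0 /(_ w)] := rotation_moves (OG _ kG) (symmetry_det kG) e0 ke k1.
  have -> : nsq (k *m w - w) = 0 by rewrite kw subrr /nsq dot0r.
  move=> h0.
  by rewrite eq_le axisq_ge0 andbT -(pmulr_rle0 _ c0).
by rewrite -[g]mul1mx -(OG _ hG) -mulmxA -/k k1 mulmx1.
Qed.

(** The orthogonal matrix that places the solid carries the basic forms to
    invariants of its group, which generate an ideal with the same property. *)
Lemma symmetry_gen f : polyfun f -> ginvariant G f -> gen G 15 f.
Proof.
have GG := symmetry_group; have OG := symmetry_orthogonal.
pose hs i h := exists2 h0, @basic_form R i h0 & h = (fun x => h0 (Q^T *m x)).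
have OQT : orthogonal_mx Q^T by rewrite /orthogonal_mx trmxK; exact: mulmx1C.
apply: (@gen_of_ideal R G GG 15 hs) => [i h [h0 bf ->]|d f' d15 Hf]; last first.
  have -> : f' = (fun x => f' (Q *m (Q^T *m x))).
    by apply/funext => x; rewrite mulmxA OQ mul1mx.
  have := ideal_all d15 (hp_lin Q Hf).
  by apply: (@ideal_lin R _ hs Q^T) => i h bf; exists h.
have inv_nsq : ginvariant G (fun x => nsq (Q^T *m x)).
  by move=> g gG x; rewrite !(orthogonal_nsq _ OQT) (orthogonal_nsq _ (OG _ gG)).
have inv_sum k : ginvariant G (fun x => power_sum k (Q^T *m x)).
  move=> g gG x.
  have E y : power_sum k (Q^T *m y) = \sum_(w <- W) dot w y ^+ k.
    by rewrite /power_sum /W big_map; apply: eq_bigr => v _; rewrite dot_mulmx trmxK.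
  rewrite !E -[RHS](perm_big _ (symmetry_perm (trmx_in GG OG gG))) [RHS]big_map.
  by apply: eq_bigr => w _; rewrite dot_mulmx.
case: i h0 / bf; split=> //; apply: hp_lin;
  [exact: hp_nsq|exact: hp_power_sum|exact: hp_power_sum].
Qed.

End Symmetries.
End Icosahedron.

(** * The lifting property *)

Section InvariantsAlongCurve.
Context {R : realType}.

Lemma dif_coord n (c : R -> 'cV[R]_n) t v i : dif c t v -> dif (fun s => c s i 0) t (v i 0).
Proof.
move=> Dc e /Dc[d d0 H]; exists d => // h /H.
by apply: le_trans; apply: le_trans (normr_coord _ i 0); rewrite !mxE.
Qed.

Lemma derivable_dif n (c : R -> 'cV[R]_n) t : derivable c t 1 -> dif c t (c^`() t).
Proof. by move=> /derivableP; rewrite -derive1E => /difP. Qed.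

Lemma Ck_bounds m k (I : set R) (c : R -> 'cV[R]_m) t0 : open I -> Ck_curve k I c -> I t0 ->
  exists2 d, 0 < d & (forall t, `|t - t0| < d -> I t) /\
  forall j, (j <= k)%N -> exists M, forall t, `|t - t0| < d -> `|derive1n j c t| <= M.
Proof.
move=> oI [Dc Cc] It0.
have cont j : (j <= k)%N -> {for t0, continuous (derive1n j c)}.
  rewrite leq_eqVlt => /orP[/eqP ->|jk]; first exact: Cc.
  by apply: differentiable_continuous; apply/derivable1_diffP; exact: Dc.
have [r /= r0 Ir] : \forall t \near t0, I t by exact: open_nbhs_nbhs.
have [d d0 dM] : exists2 d, 0 < d & forall j, j \in iota 0 k.+1 ->
    forall t, `|t - t0| < d -> `|derive1n j c t| <= `|derive1n j c t0| + 1.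
  apply: (common_delta (P := fun j d => forall t, `|t - t0| < d ->
      `|derive1n j c t| <= `|derive1n j c t0| + 1)) => [j d d' dd H t td|j].
    by apply: H; exact: lt_le_trans dd.
  rewrite mem_iota add0n ltnS /= => /cont /cvgr_dist_lt /(_ _ ltr01)[d /= d0 H].
  exists d => // t td; have := H t; rewrite /= distrC => /(_ td) h.
  rewrite -[derive1n j c t](subrKC (derive1n j c t0)) (le_trans (ler_normD _ _))// lerD2l.
  by rewrite distrC ltW.
exists (Num.min d r); first by rewrite lt_min d0.
split=> [t|j jk].
  by rewrite lt_min => /andP[_ tr]; apply: Ir; rewrite /= distrC.
exists (`|derive1n j c t0| + 1) => t; rewrite lt_min => /andP[td _].
by apply: dM => //; rewrite mem_iota add0n ltnS.
Qed.

Lemma UB_coord m k (I : set R) (c : R -> 'cV[R]_m) t0 : open I -> Ck_curve k I c -> I t0 ->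
  exists2 d, 0 < d & (forall t, `|t - t0| < d -> I t) /\
  forall i, UB [set t | `|t - t0| < d] d k (fun t s => c (t + s) i 0).
Proof.
move=> oI Cc It0; have [d d0 [Id Md]] := Ck_bounds oI Cc It0.
have near t s : `|t - t0| < d / 2 -> `|s| < d / 2 -> `|t + s - t0| < d.
  move=> td sd; have -> : t + s - t0 = (t - t0) + s by ring.
  by rewrite (le_lt_trans (ler_normD _ _))//; lra.
have d20 : 0 < d / 2 by rewrite divr_gt0.
exists (d / 2) => //; split=> [t td|i].
  by apply: Id; lra.
exists (fun j t s => derive1n j c (t + s) i 0); split=> // [j jk t td s sd|j jk].
- have [Dc _] := Cc; have := Dc _ jk _ (Id _ (near _ _ td sd)).
  move=> /derivable_dif; rewrite -derive1nS => /(dif_coord i) H.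
  have := @dif_affine R R (fun s => derive1n j c s i 0) t 1 s _; rewrite mul1r => /(_ _ H).
  by rewrite scale1r; apply: dif_near; exists 1 => // s' _; rewrite mul1r.
- have [M cM] := Md j jk; exists M => t td s sd.
  by apply: le_trans (normr_coord _ _ _) _; exact: cM (near _ _ td sd).
Qed.

Lemma UB_meval m k (T : Type) (A : set T) d (F : 'I_m -> T -> R -> R) (q : mpoly.mpoly m R) :
  (forall i, UB A d k (F i)) -> UB A d k (fun t s => meval (fun i => F i t s) q).
Proof.
move=> UF; pose H := fun (M : multinom m) t s => mcoeff M q * \prod_(i <- enum 'I_m) F i t s ^+ M i.
apply: (@UB_ext _ _ _ _ _ (fun t s => \sum_(M <- msupp q) H M t s)) => [t _ s _|].
  by rewrite mevalE; apply: eq_bigr => M _; rewrite /H big_enum.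
apply: UB_sum => M; apply: UB_mul.
  by apply: (@UB_cst _ _ _ _ _ (fun=> mcoeff M q) `|mcoeff M q|).
elim: (enum 'I_m) => [|i r IH].
  apply: (@UB_ext _ _ _ _ _ (fun _ _ => 1)) => [t _ s _|]; first by rewrite big_nil.
  by apply: (@UB_cst _ _ _ _ _ (fun=> 1) 1) => t _; rewrite normr1.
apply: (@UB_ext _ _ _ _ _ (fun t s => F i t s ^+ M i * \prod_(i <- r) F i t s ^+ M i)) => [t _ s _|].
  by rewrite big_cons.
by apply: UB_mul => //; exact: UB_exp.
Qed.

End InvariantsAlongCurve.

Section LiftingProperty.
Context {R : realType} (S : set 'M[R]_3) (G : seq 'M[R]_3) (GG : mxgroup G).
Hypothesis memG : forall A, A \in G <-> S A.
Hypothesis OG : forall g, g \in G -> orthogonal_mx g.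
Hypothesis DG : forall g, g \in G -> \det g = 1.
Hypothesis gen15 : forall f, polyfun f -> ginvariant G f -> gen G 15 f.
Hypothesis stab15 : forall e : 'cV[R]_3, e != 0 -> (size (stab G e) <= 15)%N.

(** The whole orbit space serves as the neighbourhood: for any choice of points
    over the curve, the invariants are polynomials in the curve. *)
Theorem property_B_of_generators : property_B S 15.
Proof.
move=> m sigma [inv_sigma _ gen_sigma]; exists (range (orbit_map sigma)); split=> //.
  by rewrite /within /=; near=> y.
move=> I c oI _ Cc cI t0 It0.
have /choice[x xc] : forall t, exists y, I t -> orbit_map sigma y = c t.
  move=> t; have [It|nIt] := pselect (I t); last by exists 0.
  by have [y _ yE] := cI t It; exists y.
have [d d0 [Id UBc]] := UB_coord oI Cc It0.
have UBx f : polyfun f -> ginvariant G f ->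
    UB [set t | `|t - t0| < d / 2] (d / 2) 15 (fun t s => f (x (t + s))).
  move=> [p fE] inv_f; have [|q pE] := gen_sigma p.
    by move=> A /memG AG y; rewrite -!fE inv_f.
  apply: (@UB_ext _ _ _ _ _ (fun t s => meval (fun i => c (t + s) i 0) q)) => [t td s sd|].
    have It : I (t + s).
      apply: Id; have -> : t + s - t0 = (t - t0) + s by ring.
      by rewrite (le_lt_trans (ler_normD _ _))//; move: td => /=; lra.
    rewrite fE pE /peval comp_mpoly_meval; apply: meval_eq => i.
    by rewrite -(xc _ It) mxE.
  by apply: UB_meval => i; apply: UB_restrict (UBc i) => [t /=|]; lra.
have d20 : 0 < d / 2 by rewrite divr_gt0.
have [xb [Lxb [C xbC]]] := curve_lift GG OG DG gen15 stab15 d20 UBx.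
exists [set t | `|t - t0| < d / 2 / 2], xb; split; split.
- have -> : [set t | `|t - t0| < d / 2 / 2] = ball t0 (d / 2 / 2).
    by apply/seteqP; split=> t /=; rewrite /ball /= distrC.
  exact: ball_open.
- by rewrite /= subrr normr0 !divr_gt0.
- by move=> t /= td; apply: Id; lra.
- move=> t /= td; have td2 : `|t - t0| < d / 2 by lra.
  have [[g gG xbE] _] := Lxb t td2.
  rewrite -xc; last by apply: Id; lra.
  rewrite xbE; apply/matrixP => i j; rewrite !mxE inv_sigma//; exact/memG.
- split=> [t /= td|K _ KJ].
    have td2 : `|t - t0| < d / 2 by lra.
    by have [_ [v /difP[]]] := Lxb t td2.
  exists C; split; first exact: num_real.
  move=> M CM t Kt; apply: ltW; apply: le_lt_trans CM.
  have td : `|t - t0| < d / 2 / 2 := KJ t Kt.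
  have td2 : `|t - t0| < d / 2 by lra.
  have [_ [v D]] := Lxb t td2.
  have -> : derive1 xb t = v by rewrite derive1E; move/difP: D => -[].
  exact: xbC D.
Unshelve. all: by end_near. Qed.

End LiftingProperty.

Theorem mainTheorem13 (R : realType) (P : set 'cV[R]_3)
    (hP : regular_icosahedron P) :
  property_B (rotational_symmetries P) 15.
Proof.
have [s [Q [s0 OQ ->]]] := hP.
apply: (property_B_of_generators (symmetry_group s0 OQ)).
- exact: mem_symmetry_seq.
- exact: symmetry_orthogonal.
- exact: symmetry_det.
- exact: symmetry_gen.
- exact: symmetry_stab.
Qed.
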